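(* Let $\Omega$ be a bounded domain in $\mathbb{H}$ with connected boundary $\partial\Omega$ of class $C^1$. Let $f=f_1+f_2j:\partial\Omega\to\mathbb{H}$ be a continuous function. Suppose that $f$ satisfies (at least) one of the following two conditions: (a) $\displaystyle\int_{\partial\Omega}\overline{f_1}\,\overline\partial_n\phi\,d\sigma=\int_{\partial\Omega}f_2\,L(\phi)\,d\sigma$ for every $\phi\in Harm^1(\overline\Omega)$; (b) $\displaystyle\int_{\partial\Omega}\overline{f_2}\,\overline\partial_n\phi\,d\sigma=-\int_{\partial\Omega}f_1\,L(\phi)\,d\sigma$ for every $\phi\in Harm^1(\overline\Omega)$. Then there exists a (left-)$\psi$-regular function $F$ on $\Omega$, continuous on $\overline\Omega$, such that $F_{|\partial\Omega}=f$.
   Context: Let $\mathbb{H}$ be the quaternions, with basic units $i,j,k$. Identify $\mathbb{C}^2$ with $\mathbb{H}$ by $(z_1,z_2)=(x_0+ix_1,x_2+ix_3)\mapsto q=z_1+z_2j=x_0+ix_1+jx_2+kx_3$; then $aj=j\bar a$ for $a\in\mathbb{C}$. An $\mathbb{H}$-valued function is written $f=f_1+f_2j$ with $f_1,f_2$ complex-valued. A $C^1$ function $f$ is (left-)$\psi$-regular on $\Omega$ if $\left(\frac{\partial}{\partial\bar z_1}+j\frac{\partial}{\partial\bar z_2}\right)f=0$ on $\Omega$; equivalently $\frac{\partial f_1}{\partial\bar z_1}=\frac{\partial\overline{f_2}}{\partial z_2}$ and $\frac{\partial f_1}{\partial\bar z_2}=-\frac{\partial\overline{f_2}}{\partial z_1}$.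 $\Omega=\{\rho<0\}$ with $\rho$ a real function of class $C^1$ on $\mathbb{C}^2$ and $d\rho\neq0$ on $\partial\Omega$; $|\overline\partial\rho|^2=\sum_{k=1}^2\left|\frac{\partial\rho}{\partial\bar z_k}\right|^2$. $Harm^1(\overline\Omega)$ is the space of complex-valued harmonic functions on $\Omega$ of class $C^1$ on $\overline\Omega$, and $d\sigma$ is the Lebesgue surface measure on $\partial\Omega$. For $\phi\in Harm^1(\overline\Omega)$, on $\partial\Omega$, $$\overline\partial_n\phi=\frac1{|\overline\partial\rho|}\sum_{k=1}^2\frac{\partial\rho}{\partial z_k}\frac{\partial\phi}{\partial\bar z_k},\qquad L(\phi)=\frac1{|\overline\partial\rho|}\left(\frac{\partial\rho}{\partial\bar z_2}\frac{\partial\phi}{\partial\bar z_1}-\frac{\partial\rho}{\partial\bar z_1}\frac{\partial\phi}{\partial\bar z_2}\right).$$ *)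

(* Defs.v *)
From HB Require Import structures.
From mathcomp Require Import all_boot all_order all_algebra.
From mathcomp Require Import complex.
From mathcomp Require Import all_classical all_reals all_analysis.

Set Implicit Arguments.
Unset Strict Implicit.
Unset Printing Implicit Defensive.
Import Order.TTheory GRing.Theory Num.Theory numFieldNormedType.Exports.
Local Open Scope classical_set_scope.
Local Open Scope ring_scope.
Local Open Scope complex_scope.

Section Calculus.
Context {R : realType}.

Definition partial {n : nat} {V : normedModType R} (k : 'I_n)
  (f : 'rV[R]_n -> V) (x : 'rV[R]_n) : V := 'D_('e_k) f x.

(* Meant for open [U], where continuity at the points of [U] is continuity
   on [U]. *)
Definition C1_on {n : nat} {V : normedModType R} (U : set 'rV[R]_n)
    (f : 'rV[R]_n -> V) : Prop :=
  forall x, U x ->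
    differentiable f x /\ forall k, {for x, continuous (partial k f)}.

Definition boundary {T : topologicalType} (A : set T) : set T :=
  closure A `\` A°.

(* [u] is of class C^1 on the closure of the open set [U]: [u] and its
   first-order partial derivatives on [U] extend continuously to the closure. *)
Definition C1_closure {n : nat} (U : set 'rV[R]_n) (u : 'rV[R]_n -> R) : Prop :=
  [/\ C1_on U u, {within closure U, continuous u} &
      forall k : 'I_n, exists v : 'rV[R]_n -> R,
        {within closure U, continuous v} /\
        forall x, U x -> v x = partial k u x].

(* For [u] in [C1_closure U] and [x] in the closure of [U], the value at [x] of
   the continuous extension of the [k]-th partial derivative of [u]. *)
Definition ext_partial {n : nat} (U : set 'rV[R]_n) (k : 'I_n)
    (u : 'rV[R]_n -> R) (x : 'rV[R]_n) : R :=
  lim (partial k u y @[y --> within U (nbhs x)]).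

Definition harmonic_on {n : nat} (U : set 'rV[R]_n) (u : 'rV[R]_n -> R) : Prop :=
  [/\ C1_on U u, forall k, C1_on U (partial k u) &
      forall x, U x -> \sum_(k < n) partial k (partial k u) x = 0].

End Calculus.

Section SurfaceMeasure.
Context {R : realType}.

Definition borel (n : nat) := g_sigma_algebraType (@open 'rV[R]_n).

Definition row3 (p : R * R * R) : 'rV[R]_3 :=
  \row_(j < 3) [:: p.1.1; p.1.2; p.2]`_j.

(* The point of R^4 whose [k]-th coordinate is [g y] and whose remaining
   coordinates are, in order, those of [y]. *)
Definition graph_pt (k : 'I_4) (g : 'rV[R]_3 -> R) (y : 'rV[R]_3) : 'rV[R]_4 :=
  \row_(i < 4) if unlift k i is Some j then y 0 j else g y.

Definition lebesgue3 : {measure set (measurableTypeR R * measurableTypeR R *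
    measurableTypeR R) -> \bar R} :=
  (@lebesgue_measure R \x @lebesgue_measure R \x @lebesgue_measure R)%E.

(* [sigma] is the Lebesgue surface measure of the C^1 hypersurface [S]: it is
   carried by [S], and on each piece of [S] that is the graph
   [x_k = g (other coordinates)] of a C^1 function it has the area element
   [sqrt (1 + |grad g|^2) dy]. As such graphs cover [S], this determines
   [sigma]. *)
Definition surface_measure (S : set 'rV[R]_4)
    (sigma : {measure set (borel 4) -> \bar R}) : Prop :=
  sigma (~` S) = 0%E /\
  forall (k : 'I_4) (V : set 'rV[R]_3) (g : 'rV[R]_3 -> R),
    open V -> C1_on V g -> graph_pt k g @` V `<=` S ->
    forall A : set (borel 4), measurable A ->
      sigma (A `&` (graph_pt k g @` V)) =
      (\int[lebesgue3]_(p in [set p | V (row3 p) /\ A (graph_pt k g (row3 p))])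
         (Num.sqrt (1 + \sum_(j < 3) partial j g (row3 p) ^+ 2))%:E)%E.

Definition cintegral (sigma : {measure set (borel 4) -> \bar R})
    (S : set 'rV[R]_4) (h : 'rV[R]_4 -> R[i]) : R[i] :=
  (\int[sigma]_(x in S) complex.Re (h x))%R +i*
  (\int[sigma]_(x in S) complex.Im (h x))%R.

End SurfaceMeasure.

Section Quaternions.
Variable R : realType.

(* The row (x0, x1, x2, x3) stands for the quaternion x0 + i x1 + j x2 + k x3
   and for the point (x0 + i x1, x2 + i x3) of C^2; the complex coordinates
   z_1, z_2 are indexed by 0, 1 : 'I_2. *)
Definition quat := 'rV[R]_4.

Definition re_idx (k : 'I_2) : 'I_4 := inord k.*2.
Definition im_idx (k : 'I_2) : 'I_4 := inord k.*2.+1.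

Definition zcoord (k : 'I_2) (q : quat) : R[i] :=
  q 0 (re_idx k) +i* q 0 (im_idx k).

Definition quat_of (a b : R[i]) : quat :=
  \row_(i < 4) [:: complex.Re a; complex.Im a; complex.Re b; complex.Im b]`_i.

(* (a + b j) (c + d j) = (a c - b d^* ) + (a d + b c^* ) j, from j c = c^* j *)
Definition qmul (p q : quat) : quat :=
  let a := zcoord 0 p in let b := zcoord 1 p in
  let c := zcoord 0 q in let d := zcoord 1 q in
  quat_of (a * c - b * conjc d) (a * d + b * conjc c).

Definition qi : quat := quat_of 'i 0.
Definition qj : quat := quat_of 0 1.

Definition qdbar (k : 'I_2) (F : quat -> quat) (x : quat) : quat :=
  2^-1 *: (partial (re_idx k) F x + qmul qi (partial (im_idx k) F x)).

Definition psi_regular (Omega : set quat) (F : quat -> quat) : Prop :=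
  C1_on Omega F /\
  forall x, Omega x -> qdbar 0 F x + qmul qj (qdbar 1 F x) = 0.

(* d/dz_k and d/dzbar_k in terms of the four real partial derivatives. *)
Definition wirt (k : 'I_2) (D : 'I_4 -> R[i]) : R[i] :=
  2^-1 * (D (re_idx k) - 'i * D (im_idx k)).
Definition wirt_bar (k : 'I_2) (D : 'I_4 -> R[i]) : R[i] :=
  2^-1 * (D (re_idx k) + 'i * D (im_idx k)).

Definition defining_function (rho : quat -> R) (Omega : set quat) : Prop :=
  [/\ C1_on setT rho, Omega = [set x | rho x < 0] &
      forall x, boundary Omega x -> exists k, partial k rho x != 0].

Definition harm1 (Omega : set quat) (phi : quat -> R[i]) : Prop :=
  let u x := complex.Re (phi x) in let v x := complex.Im (phi x) in
  [/\ harmonic_on Omega u, harmonic_on Omega v,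
      C1_closure Omega u & C1_closure Omega v].

Definition rho_z (rho : quat -> R) (k : 'I_2) (x : quat) : R[i] :=
  wirt k (fun j => (partial j rho x)%:C).
Definition rho_zbar (rho : quat -> R) (k : 'I_2) (x : quat) : R[i] :=
  wirt_bar k (fun j => (partial j rho x)%:C).
Definition dbar_rho_norm (rho : quat -> R) (x : quat) : R :=
  Num.sqrt (\sum_(k < 2) Normc.normc (rho_zbar rho k x) ^+ 2).

(* dphi/dzbar_k up to the boundary of [Omega] *)
Definition phi_zbar (Omega : set quat) (phi : quat -> R[i]) (k : 'I_2)
    (x : quat) : R[i] :=
  wirt_bar k (fun j => ext_partial Omega j (fun y => complex.Re (phi y)) x +i*
                       ext_partial Omega j (fun y => complex.Im (phi y)) x).

Definition dbar_n (rho : quat -> R) (Omega : set quat) (phi : quat -> R[i])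
    (x : quat) : R[i] :=
  (dbar_rho_norm rho x)%:C^-1 *
  \sum_(k < 2) rho_z rho k x * phi_zbar Omega phi k x.

Definition Lop (rho : quat -> R) (Omega : set quat) (phi : quat -> R[i])
    (x : quat) : R[i] :=
  (dbar_rho_norm rho x)%:C^-1 *
  (rho_zbar rho 1 x * phi_zbar Omega phi 0 x -
   rho_zbar rho 0 x * phi_zbar Omega phi 1 x).

End Quaternions.

(* Main.v *)
(* Write w = zeta - x, n for the unit normal and sigma for the surface measure.
   The components of the Cauchy-type integral U of f are the potentials
   U_i(x) = int sum_a k_a(x - z) H_ia(z) dsigma(z) of the gradient kernel
   k_a(v) = v_a / |v|^4, where H_ia is linear in n and f and sum_a n_a H_ia = f_i.
   Off the boundary U satisfies the psi-regularity equations, because the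
   derivatives of the k_a form a symmetric matrix of trace 0.

   For x in the exterior E, the function zeta |-> 1/|zeta - x|^2 is an admissible
   test function, and for it condition (a) says that U_0 = U_1 = 0 on E, and
   condition (b) that U_2 = U_3 = 0 on E. In both cases the regularity equations
   make the remaining two components the real and imaginary parts of a function
   which is holomorphic on E and tends to 0 at infinity. By Liouville's theorem
   it vanishes on the complex lines that miss the bounded set Omega, and it
   vanishes on E by the identity theorem: near a boundary point the exterior is
   connected, and the boundary is connected.

   The jump relation now gives the boundary values: if p is a boundary point
   nearest to x in Omega, then x = p - d n and U(x) = U(x) - U(p + d n), and
   k(x - z) - k(p + d n - z) is close to -2 n d / (|z - p|^2 + d^2)^2, a multiple
   of the Poisson kernel, whose integral over the boundary tends to pi^2. Hence
   F = - U / (2 pi^2) extends f. *)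

From HB Require Import structures.
Require Import Defs.
From mathcomp Require Import all_boot all_order all_algebra.
From mathcomp Require Import complex ring lra.
From mathcomp Require Import all_classical all_reals all_analysis measurable_realfun.
Import Order.TTheory GRing.Theory Num.Theory numFieldNormedType.Exports.
Local Open Scope classical_set_scope.
Local Open Scope ring_scope.
Local Open Scope complex_scope.

Set Implicit Arguments.
Unset Strict Implicit.
Unset Printing Implicit Defensive.

(** * Calculus on row vectors *)

(** The boundary is only C^1 and [f] only continuous, which shapes the boundary argument. The kernel
    of the Cauchy-type integral has size |z - p|^-3 on a surface of dimension 3, and the normal
    component of a chord is merely o of its length, with no rate that would restore integrability;
    no principal value on the boundary is available. Vanishing on the exterior removes the obstacle:
    the value at p + d n can be subtracted at no cost, and between two points symmetric about the
    tangent plane the tangential parts of the kernels nearly cancel. The remaining positive kernel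
    is integrable with a mass bounded independently of d, so only that mass has to be known. It is
    found by flattening a small chart onto its tangent plane, which changes areas and squared
    distances by factors close to 1. The constant 2 pi^2 is twice the mass pi^2 of d / (|u|^2 +
    d^2)^2 on R^3; it is also the area of the unit sphere of R^4. *)

Section RowCalculus.
Context {R : realType} {n : nat}.
Implicit Types (v h x y : 'rV[R]_n) (f : 'rV[R]_n -> R).

Lemma norm_coord_le v i : `|v 0 i| <= `|v|.
Proof.
rewrite [leRHS]/Num.Def.normr /= mx_normrE.
exact: (@le_bigmax _ _ _ 0 (fun ij : 'I_1 * 'I_n => `|v ij.1 ij.2|) (0, i)).
Qed.

Lemma norm_row_le v (c : R) : 0 <= c -> (forall i, `|v 0 i| <= c) -> `|v| <= c.
Proof.
move=> c0 vc; rewrite [leLHS]/Num.Def.normr /= mx_normrE.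
by apply: bigmax_le => // -[i j] _ /=; rewrite ord1.
Qed.

Lemma norm_row_lt v (c : R) : 0 < c -> (forall i, `|v 0 i| < c) -> `|v| < c.
Proof.
move=> c0 vc; rewrite [ltLHS]/Num.Def.normr /= mx_normrE.
by apply: bigmax_lt => // -[i j] _ /=; rewrite ord1.
Qed.

Lemma norm_basis_le (k : 'I_n) : `|'e_k : 'rV[R]_n| <= 1.
Proof.
by apply: norm_row_le => // i; rewrite mxE /=; case: (i == k); rewrite ?normr1 ?normr0.
Qed.

(** The norm of a row is the maximum of its coordinates, whereas normals and kernels are Euclidean
    and go through [dot] and [sqn]. In dimension 4 the two norms differ by a factor of at most 2. *)
Definition dot v y : R := \sum_(i < n) v 0 i * y 0 i.
Definition sqn v : R := \sum_(i < n) v 0 i ^+ 2.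

Lemma sqn_ge0 v : 0 <= sqn v.
Proof. by apply: sumr_ge0 => i _; rewrite sqr_ge0. Qed.

Lemma coord2_le_sqn v i : v 0 i ^+ 2 <= sqn v.
Proof.
rewrite /sqn (bigD1 i) //= lerDl; apply: sumr_ge0 => j _; exact: sqr_ge0.
Qed.

Lemma sqn_ge_norm v : `|v| ^+ 2 <= sqn v.
Proof.
have s0 := sqn_ge0 v.
suff : `|v| <= Num.sqrt (sqn v).
  by move=> h; rewrite -(sqr_sqrtr s0) lerXn2r// nnegrE ?sqrtr_ge0.
apply: norm_row_le; first exact: sqrtr_ge0.
by move=> i; rewrite -sqrtr_sqr ler_wsqrtr// coord2_le_sqn.
Qed.

Lemma sqn_le_norm v : sqn v <= n%:R * `|v| ^+ 2.
Proof.
apply: (@le_trans _ _ (\sum_(i < n) `|v| ^+ 2)).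
  apply: ler_sum => i _; rewrite -[leLHS]real_normK ?num_real//.
  by rewrite lerXn2r ?nnegrE// norm_coord_le.
by rewrite sumr_const card_ord mulr_natl.
Qed.

Lemma sqn_eq0 v : (sqn v == 0) = (v == 0).
Proof.
apply/eqP/eqP => [v0|->]; last first.
  by rewrite /sqn big1// => i _; rewrite mxE expr0n.
apply/rowP => i; rewrite mxE; apply/eqP; rewrite -sqrf_eq0 eq_le sqr_ge0 andbT.
by rewrite -v0 coord2_le_sqn.
Qed.

Lemma sqn_gt0 v : (0 < sqn v) = (v != 0).
Proof. by rewrite lt0r sqn_ge0 andbT sqn_eq0. Qed.

Lemma dotvv v : dot v v = sqn v. Proof. by []. Qed.

Lemma dotC v y : dot v y = dot y v.
Proof. by apply: eq_bigr => i _; rewrite mulrC. Qed.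

Lemma dotDl v y x : dot (v + y) x = dot v x + dot y x.
Proof. by rewrite -big_split; apply: eq_bigr => i _; rewrite mxE mulrDl. Qed.

Lemma dotZl (a : R) v y : dot (a *: v) y = a * dot v y.
Proof. by rewrite /dot mulr_sumr; apply: eq_bigr => i _; rewrite mxE mulrA. Qed.

Lemma dotNl v y : dot (- v) y = - dot v y.
Proof. by rewrite -scaleN1r dotZl mulN1r. Qed.

Lemma dotDr v y x : dot x (v + y) = dot x v + dot x y.
Proof. by rewrite dotC dotDl !(dotC x). Qed.

Lemma dotZr (a : R) v y : dot v (a *: y) = a * dot v y.
Proof. by rewrite dotC dotZl dotC. Qed.

Lemma sqnD v y : sqn (v + y) = sqn v + 2 * dot v y + sqn y.
Proof. by rewrite -!dotvv dotDl !dotDr (dotC y v); ring. Qed.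

Lemma sqnZ (a : R) v : sqn (a *: v) = a ^+ 2 * sqn v.
Proof. by rewrite -!dotvv dotZl dotZr; ring. Qed.

Lemma sqnN v : sqn (- v) = sqn v.
Proof. by rewrite -scaleN1r sqnZ sqrrN expr1n mul1r. Qed.

Lemma cauchy_schwarz v y : dot v y ^+ 2 <= sqn v * sqn y.
Proof.
have [->|y0] := eqVneq y 0.
  rewrite /dot big1; last by move=> i _; rewrite mxE mulr0.
  by rewrite expr0n mulr_ge0 ?sqn_ge0.
have sy : 0 < sqn y by rewrite sqn_gt0.
(* This vector is orthogonal to [y], and its squared length is [sqn y] times the defect in the
   inequality. *)
have := sqn_ge0 (sqn y *: v + (- dot v y) *: y).
rewrite sqnD !sqnZ dotZl dotZr => H.
have : 0 <= sqn y * (sqn v * sqn y - dot v y ^+ 2) by nra.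
by rewrite pmulr_rge0// subr_ge0.
Qed.

Lemma row_basis_sum v : v = \sum_(i < n) v 0 i *: 'e_i.
Proof. exact: row_sum_delta. Qed.

Lemma derive_dot f x v : differentiable f x ->
  'D_v f x = \sum_(i < n) v 0 i * partial i f x.
Proof.
move=> df; rewrite deriveE// [v in LHS]row_basis_sum linear_sum.
by apply: eq_bigr => i _; rewrite linearZ /= -deriveE.
Qed.

Lemma is_derive_line f x v t : differentiable f (x + t *: v) ->
  is_derive t 1 (fun s : R => f (x + s *: v)) ('D_v f (x + t *: v)).
Proof.
move=> df.
have dl : is_diff t (fun s : R => x + s *: v) (fun s => s *: v).
  have -> : (fun s : R => x + s *: v) = cst x \+ ( *:%R^~ v) by [].
  apply: is_diff_eq; by rewrite funeqE => s /=; rewrite add0r.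
have dc : differentiable (f \o (fun s : R => x + s *: v)) t.
  exact: differentiable_comp.
apply: DeriveDef; first exact/derivable1_diffP.
rewrite deriveE// diff_comp//= [RHS]deriveE//; congr ('d f _ _).
by rewrite (@diff_val _ _ _ _ _ _ _ dl) /= scale1r.
Qed.

Lemma row_MVT f x v :
  (forall t : R, 0 <= t <= 1 -> differentiable f (x + t *: v)) ->
  exists2 t : R, 0 < t < 1 &
    f (x + v) - f x = \sum_(i < n) v 0 i * partial i f (x + t *: v).
Proof.
move=> df.
have [||c c01] := @MVT R (fun s : R => f (x + s *: v))
   (fun s => 'D_v f (x + s *: v)) 0 1 ltr01.
- move=> t; rewrite in_itv /= => /andP[t0 t1].
  by apply: is_derive_line; apply: df; rewrite !ltW.
- apply: derivable_within_continuous => t; rewrite in_itv /= => t01.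
  by have [] := is_derive_line (df _ t01).
rewrite scale1r scale0r addr0 subr0 mulr1 => ->.
move: c01; rewrite in_itv /= => c01; exists c => //.
by rewrite derive_dot//; apply: df; case/andP: c01 => a b; rewrite !ltW.
Qed.

(** Potentials and implicit functions both come with an explicit first-order estimate; this is the
    common passage from such an estimate to the differential and the partial derivatives. *)
Lemma differentiable_approx f x (a : 'I_n -> R) :
  (forall e, 0 < e -> exists2 d, 0 < d & forall h, `|h| < d ->
     `|f (x + h) - f x - \sum_(i < n) h 0 i * a i| <= e * `|h|) ->
  differentiable f x /\ forall i, partial i f x = a i.
Proof.
move=> H.
pose L h : R := \sum_(i < n) h 0 i * a i.
have Llin : linear L.
  move=> c u w; rewrite /L scaler_sumr -big_split /=; apply: eq_bigr => i _.
  by rewrite !mxE mulrDl -mulrA.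
pose LM := GRing.isLinear.Build _ _ _ _ L Llin.
have [LL LLE] : exists LL : {linear 'rV[R]_n -> R}, LL = L :> (_ -> _).
  by pose LL : {linear 'rV[R]_n -> R} := HB.pack L LM; exists LL.
have Lc : continuous LL.
  move=> y.
  rewrite LLE (_ : L = \sum_(i < n) ((fun h : 'rV[R]_n => h 0 i : R) * cst (a i))); last first.
    by apply/funext => h; rewrite fct_sumE.
  apply: differentiable_continuous; apply: differentiable_sum => i.
  by apply: differentiableM => //; apply: differentiable_coord.
have fL : f \o shift x = cst (f x) + (LL : 'rV[R]_n -> R) +o_ (0 : 'rV[R]_n) id.
  apply/eqaddoP => e e0; have [d d0 Hd] := H _ e0.
  apply/nbhs_ballP; exists d => //= h; rewrite -ball_normE /= sub0r normrN => /Hd dh.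
  change (`|f (h + x) - (f x + LL h)| <= e * `|h|).
  by rewrite LLE opprD addrA (addrC h).
have dE := diff_unique Lc fL.
have df : differentiable f x.
  by apply/diff_locallyP; rewrite dE.
split=> // i; rewrite /partial deriveE// dE LLE /L (bigD1 i)//= mxE !eqxx mul1r.
by rewrite big1 ?addr0// => j ji; rewrite mxE eqxx (negbTE ji) mul0r.
Qed.

Lemma nbhs_rowP x (A : set 'rV[R]_n) :
  nbhs x A <-> exists2 d : R, 0 < d & forall h, `|h| < d -> A (x + h).
Proof.
split=> [/nbhs_ballP[d d0 dA]|[d d0 dA]].
  exists d => // h hd; apply: dA; rewrite -ball_normE /=.
  by rewrite opprD addrA subrr add0r normrN.
apply/nbhs_ballP; exists d => // y; rewrite -ball_normE /= => yd.
by rewrite -(subrKC x y); apply: dA; rewrite distrC.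
Qed.

End RowCalculus.

Section RowC1.
Context {R : realType} {n : nat} {V : normedModType R}.
Implicit Types (U : set 'rV[R]_n) (f g : 'rV[R]_n -> V).

Lemma near_eq_partial (k : 'I_n) f g x :
  {near x, f =1 g} -> partial k f x = partial k g x.
Proof.
rewrite /partial => fg; have [->|ek] := eqVneq ('e_k : 'rV[R]_n) 0.
  by rewrite !derive0.
exact: near_eq_derive.
Qed.

Lemma near_eq_differentiable f g x :
  {near x, f =1 g} -> differentiable f x -> differentiable g x.
Proof.
move=> fg df; have gx : f x = g x by exact: nbhs_singleton fg.
have dg : g \o shift x = cst (g x) + 'd f x +o_ 0 id.
  have := diff_locally df => /eqaddoP Hf.
  apply/eqaddoP => e e0; move: (Hf _ e0); rewrite !nearE => He.
  have fg' : \forall h \near (0 : 'rV[R]_n), f (h + x) = g (h + x).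
    by move: fg; rewrite (near_shift 0) subr0.
  near=> h.
  have -> : (g \o shift x - (cst (g x) + 'd f x)) h =
     (f \o shift x - (cst (f x) + 'd f x)) h.
    change (g (h + x) - (g x + 'd f x h) = f (h + x) - (f x + 'd f x h)).
    by rewrite gx; congr (_ - _); apply/esym; near: h.
  by near: h.
have dE := diff_unique (diff_continuous df) dg.
apply/diff_locallyP; rewrite dE; split=> //; exact: diff_continuous.
Unshelve. all: by end_near. Qed.

Lemma eq_C1_on U f g : open U -> (forall x, U x -> f x = g x) ->
  C1_on U f -> C1_on U g.
Proof.
move=> oU fg C1 x Ux; have [df pf] := C1 _ Ux.
have nU : nbhs x U by apply: open_nbhs_nbhs.
have nfg : forall y, U y -> {near y, f =1 g}.
  move=> y Uy; have : nbhs y U by apply: open_nbhs_nbhs.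
  by apply: filterS => z /fg.
split; first exact: near_eq_differentiable (nfg _ Ux) df.
move=> k; have := pf k; rewrite /prop_for /continuous_at (near_eq_partial k (nfg _ Ux)) => pk.
have E : {near x, partial k f =1 partial k g}.
  by apply: filterS nU => y Uy; rewrite (near_eq_partial k (nfg _ Uy)).
by apply: cvg_trans pk; exact: (near_eq_cvg E).
Qed.

End RowC1.

Lemma continuous_rowP {R : realType} {n : nat} (f : 'rV[R]_n -> R) (x : 'rV[R]_n) :
  {for x, continuous f} <->
  forall e, 0 < e -> exists2 d, 0 < d & forall h, `|h| < d -> `|f (x + h) - f x| <= e.
Proof.
split=> [cf e e0|H].
  have /nbhs_rowP[d d0 Hd] : nbhs x (fun y => `|f x - f y| <= e).
    by move/cvgrPdist_le : cf; apply.
  by exists d => // h /Hd; rewrite distrC.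
have FF : Filter (nbhs x) by apply: nbhs_filter.
apply/(@cvgrPdist_le _ _ _ (nbhs x) FF) => e e0; have [d d0 Hd] := H _ e0.
by apply/nbhs_rowP; exists d => // h /Hd; rewrite distrC.
Qed.

(** * Integrals over a compact set *)

Section WithinContinuous.
Context {R : realType} {T : topologicalType} (S : set T).
Implicit Types f g : T -> R.

Lemma within_continuous_fun f : (forall x, S x -> {for x, continuous f}) ->
  {within S, continuous f}.
Proof. by move=> cf; apply: continuous_in_subspaceT => x /set_mem /cf. Qed.

Lemma within_continuousD f g : {within S, continuous f} ->
  {within S, continuous g} -> {within S, continuous (fun x => f x + g x)}.
Proof. by move=> cf cg x; apply: continuousD; [exact: cf|exact: cg]. Qed.

Lemma within_continuousM f g : {within S, continuous f} ->
  {within S, continuous g} -> {within S, continuous (fun x => f x * g x)}.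
Proof. by move=> cf cg x; apply: continuousM; [exact: cf|exact: cg]. Qed.

Lemma within_continuous_cst (c : R) : {within S, continuous (fun=> c)}.
Proof. by move=> x; apply: cst_continuous. Qed.

Lemma within_continuousN f : {within S, continuous f} ->
  {within S, continuous (fun x => - f x)}.
Proof. by move=> cf x; apply: continuousN; exact: cf. Qed.

Lemma within_continuous_norm f : {within S, continuous f} ->
  {within S, continuous (fun x => `|f x|)}.
Proof.
by move=> cf x; apply: continuous_comp; [exact: cf|exact: norm_continuous].
Qed.

Lemma within_continuous_sum (I : finType) (F : I -> T -> R) :
  (forall i, {within S, continuous (F i)}) ->
  {within S, continuous (fun x => \sum_i F i x)}.
Proof.
move=> cF; elim: (index_enum I) => [|j s IHs].
  rewrite (_ : (fun x => _) = (fun=> 0)); first exact: within_continuous_cst.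
  by apply/funext => x; rewrite big_nil.
rewrite (_ : (fun x => _) = (fun x => F j x + \sum_(i <- s) F i x)).
  exact: within_continuousD.
by apply/funext => x; rewrite big_cons.
Qed.

Lemma within_continuous_bounded f : compact S -> {within S, continuous f} ->
  exists2 M, 0 < M & forall x, S x -> `|f x| <= M.
Proof.
move=> cS cf; have /compact_bounded[M [_ mrt]] := continuous_compact cf cS.
exists (`|M| + 1); first by rewrite ltr_wpDl.
move=> x Sx; apply: (mrt (`|M| + 1)); first by rewrite ltr_pwDr// ler_norm.
by exists x.
Qed.

End WithinContinuous.

Section BorelIntegral.
Context {R : realType} {n : nat}.
Variables (sigma : {measure set (@borel R n) -> \bar R}) (S : set 'rV[R]_n).
Hypotheses (cS : compact S) (finS : (sigma S < +oo)%E).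
Implicit Types f g h k : 'rV[R]_n -> R.

Lemma borel_open (U : set 'rV[R]_n) : open U -> measurable (U : set (borel n)).
Proof. by move=> oU; apply: sub_gen_smallest. Qed.

Lemma borel_closed (U : set 'rV[R]_n) : closed U -> measurable (U : set (borel n)).
Proof. by move=> cU; rewrite -(setCK U); apply: measurableC; apply: borel_open; exact: closed_openC. Qed.

Lemma compact_borel : measurable (S : set (borel n)).
Proof. by apply: borel_closed; apply: compact_closed => //; exact: norm_hausdorff. Qed.

Lemma within_continuous_measurable (D : set 'rV[R]_n) f :
  measurable (D : set (borel n)) ->
  {within D, continuous f} -> measurable_fun (D : set (borel n)) (f : borel n -> R).
Proof.
move=> mD /continuousP cf; apply: (measurability _ (measurable_realfun.RGenOpens.measurableE R)).
move=> _ [_ [a [b ->] <-]].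
have oP : open (from_subspace D f @^-1` `]a, b[) by exact/cf/interval_open.
have [U oU UE] := (open_subspaceP _ _).1 oP.
have -> : D `&` f @^-1` `]a, b[ = D `&` U.
  by rewrite setIC [RHS]setIC; exact: esym UE.
by apply: measurableI => //; exact: borel_open.
Qed.

(** The real-valued integral is linear and monotone only on integrable functions; compactness of [S]
    and its finite mass supply integrability for everything continuous on [S]. *)
Lemma within_continuous_integrable f : {within S, continuous f} ->
  sigma.-integrable S (EFin \o f).
Proof.
move=> cf; apply: measurable_bounded_integrable => //.
- exact: compact_borel.
- by apply: within_continuous_measurable => //; exact: compact_borel.
- have [M M0 MH] := within_continuous_bounded cS cf.
  by exists M; split; rewrite ?num_real// => x Mx y Sy; apply: le_trans (MH _ Sy) (ltW Mx).
Qed.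

Local Notation I f := (\int[sigma]_(z in S) f z).

Lemma sintD f g : {within S, continuous f} -> {within S, continuous g} ->
  I (fun z => f z + g z) = I f + I g.
Proof.
move=> cf cg; apply: RintegralD; first exact: compact_borel.
  exact: within_continuous_integrable.
exact: within_continuous_integrable.
Qed.

Lemma sintB f g : {within S, continuous f} -> {within S, continuous g} ->
  I (fun z => f z - g z) = I f - I g.
Proof.
move=> cf cg; apply: RintegralB; first exact: compact_borel.
  exact: within_continuous_integrable.
exact: within_continuous_integrable.
Qed.

Lemma sintZ (c : R) f : {within S, continuous f} ->
  I (fun z => c * f z) = c * I f.
Proof.
move=> cf; apply: RintegralZl; first exact: compact_borel.
exact: within_continuous_integrable.
Qed.

Lemma sint_sum (J : finType) (F : J -> 'rV[R]_n -> R) :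
  (forall i, {within S, continuous (F i)}) ->
  I (fun z => \sum_i F i z) = \sum_i I (F i).
Proof.
move=> cF; elim: (index_enum J) => [|j s IHs].
  rewrite big_nil (_ : (fun z => _) = (fun=> 0)); last by apply/funext => z; rewrite big_nil.
  by rewrite Rintegral_cst ?mul0r//; exact: compact_borel.
rewrite big_cons -IHs -sintD//.
  by apply: eq_Rintegral => z _; rewrite big_cons.
elim: s {IHs} => [|i s IHs].
  rewrite (_ : (fun z => _) = (fun=> 0)); last by apply/funext => z; rewrite big_nil.
  exact: within_continuous_cst.
rewrite (_ : (fun z => _) = (fun z => F i z + \sum_(i <- s) F i z)).
  exact: within_continuousD.
by apply/funext => z; rewrite big_cons.
Qed.

Lemma sint_le f g : {within S, continuous f} -> {within S, continuous g} ->
  (forall z, S z -> f z <= g z) -> I f <= I g.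
Proof.
move=> cf cg fg; apply: le_Rintegral => //; first exact: compact_borel.
  exact: within_continuous_integrable.
exact: within_continuous_integrable.
Qed.

Lemma sint_norm_le f g : {within S, continuous f} -> {within S, continuous g} ->
  (forall z, S z -> `|f z| <= g z) -> `|I f| <= I g.
Proof.
move=> cf cg fg; apply: (le_trans (le_normr_Rintegral _ _)) => //.
- exact: compact_borel.
- exact: within_continuous_integrable.
- by apply: sint_le => //; exact: within_continuous_norm.
Qed.

Definition potential k h (x : 'rV[R]_n) : R := \int[sigma]_(z in S) (k (x - z) * h z).

Definition continuous_off0 k := forall v : 'rV[R]_n, v != 0 -> {for v, continuous k}.

Lemma off_sub x z : ~ S x -> S z -> x - z != 0.
Proof. by move=> nSx Sz; apply/eqP => /subr0_eq xz; apply: nSx; rewrite xz. Qed.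

Lemma kernel_within k x : continuous_off0 k -> ~ S x ->
  {within S, continuous (fun z => k (x - z))}.
Proof.
move=> ck nSx; apply: within_continuous_fun => z Sz.
apply: continuous_comp; last exact/ck/off_sub.
by apply: continuousB; [exact: cst_continuous|exact: cvg_id].
Qed.

Lemma potential_within k h x : continuous_off0 k -> {within S, continuous h} ->
  ~ S x -> {within S, continuous (fun z => k (x - z) * h z)}.
Proof. by move=> ck ch nSx; apply: within_continuousM => //; exact: kernel_within. Qed.

(** The kernel may be singular at 0, but [x] is off the compact set [S]: each point of [S] has a
    neighbourhood on which the bound holds for all small [y], and compactness makes the radius
    common. *)
Lemma kernel_unif k x e : continuous_off0 k -> ~ S x -> 0 < e ->
  exists2 d, 0 < d & forall y, `|y| < d -> forall z, S z ->
    `|k (x + y - z) - k (x - z)| <= e.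
Proof.
move=> ck nSx e0.
have /nbhs_rowP[d d0 Hd] : nbhs (0 : 'rV[R]_n)
    [set y | forall z, S z -> `|k (x + y - z) - k (x - z)| <= e]; last first.
  by exists d => // y /Hd; rewrite add0r.
apply: ((iffLR (compact_near_coveringP S) cS) 'rV[R]_n (nbhs (0 : 'rV[R]_n))
   (fun y z => `|k (x + y - z) - k (x - z)| <= e)).
move=> z Sz.
  have /continuous_rowP/(_ (e / 2))[|d d0 Hd] : {for x - z, continuous k}.
  - exact/ck/off_sub.
  - by rewrite divr_gt0.
  have d20 : 0 < d / 2 by rewrite divr_gt0.
  exists ([set z' | `|z - z'| < d / 2], [set y | `|y| < d / 2]) => /=.
    split; apply/nbhs_ballP; exists (d / 2) => //= y.
      by rewrite -ball_normE.
    by rewrite -ball_normE /= sub0r normrN.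
  move=> [z' y] /= [zz' yd].
  have -> : k (x + y - z') - k (x - z') =
    (k (x + y - z') - k (x - z)) - (k (x - z') - k (x - z)) by ring.
  apply: le_trans (ler_normB _ _) _; rewrite (splitr e) lerD//.
    have -> : x + y - z' = x - z + (y + (z - z')).
      by apply/rowP => i; rewrite !mxE; ring.
    by apply/Hd; apply: le_lt_trans (ler_normD _ _) _; rewrite (splitr d) ltrD.
  have -> : x - z' = x - z + (z - z') by rewrite addrA subrK.
  by apply/Hd; apply: lt_trans zz' _; rewrite ltr_pdivrMr// ltr_pMr// ltr1n.
Qed.

Lemma off_ball x : ~ S x ->
  exists2 d : R, 0 < d & forall y, `|y| < d -> ~ S (x + y).
Proof.
move=> nSx; have /nbhs_rowP[d d0 Hd] : nbhs x (~` S); last by exists d.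
apply: open_nbhs_nbhs; split => //; apply: closed_openC.
by apply: compact_closed => //; exact: norm_hausdorff.
Qed.

(** Differentiation under the integral sign: the mean value theorem on the segment from [x - z] to
    [x + y - z] turns the remainder into increments of the [kd i], which are small uniformly in [z]
    by [kernel_unif]. *)
Lemma potential_diff k (kd : 'I_n -> 'rV[R]_n -> R) h x :
  (forall v, v != 0 -> differentiable k v /\ forall i, partial i k v = kd i v) ->
  (forall i, continuous_off0 (kd i)) -> {within S, continuous h} ->
  ~ S x -> differentiable (potential k h) x /\
    forall i, partial i (potential k h) x = potential (kd i) h x.
Proof.
move=> dk ckd ch nSx.
have ck : continuous_off0 k.
  by move=> v /dk[dkv _]; exact: differentiable_continuous.
apply: differentiable_approx => e e0.
pose M := I (fun z => `|h z|).
have M0 : 0 <= M by apply: Rintegral_ge0.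
have Mn0 : 0 < n%:R * M + 1 by rewrite ltr_wpDl// mulr_ge0.
(* The [n] coordinates of [y] and the integral of [|h|] cost a factor [n * M] in the end; the added
   1 covers [M = 0]. *)
have e1 : 0 < e / (n%:R * M + 1) by rewrite divr_gt0.
have [d d0 Hd] : exists2 d, 0 < d & forall y, `|y| < d -> forall z, S z ->
    forall i, `|kd i (x + y - z) - kd i (x - z)| <= e / (n%:R * M + 1).
  have /choice[dd ddP] : forall i, exists d, 0 < d /\ forall y, `|y| < d -> forall z, S z ->
    `|kd i (x + y - z) - kd i (x - z)| <= e / (n%:R * M + 1).
    by move=> i; have [d ? ?] := kernel_unif (ckd i) nSx e1; exists d.
  exists (\big[Num.min/1]_i dd i).
    by elim/big_ind : _ => // [a b a0 b0|i _]; [rewrite lt_min a0|case: (ddP i)].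
  move=> y yd z Sz i; apply: (ddP i).2 => //; apply: lt_le_trans yd _.
  exact: bigmin_le.
(* Within this radius the whole segment avoids [S], so the kernel is differentiable along it. *)
have [d2 d20 H2] := off_ball nSx.
exists (Num.min d d2); first by rewrite lt_min d0.
move=> y; rewrite lt_min => /andP[yd yd2].
have c1 : {within S, continuous (fun z => k (x + y - z) * h z)}.
  by apply: potential_within => //; exact: H2.
have c2 : {within S, continuous (fun z => k (x - z) * h z)} by exact: potential_within.
have c3 i : {within S, continuous (fun z => y 0 i * (kd i (x - z) * h z))}.
  by apply: within_continuousM; [exact: within_continuous_cst|exact: potential_within].
have c4 := within_continuous_sum c3.
have c12 : {within S, continuous (fun z => k (x + y - z) * h z - k (x - z) * h z)}.
  by apply: within_continuousD => //; exact: within_continuousN.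
have -> : potential k h (x + y) - potential k h x -
  \sum_(i < n) y 0 i * potential (kd i) h x =
  I (fun z => k (x + y - z) * h z - k (x - z) * h z -
     \sum_(i < n) y 0 i * (kd i (x - z) * h z)).
  rewrite sintB// sintB// sint_sum//; congr (_ - _); apply: eq_bigr => i _.
  by rewrite sintZ//; exact: potential_within.
apply: (@le_trans _ _ (I (fun z => n%:R * (`|y| * (e / (n%:R * M + 1))) * `|h z|))).
  apply: sint_norm_le.
  - by apply: within_continuousD => //; exact: within_continuousN.
  - apply: within_continuousM; first exact: within_continuous_cst.
    exact: within_continuous_norm.
  move=> z Sz.
  have [t /andP[t0 t1] tE] : exists2 t : R, 0 < t < 1 &
      k (x - z + y) - k (x - z) = \sum_(i < n) y 0 i * partial i k (x - z + t *: y).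
    apply: row_MVT => t /andP[t0 t1]; apply: (dk _ _).1.
    rewrite addrAC; apply: off_sub => //; apply: H2.
    by rewrite normrZ ger0_norm//; apply: le_lt_trans yd2; rewrite ler_piMl.
  have yt : `|t *: y| < d.
    by rewrite normrZ gtr0_norm//; apply: le_lt_trans yd; rewrite ler_piMl// ltW.
  have yt2 : `|t *: y| < d2.
    by rewrite normrZ gtr0_norm//; apply: le_lt_trans yd2; rewrite ler_piMl// ltW.
  have -> : k (x + y - z) * h z - k (x - z) * h z -
      \sum_(i < n) y 0 i * (kd i (x - z) * h z) =
     (\sum_(i < n) y 0 i * (kd i (x + t *: y - z) - kd i (x - z))) * h z.
    rewrite -mulrBl (addrAC x y) tE mulr_suml mulr_suml -sumrB.
    have nz : x - z + t *: y != 0 by rewrite addrAC; apply: off_sub => //; exact: H2.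
    apply: eq_bigr => i _; rewrite (dk _ nz).2 (addrAC x (- z)).
    by rewrite mulrBr mulrBl mulrA.
  rewrite normrM ler_wpM2r//; apply: le_trans (ler_norm_sum _ _ _) _.
  apply: (@le_trans _ _ (\sum_(i < n) `|y| * (e / (n%:R * M + 1)))).
    apply: ler_sum => i _; rewrite normrM ler_pM//; first exact: norm_coord_le.
    exact: Hd.
  by rewrite sumr_const card_ord -[leLHS]mulr_natl.
rewrite sintZ; last exact: within_continuous_norm.
rewrite -/M (_ : n%:R * (`|y| * (e / (n%:R * M + 1))) * M =
   e * `|y| * (n%:R * M / (n%:R * M + 1))); last first.
  by field; rewrite gt_eqF.
by rewrite ler_piMr ?mulr_ge0 ?(ltW e0)// ler_pdivrMr// mul1r ler_wpDr.
Qed.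

End BorelIntegral.

(** * The kernels *)

Section Gradient.
Context {R : realType} {n : nat}.
Implicit Types (f g : 'rV[R]_n -> R) (v : 'rV[R]_n).

(** Carrying the values of the partial derivatives together with differentiability lets the rules
    below assemble the gradient of a formula, so that only a ring identity is left. *)
Definition has_grad f v (df : 'I_n -> R) :=
  differentiable f v /\ forall i, partial i f v = df i.

Lemma has_grad_eq f v df dg : has_grad f v df -> (forall i, df i = dg i) ->
  has_grad f v dg.
Proof. by move=> [? H] E; split => // i; rewrite H. Qed.

Lemma has_grad_cst (c : R) v : has_grad (fun=> c) v (fun=> 0).
Proof. by split; [exact: differentiable_cst|move=> i; exact: derive_cst]. Qed.

Lemma has_grad_coord a v : has_grad (fun w => w 0 a) v (fun i => (a == i)%:R).
Proof.
split; first exact: differentiable_coord.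
move=> i; rewrite /partial /derive; apply: cvg_lim => //.
apply: cvg_near_cst; near=> h.
have h0 : h != 0 by near: h; exact: nbhs_dnbhs_neq.
rewrite /= !mxE eqxx /= addrK /GRing.scale /= mulrA mulVf// mul1r.
by rewrite eq_sym.
Unshelve. all: by end_near. Qed.

Lemma has_gradD f g v df dg : has_grad f v df -> has_grad g v dg ->
  has_grad (fun w => f w + g w) v (fun i => df i + dg i).
Proof.
move=> [f1 f2] [g1 g2]; split; first exact: differentiableD.
by move=> i; rewrite -f2 -g2; apply: deriveD; exact: diff_derivable.
Qed.

Lemma has_gradM f g v df dg : has_grad f v df -> has_grad g v dg ->
  has_grad (fun w => f w * g w) v (fun i => f v * dg i + g v * df i).
Proof.
move=> [f1 f2] [g1 g2]; split; first exact: differentiableM.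
by move=> i; rewrite -f2 -g2; apply: deriveM; exact: diff_derivable.
Qed.

Lemma has_gradZ (c : R) f v df : has_grad f v df ->
  has_grad (fun w => c * f w) v (fun i => c * df i).
Proof.
move=> fv; apply: has_grad_eq (has_gradM (has_grad_cst c v) fv) _ => i.
by rewrite mulr0 addr0.
Qed.

Lemma has_grad_sum (I : finType) (F : I -> 'rV[R]_n -> R) v (dF : I -> 'I_n -> R) :
  (forall j, has_grad (F j) v (dF j)) ->
  has_grad (fun w => \sum_j F j w) v (fun i => \sum_j dF j i).
Proof.
move=> cF; elim: (index_enum I) => [|j s IHs].
  rewrite (_ : (fun w => _) = (fun=> 0)); last by apply/funext => x; rewrite big_nil.
  by apply: has_grad_eq (has_grad_cst 0 v) _ => i; rewrite big_nil.
rewrite (_ : (fun w => _) = (fun w => F j w + \sum_(i <- s) F i w)).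
  by apply: has_grad_eq (has_gradD (cF j) IHs) _ => i; rewrite big_cons.
by apply/funext => x; rewrite big_cons.
Qed.

Lemma has_gradV f v df : f v != 0 -> has_grad f v df ->
  has_grad (fun w => (f w)^-1) v (fun i => - (f v)^-1 ^+ 2 * df i).
Proof.
move=> fv0 [f1 f2]; split; first exact: differentiableV.
move=> i; rewrite -f2 /partial (deriveV fv0); last exact: diff_derivable.
by rewrite /GRing.scale /= exprVn.
Qed.

Lemma has_grad_sqn v : has_grad (@sqn R n) v (fun i => 2 * v 0 i).
Proof.
apply: has_grad_eq (has_grad_sum (fun j => has_gradM (has_grad_coord j v) (has_grad_coord j v))) _.
move=> i; rewrite (bigD1 i)//= eqxx big1 => [|j /negbTE ->]; last by rewrite mulr0 addr0.
by rewrite !mulr1 addr0 mulr2n mulrDl mul1r.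
Qed.

End Gradient.

Section Kernels.
Context {R : realType} {n : nat}.
Implicit Types (v : 'rV[R]_n) (a b c : 'I_n).

(** In dimension 4 this is, up to a constant, the fundamental solution of the Laplacian. [ker a] is
    -1/2 times its partial derivative in direction [a]; [ker1] and [ker2] are the next two orders of
    differentiation. *)
Definition newton v : R := (sqn v)^-1.
Definition ker a v : R := v 0 a * newton v ^+ 2.
Definition ker1 a b v : R :=
  (a == b)%:R * newton v ^+ 2 - 4 * (v 0 a * v 0 b) * newton v ^+ 3.
Definition ker2 a b c v : R :=
  - 4 * ((a == b)%:R * v 0 c + (a == c)%:R * v 0 b + (b == c)%:R * v 0 a) *
  newton v ^+ 3 + 24 * (v 0 a * v 0 b * v 0 c) * newton v ^+ 4.

Lemma has_grad_newton v : v != 0 ->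
  has_grad newton v (fun i => - 2 * v 0 i * newton v ^+ 2).
Proof.
rewrite -sqn_eq0 => v0; apply: has_grad_eq (has_gradV v0 (has_grad_sqn v)) _ => i.
by rewrite /newton; ring.
Qed.

Lemma has_grad_newtonX v k : v != 0 ->
  has_grad (fun w => newton w ^+ k) v (fun i => - 2 * k%:R * v 0 i * newton v ^+ k.+1).
Proof.
move=> v0; elim: k => [|k IH].
  apply: has_grad_eq (has_grad_cst 1 v) _ => i; ring.
rewrite (_ : (fun w => _) = (fun w => newton w * newton w ^+ k)).
  apply: has_grad_eq (has_gradM (has_grad_newton v0) IH) _ => i.
  by rewrite -natr1 !exprS; ring.
by apply/funext => w; rewrite exprS.
Qed.

Lemma has_grad_ker a v : v != 0 -> has_grad (ker a) v (fun i => ker1 a i v).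
Proof.
move=> v0; apply: has_grad_eq
  (has_gradM (has_grad_coord a v) (has_grad_newtonX 2 v0)) _ => i.
by rewrite /ker1; ring.
Qed.

Lemma has_grad_ker1 a b v : v != 0 -> has_grad (ker1 a b) v (fun i => ker2 a b i v).
Proof.
move=> v0.
have N2 := has_grad_newtonX 2 v0; have N3 := has_grad_newtonX 3 v0.
have A := has_grad_coord a v; have B := has_grad_coord b v.
have := has_gradD (has_gradZ (a == b)%:R N2)
   (has_gradZ (-1) (has_gradM (has_gradZ 4 (has_gradM A B)) N3)).
rewrite [X in has_grad X](_ : _ = ker1 a b); last first.
  by apply/funext => w; rewrite /ker1; ring.
by move=> H; apply: has_grad_eq H _ => i; rewrite /ker2; ring.
Qed.

Lemma differentiable_ker2 a b c v : v != 0 -> differentiable (ker2 a b c) v.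
Proof.
move=> v0.
have N3 := has_grad_newtonX 3 v0; have N4 := has_grad_newtonX 4 v0.
have A := has_grad_coord a v; have B := has_grad_coord b v.
have C := has_grad_coord c v.
by have [] := has_gradD (has_gradM (has_gradZ (- 4) (has_gradD (has_gradD
  (has_gradZ (a == b)%:R C) (has_gradZ (a == c)%:R B)) (has_gradZ (b == c)%:R A))) N3)
  (has_gradM (has_gradZ 24 (has_gradM (has_gradM A B) C)) N4).
Qed.

Lemma ker1C a b v : ker1 a b v = ker1 b a v.
Proof. by rewrite /ker1 eq_sym; congr (_ - _); ring. Qed.

Lemma ker2C23 a b c v : ker2 a b c v = ker2 a c b v.
Proof. by rewrite /ker2 (eq_sym b c); ring. Qed.

Lemma kerN a v : ker a (- v) = - ker a v.
Proof. by rewrite /ker /newton sqnN mxE mulNr. Qed.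

End Kernels.

(** This is the harmonicity of the Newtonian kernel: the diagonal contributes the dimension 4, which
    cancels the 4 produced by differentiating |v|^-4. *)
Lemma ker1_trace {R : realType} (v : 'rV[R]_4) : v != 0 -> \sum_(a < 4) ker1 a a v = 0.
Proof.
move=> v0; have q0 : sqn v != 0 by rewrite sqn_eq0.
rewrite /ker1 sumrB -!mulr_suml -mulr_sumr.
rewrite [X in X * _ - _](_ : _ = 4); last first.
  by rewrite (eq_bigr (fun=> 1)) ?sumr_const ?card_ord// => i _; rewrite eqxx.
rewrite (_ : \sum_(i < 4) v 0 i * v 0 i = sqn v)//.
by rewrite /newton; field.
Qed.

(** * The Poisson integral of a hyperplane *)

Section LineIntegrals.
Context {R : realType}.
Local Notation mu := (@lebesgue_measure R).
Implicit Types (f F H : R -> R) (A B c l t : R).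

(** The line is cut at 0; the negative half is reflected, with antiderivative - F (- t), and the two
    values at 0 cancel. *)
Lemma ge0_integral_line f F l : (forall t, 0 <= f t) -> continuous f ->
  (forall t : R, is_derive t 1 F (f t)) ->
  F t @[t --> +oo] --> l -> F (- t) @[t --> +oo] --> - l ->
  (\int[mu]_t (f t)%:E = (2 * l)%:E)%E.
Proof.
move=> f0 cf dF Fy FNy.
have mf : measurable_fun [set: R] f by exact: continuous_measurable_fun.
have mposnums : measurable [set t : R | 0 <= t] by rewrite -set_itvcy.
have cF : continuous F.
  by move=> t; apply: differentiable_continuous; apply/derivable1_diffP.
have Fhalf : (\int[mu]_(t in `[0%R, +oo[) (f t)%:E = l%:E - (F 0)%:E)%E.
  apply: ge0_continuous_FTC2y => //.
  - exact: continuous_subspaceT.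
  - by apply: cvg_at_right_filter; exact: cF.
  - by move=> t _; rewrite derive1E; apply: derive_val.
have Fhalf' : (\int[mu]_(t in `[0%R, +oo[) (f (- t))%:E = l%:E - (- F 0)%:E)%E.
  have dG t : is_derive t 1 (fun t => - F (- t)) (f (- t)).
    have dN : is_derive t 1 (-%R : R -> R) (-1) by exact: is_deriveNid.
    have := @is_deriveN _ _ _ _ t 1 _ (@is_derive1_comp R F (fun t => - t) t _ _ (dF (- t)) dN).
    by rewrite mulrN1 opprK.
  have := @ge0_continuous_FTC2y R (fun t => f (- t)) (fun t => - F (- t)) 0 l.
  rewrite oppr0; apply => //.
  - apply: continuous_subspaceT => t.
    by apply: continuous_comp; [exact: opp_continuous|exact: cf].
  - by rewrite -[X in _ --> X]opprK; apply: cvgN.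
  - rewrite -[in X in _ --> X](oppr0 R); apply: cvg_at_right_filter.
    apply: cvgN; apply: continuous_comp; [exact: opp_continuous|exact: cF].
  - by move=> t _; rewrite derive1E; apply: derive_val.
rewrite -(setUv [set t : R | 0 <= t]) ge0_integral_setU//= ; last 4 first.
- exact: measurableC.
- by apply/measurable_EFinP; rewrite setUv.
- by move=> x _; rewrite lee_fin.
- exact/disj_setPCl.
rewrite -set_itvcy// setCitvr Fhalf.
rewrite integral_itv_bndo_bndc; last exact/measurable_EFinP/measurable_funTS.
have Hs := @ge0_integration_by_substitutionNy R f 0; rewrite oppr0 in Hs.
rewrite Hs//; last exact: continuous_subspaceT.
rewrite Fhalf' -!EFinB -EFinD; congr (_%:E); ring.
Qed.

(** Limits at infinity become values at 0 of a function continuous in 1/t. *)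
Lemma cvgy_inv F H : {for 0, continuous H} -> (forall t, 0 < t -> F t = H t^-1) ->
  F t @[t --> +oo] --> H 0.
Proof.
move=> cH FH.
have iv : (t : R)^-1 @[t --> +oo] --> (0 : R).
  by apply/gtr0_cvgV0 => //; exact: nbhs_pinfty_gt.
apply: cvg_trans (cvg_comp _ _ iv cH).
by apply: near_eq_cvg; exists 0; split => // t t0 /=; rewrite FH.
Qed.

Lemma cvgy_shift (T : topologicalType) (F : R -> T) (l : T) c :
  F t @[t --> +oo] --> l -> F (t + c) @[t --> +oo] --> l.
Proof.
move=> Fl; apply: (cvg_comp (fun t => t + c) F _ Fl).
by apply/cvgryPge => A; exists (A - c); split; [exact: num_real|move=> t]; move=> /ltW; rewrite lerBlDr.
Qed.

Lemma integral_line_odd f F l c : (forall t, 0 <= f t) -> continuous f ->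
  (forall t : R, is_derive t 1 F (f t)) -> (forall t, F (- t) = - F t) ->
  F t @[t --> +oo] --> l ->
  (\int[mu]_t (f (t + c))%:E = (2 * l)%:E)%E.
Proof.
move=> f0 cf dF oF Fl; apply: (@ge0_integral_line _ (fun t => F (t + c))) => //.
- move=> t; apply: continuous_comp; last exact: cf.
  by apply: continuousD; [exact: cvg_id|exact: cst_continuous].
- move=> t; have dS : is_derive t 1 (fun t => t + c) 1.
    by apply: is_derive_eq; rewrite addr0.
  by have := @is_derive1_comp R F (fun t => t + c) t _ _ (dF (t + c)) dS; rewrite mulr1.
- exact: cvgy_shift.
- rewrite (_ : (fun t => _) = (fun t => - F (t + - c))).
    by apply: cvgN; exact: cvgy_shift.
  by apply/funext => t; rewrite -oF opprD opprK.
Qed.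

Section Quadratic.
Variables (A B : R).
Hypotheses (A0 : 0 < A) (B0 : 0 < B).
Local Notation X t := (A + B * t ^+ 2).
Local Notation a := (Num.sqrt A).
Local Notation b := (Num.sqrt B).

Let X0 t : 0 < X t.
Proof. by rewrite ltr_pwDl// mulr_ge0 ?sqr_ge0// ltW. Qed.
Let Xn0 t : X t != 0. Proof. by rewrite gt_eqF. Qed.
Let a0 : 0 < a. Proof. by rewrite sqrtr_gt0. Qed.
Let b0 : 0 < b. Proof. by rewrite sqrtr_gt0. Qed.
Let aa : a ^+ 2 = A. Proof. by rewrite sqr_sqrtr// ltW. Qed.
Let bb : b ^+ 2 = B. Proof. by rewrite sqr_sqrtr// ltW. Qed.

Let dX t : is_derive t 1 (fun t => X t) (2 * B * t).
Proof.
by apply: is_derive_eq; rewrite /GRing.scale /=; ring.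
Qed.

Let cX : continuous (fun t => X t).
Proof.
by move=> t; apply: differentiable_continuous; apply/derivable1_diffP; case: (dX t).
Qed.

Let dV t : is_derive t 1 (fun t => (X t)^-1) (- (2 * B * t) / X t ^+ 2).
Proof.
have := is_deriveV (f:=fun t => X t) (Xn0 t) (dX t).
by rewrite /GRing.scale /= mulNr mulrC mulNr.
Qed.

Let dat t : is_derive t 1 (fun t => atan (b / a * t)) (a * b / X t).
Proof.
have dl : is_derive t 1 (fun t => b / a * t) (b / a).
  by apply: is_derive_eq; rewrite /GRing.scale /= mulr1.
have := @is_derive1_comp R (@atan R) (fun t => b / a * t) t _ _ (is_derive1_atan (b / a * t)) dl.
congr is_derive; rewrite /GRing.scale /=.
have -> : X t = a ^+ 2 + b ^+ 2 * t ^+ 2 by rewrite aa bb.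
have h := Xn0 t; rewrite -aa -bb in h.
field; apply/andP; split; last by rewrite gt_eqF.
by apply: contra_neq h => h; rewrite -[RHS]h; ring.
Qed.

Let cvg_at : atan (b / a * t) @[t --> +oo] --> pi / 2.
Proof.
apply: (cvg_comp (fun t => b / a * t) _ _ (@cvgy_atan R)).
apply/cvgryPge => M; exists (M / (b / a)); split; [exact: num_real|move=> t]; move=> /ltW.
by rewrite ler_pdivrMr ?divr_gt0// mulrC.
Qed.

(** The three integrals of this section are the stages of one triple integral: integrating out a
    variable turns the power -2 of a quadratic polynomial into -3/2, then -3/2 into -1, and the last
    integration leaves a number. *)
Lemma integral_quadratic_inv2 c :
  (\int[mu]_t ((X (t + c) ^+ 2)^-1)%:E = (pi / (2 * A * (a * b)))%:E)%E.
Proof.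
pose F t := (2 * A)^-1 * (t * (X t)^-1) + (2 * A * (a * b))^-1 * atan (b / a * t).
have -> : pi / (2 * A * (a * b)) =
    2 * ((2 * A)^-1 * 0 + (2 * A * (a * b))^-1 * (pi / 2)).
  by field; rewrite !gt_eqF.
apply: (@integral_line_odd (fun t => (X t ^+ 2)^-1) F) => //.
- by move=> t; rewrite invr_ge0 sqr_ge0.
- move=> t; apply: (@cvgV _ _ (nbhs t)); first by rewrite sqrf_eq0.
  by apply: cvgM; exact: cX.
- move=> t; have dtv := dV t; have datt := dat t.
  apply: is_derive_eq; rewrite /GRing.scale /=.
  by field; rewrite !gt_eqF.
- move=> t; rewrite /F sqrrN !mulrN atanN; ring.
- apply: cvgD; apply: cvgM; [exact: cvg_cst| |exact: cvg_cst|exact: cvg_at].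
  have -> : (0 : R) = (fun y => y / (A * y ^+ 2 + B)) 0 by rewrite mul0r.
  apply: (@cvgy_inv _ (fun y => y / (A * y ^+ 2 + B))).
    apply: continuousM; first exact: cvg_id.
    apply: (@cvgV _ _ (nbhs 0)); first by rewrite expr0n mulr0 add0r gt_eqF.
    apply: cvgD; last exact: cvg_cst.
    by apply: cvgM; [exact: cvg_cst|exact: exprn_continuous].
  move=> t t0; have tn0 : t != 0 by rewrite gt_eqF.
  have := Xn0 t => h; field; apply/andP; split=> //.
Qed.

Lemma integral_quadratic_inv c :
  (\int[mu]_t ((X (t + c))^-1)%:E = (pi / (a * b))%:E)%E.
Proof.
pose F t := (a * b)^-1 * atan (b / a * t).
have -> : pi / (a * b) = 2 * ((a * b)^-1 * (pi / 2)) by field; rewrite !gt_eqF.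
apply: (@integral_line_odd (fun t => (X t)^-1) F) => //.
- by move=> t; rewrite invr_ge0 ltW.
- by move=> t; apply: (@cvgV _ _ (nbhs t)) => //; exact: cX.
- move=> t; have datt := dat t.
  apply: is_derive_eq; rewrite /GRing.scale /=.
  by field; rewrite !gt_eqF.
- move=> t; rewrite /F !mulrN atanN; ring.
- by apply: cvgM; [exact: cvg_cst|exact: cvg_at].
Qed.

Lemma integral_quadratic_inv32 c :
  (\int[mu]_t ((X (t + c) * Num.sqrt (X (t + c)))^-1)%:E = (2 / (A * b))%:E)%E.
Proof.
(* The power -3/2 has an algebraic antiderivative, so this stage contributes no factor pi; the other
   two contribute one each. *)
pose F t := A^-1 * (t / Num.sqrt (X t)).
have s0 t : 0 < Num.sqrt (X t) by rewrite sqrtr_gt0.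
have ds t : is_derive t 1 (fun t => Num.sqrt (X t)) (B * t / Num.sqrt (X t)).
  have dsq : is_derive (X t) 1 (@Num.sqrt R) (2 * Num.sqrt (X t))^-1.
    exact: is_derive1_sqrt.
  have := @is_derive1_comp R (@Num.sqrt R) (fun t => X t) t _ _ dsq (dX t); congr is_derive; rewrite /GRing.scale /=.
  by field; rewrite gt_eqF.
rewrite (_ : 2 / (A * b) = 2 * (A^-1 * b^-1)); last by field; rewrite !gt_eqF.
apply: (@integral_line_odd (fun t => (X t * Num.sqrt (X t))^-1) F) => //.
- by move=> t; rewrite invr_ge0 mulr_ge0// ltW.
- move=> t; apply: (@cvgV _ _ (nbhs t)); first by rewrite mulf_neq0// gt_eqF.
  apply: cvgM; first exact: cX.
  by apply: continuous_comp; [exact: cX|exact: sqrt_continuous].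
- move=> t; have dst := ds t.
  have dst' := is_deriveV (f:=fun t => Num.sqrt (X t)) (lt0r_neq0 (s0 t)) dst.
  apply: is_derive_eq; rewrite /GRing.scale /=.
  have ss : Num.sqrt (X t) ^+ 2 = X t by rewrite sqr_sqrtr// ltW.
  have sn0 : Num.sqrt (X t) != 0 by rewrite gt_eqF.
  have An0 : A != 0 by rewrite gt_eqF.
  transitivity (A^-1 * ((Num.sqrt (X t) ^+ 2 - B * t ^+ 2) / Num.sqrt (X t) ^+ 3)).
    by field; rewrite An0 sn0.
  have -> : (X t * Num.sqrt (X t))^-1 = (Num.sqrt (X t) ^+ 2 * Num.sqrt (X t))^-1.
    by rewrite ss.
  rewrite [in Z in A^-1 * (Z / _)]ss addrK.
  by field; rewrite An0 sn0.
- by move=> t; rewrite /F sqrrN mulNr mulrN.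
- apply: cvgM; first exact: cvg_cst.
  have -> : b^-1 = (fun y => (Num.sqrt (A * y ^+ 2 + B))^-1) 0.
    by rewrite expr0n mulr0 add0r.
  apply: (@cvgy_inv _ (fun y => (Num.sqrt (A * y ^+ 2 + B))^-1)).
    apply: (@cvgV _ _ (nbhs 0)); first by rewrite expr0n mulr0 add0r gt_eqF.
    apply: continuous_comp; last exact: sqrt_continuous.
    apply: cvgD; last exact: cvg_cst.
    by apply: cvgM; [exact: cvg_cst|exact: exprn_continuous].
  move=> t t0; have tn0 : t != 0 by rewrite gt_eqF.
  have -> : A * t^-1 ^+ 2 + B = X t / t ^+ 2 by field.
  rewrite sqrtrM ?sqrtrV ?sqr_ge0 ?ltW// sqrtr_sqr gtr0_norm//.
  by rewrite invfM invrK mulrC.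
Qed.

End Quadratic.
End LineIntegrals.

Section SigmaFiniteProduct.
Context {R : realType} d1 d2 (T1 : measurableType d1) (T2 : measurableType d2).
Variable m1 : {sigma_finite_measure set T1 -> \bar R}.
Variable m2 : {sigma_finite_measure set T2 -> \bar R}.

(* An alias carrying the sigma-finite structure: on [m1 \x m2] itself, canonical
   structure inference only finds the instance for subprobabilities. *)
Definition sigma_finite_product : set (T1 * T2) -> \bar R := product_measure1 m1 m2.

HB.instance Definition _ := Measure.on sigma_finite_product.

Let sigma_finite_productT : sigma_finite setT sigma_finite_product.
Proof.
have /sigma_finiteP[F [TF ndF Foo]] := sigma_finiteT m1.
have /sigma_finiteP[G [TG ndG Goo]] := sigma_finiteT m2.
exists (fun n => F n `*` G n).
  rewrite -setXTT TF TG predeqE => -[x y]; split.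
    move=> [/= [n _ Fnx] [k _ Gky]]; exists (maxn n k) => //; split.
      by move: x Fnx; exact/subsetPset/ndF/leq_maxl.
    by move: y Gky; exact/subsetPset/ndG/leq_maxr.
  by move=> [n _ []/= ? ?]; split; exists n.
move=> k; have [? ?] := Foo k; have [? ?] := Goo k.
split; first exact: measurableX.
by rewrite /sigma_finite_product product_measure1E// lte_mul_pinfty// ge0_fin_numE.
Qed.

HB.instance Definition _ :=
  Measure_isSigmaFinite.Build _ _ _ sigma_finite_product sigma_finite_productT.

End SigmaFiniteProduct.

Lemma tonelli3_gen {R : realType} d1 d2 d3 (T1 : measurableType d1)
  (T2 : measurableType d2) (T3 : measurableType d3)
  (m1 : {sigma_finite_measure set T1 -> \bar R})
  (m2 : {sigma_finite_measure set T2 -> \bar R})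
  (m3 : {sigma_finite_measure set T3 -> \bar R})
  (f : T1 * T2 * T3 -> \bar R) :
  measurable_fun setT f -> (forall p, 0 <= f p)%E ->
  (\int[product_measure1 (sigma_finite_product m1 m2) m3]_p f p =
   \int[m1]_x \int[m2]_y \int[m3]_z f (x, y, z))%E.
Proof.
move=> mf f0; rewrite (@fubini_tonelli1 _ _ _ _ _ (sigma_finite_product m1 m2) m3 _ mf f0).
rewrite [LHS](@fubini_tonelli1 _ _ _ _ _ m1 m2)//; first exact: measurable_fun_fubini_tonelli_F.
by move=> p; apply: integral_ge0.
Qed.

Section Tonelli.
Context {R : realType}.
Local Notation mu := (@lebesgue_measure R).

Lemma tonelli3 (f : measurableTypeR R * measurableTypeR R * measurableTypeR R -> R) :
  measurable_fun setT f -> (forall p, 0 <= f p) ->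
  (\int[@lebesgue3 R]_p (f p)%:E =
   \int[mu]_x \int[mu]_y \int[mu]_z (f (x, y, z))%:E)%E.
Proof.
move=> mf f0.
apply: (@tonelli3_gen R _ _ _ (measurableTypeR R) (measurableTypeR R)
  (measurableTypeR R) mu mu mu (EFin \o f)).
  exact/measurable_EFinP.
by move=> p; rewrite lee_fin.
Qed.

Variables (A B c : R).
Hypotheses (A0 : 0 < A) (B0 : 0 < B).
Local Notation X t := (A + B * t ^+ 2).

Let X0 t : 0 < X t.
Proof. by rewrite ltr_pwDl// mulr_ge0 ?sqr_ge0// ltW. Qed.
Let Xn0 t : X t != 0. Proof. by rewrite gt_eqF. Qed.
Let cXc : continuous (fun t => X (t + c)).
Proof.
move=> t; apply: cvgD; first exact: cvg_cst.
apply: cvgM; first exact: cvg_cst.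
apply: (continuous_comp (f := fun t => t + c) (g := fun t => t ^+ 2)).
  by apply: cvgD; [exact: cvg_id|exact: cvg_cst].
exact: exprn_continuous.
Qed.

Lemma measurable_quadratic_inv : measurable_fun setT (fun t : R => (X (t + c))^-1).
Proof.
apply: continuous_measurable_fun => t; apply: (@cvgV _ _ (nbhs t)) => //.
exact: cXc.
Qed.

Lemma measurable_quadratic_inv2 : measurable_fun setT (fun t : R => (X (t + c) ^+ 2)^-1).
Proof.
apply: continuous_measurable_fun => t; apply: (@cvgV _ _ (nbhs t)).
  by rewrite sqrf_eq0.
by apply: cvgM; exact: cXc.
Qed.

Lemma measurable_quadratic_inv32 :
  measurable_fun setT (fun t : R => (X (t + c) * Num.sqrt (X (t + c)))^-1).
Proof.
apply: continuous_measurable_fun => t; apply: (@cvgV _ _ (nbhs t)).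
  by rewrite mulf_neq0// gt_eqF// sqrtr_gt0.
apply: cvgM; first exact: cXc.
by apply: continuous_comp; [exact: cXc|exact: sqrt_continuous].
Qed.
End Tonelli.

Section TiltedIntegral.
Context {R : realType}.
Variables (a1 a2 a3 c1 c2 c3 d : R).
Hypothesis d0 : 0 < d.
Local Notation mu := (@lebesgue_measure R).

(** Squared Euclidean length of the vector over [(u1, u2, u3)] in the hyperplane through 0 with
    slopes [a1], [a2], [a3]. *)
Definition tilted_form (u1 u2 u3 : R) : R :=
  u1 ^+ 2 + u2 ^+ 2 + u3 ^+ 2 + (a1 * u1 + a2 * u2 + a3 * u3) ^+ 2.

Lemma tilted_form_ge0 u1 u2 u3 : 0 <= tilted_form u1 u2 u3.
Proof. by rewrite /tilted_form !addr_ge0 ?sqr_ge0. Qed.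

(** The absolute value makes the profile continuous on the whole line and is harmless on the
    nonnegative [tilted_form]; measurability then follows by composition. *)
Lemma continuous_poisson_profile : continuous (fun q : R => d / (`|q| + d ^+ 2) ^+ 2).
Proof.
move=> q; apply: cvgM; first exact: cvg_cst.
have P : 0 < `|q| + d ^+ 2 by rewrite ltr_wpDl// exprn_gt0.
apply: (@cvgV _ _ (nbhs q)); first by rewrite gt_eqF// exprn_gt0.
have cq : `|x| + d ^+ 2 @[x --> q] --> `|q| + d ^+ 2.
  by apply: cvgD; [exact: norm_continuous|exact: cvg_cst].
exact: cvgM.
Qed.

Lemma measurable_tilted disp (X : measurableType disp) (u1 u2 u3 : X -> R) :
  measurable_fun setT u1 -> measurable_fun setT u2 -> measurable_fun setT u3 ->
  measurable_fun setT (fun x => d / (tilted_form (u1 x) (u2 x) (u3 x) + d ^+ 2) ^+ 2).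
Proof.
move=> m1 m2 m3.
rewrite (_ : (fun x => _) = (fun q : R => d / (`|q| + d ^+ 2) ^+ 2) \o
   (fun x => tilted_form (u1 x) (u2 x) (u3 x))); last first.
  by apply/funext => x /=; rewrite ger0_norm// tilted_form_ge0.
apply: measurableT_comp.
  by apply: continuous_measurable_fun; exact: continuous_poisson_profile.
rewrite /tilted_form.
repeat first [apply: measurable_funD | apply: measurable_funX | apply: measurable_funM];
  done.
Qed.

(** The denominator is the area factor of the hyperplane as a graph, so with respect to surface
    measure the mass is pi^2 for every slope. The shifts [c1], [c2], [c3] are absorbed because each
    variable runs over a full line. *)
Lemma integral_tilted :
  (\int[@lebesgue3 R]_p (d / (tilted_form (p.1.1 + c1) (p.1.2 + c2) (p.2 + c3) +
     d ^+ 2) ^+ 2)%:E = (pi ^+ 2 / Num.sqrt (1 + a1 ^+ 2 + a2 ^+ 2 + a3 ^+ 2))%:E)%E.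
Proof.
(* [B3], [B2], [B1] are the leading coefficients found when the square is completed in [u3], then
   [u2], then [u1]; their product is the determinant 1 + |a|^2 of the form. *)
pose B3 := 1 + a3 ^+ 2.
have B30 : 0 < B3 by rewrite ltr_wpDr// sqr_ge0.
pose B2 := 1 + a2 ^+ 2 / B3.
have B20 : 0 < B2 by rewrite ltr_wpDr// divr_ge0 ?sqr_ge0// ltW.
pose B1 := 1 + a1 ^+ 2 / (B2 * B3).
have B10 : 0 < B1 by rewrite ltr_wpDr// divr_ge0 ?sqr_ge0// mulr_ge0// ltW.
pose A3 u1 u2 := d ^+ 2 + u1 ^+ 2 + u2 ^+ 2 + (a1 * u1 + a2 * u2) ^+ 2 / B3.
have dd0 : 0 < d ^+ 2 by rewrite exprn_gt0.
have A30 u1 u2 : 0 < A3 u1 u2.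
  by rewrite /A3 -!addrA ltr_wpDr// !addr_ge0 ?sqr_ge0// divr_ge0 ?sqr_ge0// ltW.
pose A2 u1 := d ^+ 2 + B1 * u1 ^+ 2.
have A20 u1 : 0 < A2 u1.
  by rewrite /A2 ltr_wpDr// mulr_ge0 ?sqr_ge0// ltW.
have B3n : B3 != 0 by rewrite gt_eqF.
have B2n : B2 != 0 by rewrite gt_eqF.
have E3 u1 u2 u3 : tilted_form u1 u2 u3 + d ^+ 2 =
    A3 u1 u2 + B3 * (u3 + a3 * (a1 * u1 + a2 * u2) / B3) ^+ 2.
  rewrite /tilted_form /A3.
  have -> : u3 ^+ 2 = B3 * u3 ^+ 2 - a3 ^+ 2 * u3 ^+ 2 by rewrite /B3; ring.
  rewrite (_ : (a1 * u1 + a2 * u2) ^+ 2 / B3 =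
    (a1 * u1 + a2 * u2) ^+ 2 - a3 ^+ 2 * (a1 * u1 + a2 * u2) ^+ 2 / B3); last first.
    have -> : a3 ^+ 2 = B3 - 1 by rewrite /B3; ring.
    by field.
  by field.
have E2 u1 u2 : A3 u1 u2 = A2 u1 + B2 * (u2 + a1 * a2 * u1 / (B2 * B3)) ^+ 2.
  rewrite /A3 /A2 /B1.
  have -> : u2 ^+ 2 = B2 * u2 ^+ 2 - a2 ^+ 2 / B3 * u2 ^+ 2 by rewrite /B2; ring.
  have -> : a1 ^+ 2 / (B2 * B3) = a1 ^+ 2 / B3 - (a2 ^+ 2 / B3) * a1 ^+ 2 / (B2 * B3).
    have -> : a2 ^+ 2 / B3 = B2 - 1 by rewrite /B2; ring.
    by field; rewrite B3n B2n.
  by field; rewrite B3n B2n.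
have m3 : measurable_fun setT (fun p : measurableTypeR R * measurableTypeR R * measurableTypeR R =>
   (d / (tilted_form (p.1.1 + c1) (p.1.2 + c2) (p.2 + c3) + d ^+ 2) ^+ 2)%:E).
  apply/measurable_EFinP; apply: measurable_tilted => //.
  + by apply: measurable_funD => //; apply: measurableT_comp => //; exact: measurable_fst.
  + by apply: measurable_funD => //; apply: measurableT_comp => //; exact: measurable_fst.
  + by apply: measurable_funD => //; exact: measurable_snd.
rewrite tonelli3; last 2 first.
- exact/measurable_EFinP.
- by move=> p; rewrite divr_ge0 ?sqr_ge0// ltW.
pose K := d * (pi / (2 * Num.sqrt B3)).
have K0 : 0 <= K by rewrite mulr_ge0 ?(ltW d0)// divr_ge0 ?pi_ge0// mulr_ge0 ?sqrtr_ge0.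
have E3' x y z : tilted_form (x + c1) (y + c2) (z + c3) + d ^+ 2 = A3 (x + c1) (y + c2) +
    B3 * (z + (c3 + a3 * (a1 * (x + c1) + a2 * (y + c2)) / B3)) ^+ 2.
  by rewrite E3 -(addrA z).
have E2' x y : A3 (x + c1) (y + c2) = A2 (x + c1) +
    B2 * (y + (c2 + a1 * a2 * (x + c1) / (B2 * B3))) ^+ 2.
  by rewrite E2 -(addrA y).
have I3 x y : (\int[mu]_z (d / (tilted_form (x + c1) (y + c2) (z + c3) + d ^+ 2) ^+ 2)%:E =
   (K * (A3 (x + c1) (y + c2) * Num.sqrt (A3 (x + c1) (y + c2)))^-1)%:E)%E.
  under eq_integral do rewrite EFinM E3'.
  rewrite ge0_integralZl_EFin//; last 3 first.
  - by move=> z _; rewrite lee_fin invr_ge0 sqr_ge0.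
  - apply/measurable_EFinP; apply: measurable_quadratic_inv2 => //.
  - exact: ltW.
  rewrite integral_quadratic_inv2// -EFinM; congr (_%:E).
  by rewrite /K; field; rewrite !gt_eqF// sqrtr_gt0.
under eq_integral do under eq_integral do rewrite I3.
have I2 x : (\int[mu]_y (K * (A3 (x + c1) (y + c2) * Num.sqrt (A3 (x + c1) (y + c2)))^-1)%:E =
   (K * (2 / Num.sqrt B2) * (A2 (x + c1))^-1)%:E)%E.
  under eq_integral do rewrite EFinM E2'.
  rewrite ge0_integralZl_EFin//; last 2 first.
  - by move=> z _; rewrite lee_fin invr_ge0 mulr_ge0 ?sqrtr_ge0// -E2' ltW.
  - apply/measurable_EFinP; exact: measurable_quadratic_inv32.
  rewrite integral_quadratic_inv32// -EFinM; congr (_%:E).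
  by field; rewrite !gt_eqF// sqrtr_gt0.
under eq_integral do rewrite I2 EFinM.
rewrite ge0_integralZl_EFin//; last 3 first.
- by move=> z _; rewrite lee_fin invr_ge0 ltW.
- apply/measurable_EFinP; exact: measurable_quadratic_inv.
- by rewrite mulr_ge0// divr_ge0// sqrtr_ge0.
rewrite integral_quadratic_inv// -EFinM; congr (_%:E).
have -> : 1 + a1 ^+ 2 + a2 ^+ 2 + a3 ^+ 2 = B1 * (B2 * B3).
  by rewrite /B1 /B2 /B3; field; rewrite -/B3 B3n /=; rewrite gt_eqF//; nra.
rewrite !sqrtrM ?mulr_ge0 ?(ltW B20) ?(ltW B10) ?(ltW B30) ?(ltW d0)//.
have dE : Num.sqrt d * Num.sqrt d = d by rewrite -expr2 sqr_sqrtr// ltW.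
rewrite dE /K.
by field; rewrite !gt_eqF// sqrtr_gt0.
Qed.
End TiltedIntegral.

(** * Implicit functions *)

Section GraphPoints.
Context {R : realType}.
Implicit Types (k : 'I_4) (y h : 'rV[R]_3) (x : 'rV[R]_4) (t s : R).

(** Unlike [graph_pt] with a varying [g], this is linear in the pair [(y, t)], which is what the
    mean value arguments below rely on. *)
Definition ins k y t : 'rV[R]_4 := graph_pt k (fun=> t) y.
Definition del k x : 'rV[R]_3 := \row_(j < 3) x 0 (lift k j).

Lemma graph_ptE k (g : 'rV[R]_3 -> R) y : graph_pt k g y = ins k y (g y).
Proof. by apply/rowP => i; rewrite !mxE; case: unliftP. Qed.

Lemma ins_at k y t : ins k y t 0 k = t.
Proof. by rewrite mxE unlift_none. Qed.

Lemma ins_lift k y t j : ins k y t 0 (lift k j) = y 0 j.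
Proof. by rewrite mxE liftK. Qed.

Lemma del_ins k y t : del k (ins k y t) = y.
Proof. by apply/rowP => j; rewrite mxE ins_lift. Qed.

Lemma ins_del k x : ins k (del k x) (x 0 k) = x.
Proof.
by apply/rowP => i; case: (unliftP k i) => [j ->|->]; rewrite ?ins_lift ?ins_at// mxE.
Qed.

Lemma insD k y h t s : ins k (y + h) (t + s) = ins k y t + ins k h s.
Proof.
apply/rowP => i; rewrite [RHS]mxE.
by case: (unliftP k i) => [j ->|->]; rewrite ?ins_lift ?ins_at// mxE.
Qed.

Lemma insB k y h t s : ins k (y - h) (t - s) = ins k y t - ins k h s.
Proof.
by apply: (addIr (ins k h s)); rewrite -insD !subrK.
Qed.

Lemma insZ k y t s : s *: ins k y t = ins k (s *: y) (s * t).
Proof.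
apply/rowP => i; rewrite [LHS]mxE.
by case: (unliftP k i) => [j ->|->]; rewrite ?ins_lift ?ins_at// mxE.
Qed.

Lemma norm_ins_lt k y t c : 0 < c -> `|y| < c -> `|t| < c -> `|ins k y t| < c.
Proof.
move=> c0 yc tc; apply: norm_row_lt => // i.
case: (unliftP k i) => [j ->|->]; rewrite ?ins_lift ?ins_at//.
by apply: le_lt_trans yc; exact: norm_coord_le.
Qed.

Lemma norm_ins_le k y t c : 0 <= c -> `|y| <= c -> `|t| <= c -> `|ins k y t| <= c.
Proof.
move=> c0 yc tc; apply: norm_row_le => // i.
case: (unliftP k i) => [j ->|->]; rewrite ?ins_lift ?ins_at//.
by apply: le_trans yc; exact: norm_coord_le.
Qed.

Lemma norm_del_le k x : `|del k x| <= `|x|.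
Proof. by apply: norm_row_le => // j; rewrite mxE norm_coord_le. Qed.

Lemma delB k x x' : del k (x - x') = del k x - del k x'.
Proof. by apply/rowP => j; rewrite !mxE. Qed.

Lemma sum_ins k (F : 'I_4 -> R) : \sum_(i < 4) F i = F k + \sum_(j < 3) F (lift k j).
Proof. exact: bigD1_ord. Qed.

Lemma sqn_ins k y t : sqn (ins k y t) = t ^+ 2 + sqn y.
Proof.
rewrite /sqn (sum_ins k) ins_at; congr (_ + _).
by apply: eq_bigr => j _; rewrite ins_lift.
Qed.

End GraphPoints.

Section C1Facts.
Context {R : realType} {n : nat}.
Implicit Types (f : 'rV[R]_n -> R) (x y v : 'rV[R]_n).

(** Strict differentiability: both endpoints move while the derivative stays frozen at [x]. It lets
    all chords of a small piece of a C^1 graph be compared with one and the same tangent plane. *)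
Lemma C1_strict f x r : 0 < r -> C1_on [set y | `|y - x| < r] f ->
  forall e, 0 < e -> exists2 d, 0 < d <= r & forall y v, `|y - x| < d -> `|y + v - x| < d ->
    `|f (y + v) - f y - \sum_i v 0 i * partial i f x| <= e * `|v|.
Proof.
move=> r0 C1 e e0.
have xr : [set y | `|y - x| < r] x by rewrite /= subrr normr0.
have en : 0 < e / (n%:R + 1) by rewrite divr_gt0// ltr_wpDl.
have /choice[dd ddP] : forall i, exists d, 0 < d /\ forall h, `|h| < d ->
    `|partial i f (x + h) - partial i f x| <= e / (n%:R + 1).
  move=> i; have /continuous_rowP/(_ _ en)[d d0 Hd] := (C1 _ xr).2 i.
  by exists d.
exists (\big[Num.min/r]_i dd i).
  rewrite bigmin_le_id andbT.
  by elim/big_ind : _ => // [a b a0 b0|i _]; [rewrite lt_min a0|case: (ddP i)].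
move=> y v yd yvd.
have seg t : 0 <= t <= 1 -> `|y + t *: v - x| < \big[Num.min/r]_i dd i.
  move=> /andP[t0 t1].
  have -> : y + t *: v - x = (1 - t) *: (y - x) + t *: (y + v - x).
    by apply/rowP => i; rewrite !mxE; ring.
  apply: le_lt_trans (ler_normD _ _) _; rewrite !normrZ.
  rewrite (ger0_norm t0) (@ger0_norm _ (1 - t)) ?subr_ge0//.
  have [->|tn0] := eqVneq t 0; first by rewrite subr0 mul1r mul0r addr0.
  have tp : 0 < t by rewrite lt0r tn0.
  rewrite [ltRHS](_ : _ = (1 - t) * \big[Num.min/r]_i dd i + t * \big[Num.min/r]_i dd i); last by ring.
  by rewrite ler_ltD// ?ler_wpM2l ?subr_ge0// ?(ltW yd)// ltr_pM2l.
have segr t : 0 <= t <= 1 -> `|y + t *: v - x| < r.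
  by move=> /seg /lt_le_trans; apply; exact: bigmin_le_id.
have [t /andP[t0 t1] ->] := row_MVT (fun t tt => (C1 _ (segr t tt)).1).
rewrite -sumrB; apply: le_trans (ler_norm_sum _ _ _) _.
apply: (@le_trans _ _ (\sum_(i < n) `|v| * (e / (n%:R + 1)))).
  apply: ler_sum => i _; rewrite -mulrBr normrM ler_pM// ?norm_coord_le//.
  have -> : y + t *: v = x + (y + t *: v - x) by rewrite subrKC.
  apply: (ddP i).2; apply: lt_le_trans (seg t _) _; first by rewrite !ltW.
  exact: bigmin_le.
rewrite sumr_const card_ord -[leLHS]mulr_natl mulrCA mulrC mulrA.
rewrite ler_wpM2r// ler_pdivrMr ?ltr_wpDl//.
by rewrite mulrDr mulr1 mulrC lerDl ltW.
Qed.

End C1Facts.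

Section ImplicitFunction.
Context {R : realType}.
Variables (rho : 'rV[R]_4 -> R) (p0 : 'rV[R]_4) (k : 'I_4).
Hypothesis C1rho : C1_on setT rho.
Hypothesis rho0 : rho p0 = 0.
Hypothesis drho0 : 0 < partial k rho p0.
Local Notation y0 := (del k p0).
Local Notation t0 := (p0 0 k).

Let drho (x : 'rV[R]_4) i : {for x, continuous (partial i rho)}.
Proof. by have [_] := C1rho (I : setT x). Qed.
Let rho_diff x : differentiable rho x.
Proof. by have [] := C1rho (I : setT x). Qed.

Let bounds : exists d m M : R, [/\ 0 < d, 0 < m, 0 < M &
  forall x, `|x - p0| < d -> m <= partial k rho x /\ forall i, `|partial i rho x| <= M].
Proof.
pose m := partial k rho p0 / 2.
have m0 : 0 < m by rewrite divr_gt0.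
have /choice[dd ddP] : forall i, exists d, 0 < d /\ forall h, `|h| < d ->
    `|partial i rho (p0 + h) - partial i rho p0| <= m.
  by move=> i; have /continuous_rowP/(_ _ m0)[d d0 Hd] := @drho p0 i; exists d.
exists (\big[Num.min/1]_i dd i), m, (m + \sum_i `|partial i rho p0|); split => //.
- by elim/big_ind : _ => // [a b a0 b0|i _]; [rewrite lt_min a0|case: (ddP i)].
- by rewrite ltr_wpDr// sumr_ge0.
move=> x xd.
have H i : `|partial i rho x - partial i rho p0| <= m.
  rewrite -{1}(subrKC p0 x); apply: (ddP i).2.
  by apply: lt_le_trans xd _; exact: bigmin_le.
split.
  have := H k; rewrite ler_norml => /andP[+ _].
  by rewrite lerBrDl; apply: le_trans; rewrite /m; lra.
move=> i; rewrite -(subrK (partial i rho p0) (partial i rho x)).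
apply: le_trans (ler_normD _ _) _; rewrite lerD// (bigD1 i)//= lerDl.
by rewrite sumr_ge0.
Qed.

Let convex_ball x v d t : `|x - p0| < d -> `|x + v - p0| < d -> 0 <= t <= 1 ->
  `|x + t *: v - p0| < d.
Proof.
move=> xd yd /andP[t0' t1].
have -> : x + t *: v - p0 = (1 - t) *: (x - p0) + t *: (x + v - p0).
  by apply/rowP => i; rewrite !mxE; ring.
apply: le_lt_trans (ler_normD _ _) _; rewrite !normrZ.
rewrite (ger0_norm t0') (@ger0_norm _ (1 - t)) ?subr_ge0//.
have [->|tn0] := eqVneq t 0; first by rewrite subr0 mul1r mul0r addr0.
have tp : 0 < t by rewrite lt0r tn0.
rewrite [ltRHS](_ : _ = (1 - t) * d + t * d); last by ring.
by rewrite ler_ltD// ?ler_wpM2l ?subr_ge0// ?(ltW xd)// ltr_pM2l.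
Qed.

Lemma implicit_graph_pos (c : R) : 0 < c -> exists (r h : R) (g : 'rV[R]_3 -> R),
  [/\ 0 < r < c, 0 < h < c,
      forall y, `|y - y0| < r -> `|g y - t0| < h /\
        forall t, `|t - t0| < h -> (rho (ins k y t) = 0 <-> t = g y),
      C1_on [set y | `|y - y0| < r] g &
      forall y t, `|y - y0| < r -> `|t - t0| < h -> partial k rho (ins k y t) != 0].
Proof.
move=> c0; have [d [m [M [d0 m0 M0 HB]]]] := bounds.
pose h := Num.min d c / 2.
have dc0 : 0 < Num.min d c by rewrite lt_min d0.
have h0 : 0 < h by rewrite divr_gt0.
have hdc : h < Num.min d c by rewrite /h ltr_pdivrMr// ltr_pMr// ltr1n.
have hd : h < d by apply: lt_le_trans hdc _; rewrite ge_min lexx.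
have hc : h < c by apply: lt_le_trans hdc _; rewrite ge_min lexx orbT.
(* Moving the three other coordinates by less than [r] changes [rho] by less than [3 * M * r], hence
   by less than the [m * h] gained when coordinate [k] moves by [h]. The opposite signs of [rho] at
   heights [t0 - h] and [t0 + h] therefore persist. *)
pose r := Num.min h (m * h / (3 * M)).
have r0 : 0 < r by rewrite lt_min h0 divr_gt0// mulr_gt0.
have rh : r <= h by rewrite ge_min lexx.
have rM : 3 * M * r <= m * h.
  have : r <= m * h / (3 * M) by rewrite ge_min lexx orbT.
  by rewrite ler_pdivlMr ?mulr_gt0// mulrC.
have p0E : ins k y0 t0 = p0 by exact: ins_del.
have inb y t : `|y - y0| < r -> `|t - t0| <= h -> `|ins k y t - p0| < d.
  move=> yr th; rewrite -p0E -insB norm_ins_lt//.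
    by apply: lt_trans hd; exact: lt_le_trans rh.
  by apply: le_lt_trans hd.
have incr y t s : `|y - y0| < r -> `|t - t0| <= h -> `|s - t0| <= h -> t < s ->
    m * (s - t) <= rho (ins k y s) - rho (ins k y t).
  move=> yr th sh ts.
  have [q q01] := row_MVT (f := rho) (x := ins k y t) (v := ins k 0 (s - t)) (fun t _ => rho_diff _).
  rewrite -insD addr0 subrKC => ->.
  rewrite (sum_ins k) ins_at big1 ?addr0; last by move=> j _; rewrite ins_lift mxE mul0r.
  rewrite mulrC ler_wpM2l ?subr_ge0 ?(ltW ts)//.
  apply: (HB _ _).1; apply: convex_ball; first exact: inb.
    by rewrite -insD addr0 subrKC; exact: inb.
  by case/andP: q01 => a b; rewrite !ltW.
have hn : `|t0 + h - t0| <= h by rewrite addrAC subrr add0r ger0_norm// ltW.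
have hn' : `|t0 - h - t0| <= h by rewrite addrAC subrr add0r normrN ger0_norm// ltW.
have y0r : `|y0 - y0| < r by rewrite subrr normr0.
have tt : `|t0 - t0| <= h by rewrite subrr normr0 ltW.
have top : m * h <= rho (ins k y0 (t0 + h)).
  have := incr _ _ _ y0r tt hn; rewrite ltrDl => /(_ h0).
  by rewrite p0E rho0 subr0 addrAC subrr add0r.
have bot : rho (ins k y0 (t0 - h)) <= - (m * h).
  have := incr _ _ _ y0r hn' tt; rewrite ltrBlDr ltrDl => /(_ h0).
  by rewrite p0E rho0 sub0r opprB addrCA subrr addr0 lerNr.
have lat y t : `|y - y0| < r -> `|t - t0| <= h ->
    `|rho (ins k y t) - rho (ins k y0 t)| < m * h.
  move=> yr th.
  have [q q01] := row_MVT (f := rho) (x := ins k y0 t) (v := ins k (y - y0) 0) (fun t _ => rho_diff _).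
  rewrite -insD addr0 subrKC => ->.
  rewrite (sum_ins k) ins_at mul0r add0r.
  have [yy|yy] := eqVneq (y - y0) 0.
    rewrite big1 ?normr0 ?mulr_gt0// => j _.
    by rewrite ins_lift yy mxE mul0r.
  have yp : 0 < `|y - y0| by rewrite normr_gt0.
  apply: le_lt_trans (ler_norm_sum _ _ _) _.
  apply: (@le_lt_trans _ _ (\sum_(j < 3) `|y - y0| * M)).
    apply: ler_sum => j _; rewrite ins_lift normrM ler_pM// ?norm_coord_le//.
    apply: (HB _ _).2; apply: convex_ball; first exact: inb.
      by rewrite -insD addr0 subrKC; exact: inb.
    by case/andP: q01 => a b; rewrite !ltW.
  rewrite sumr_const card_ord -[ltLHS]mulr_natl; apply: lt_le_trans rM.
  by rewrite -[ltRHS]mulrA ltr_pM2l// mulrC ltr_pM2l.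
have ex y : exists t, `|y - y0| < r -> `|t - t0| < h /\ rho (ins k y t) = 0.
  have [yr|] := boolP (`|y - y0| < r); last by exists 0.
  have cr : {within `[t0 - h, t0 + h], continuous (fun t => rho (ins k y t))}.
    apply: continuous_subspaceT => t.
    have -> : (fun t => rho (ins k y t)) = (fun t => rho (ins k y 0 + t *: ins k 0 1)).
      by apply/funext => s; rewrite insZ -insD mulr1 scaler0 addr0 add0r.
    apply: differentiable_continuous; apply/derivable1_diffP.
    by case: (is_derive_line (x := ins k y 0) (v := ins k 0 1) (t := t) (rho_diff _)).
  have l1 := lat _ _ yr hn; have l2 := lat _ _ yr hn'.
  have pos : 0 < rho (ins k y (t0 + h)).
    by move: l1; rewrite ltr_norml => /andP[l1 _]; lra.
  have neg : rho (ins k y (t0 - h)) < 0.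
    by move: l2; rewrite ltr_norml => /andP[_ l2]; lra.
  have le : t0 - h <= t0 + h by rewrite lerD2l; lra.
  have [|t] := IVT (v := 0) le cr.
    by rewrite ge_min le_max (ltW neg) (ltW pos) orbT.
  rewrite in_itv /= => /andP[a b] tE; exists t => _; split=> //.
  rewrite ltr_norml; apply/andP; split.
    rewrite ltrBrDl lt_neqAle a andbT; apply/eqP => E.
    by move: neg; rewrite E tE ltxx.
  rewrite ltrBlDl lt_neqAle b andbT; apply/eqP => E.
  by move: pos; rewrite -E tE ltxx.
have [g gP] := choice ex.
have uniq y t : `|y - y0| < r -> `|t - t0| < h -> rho (ins k y t) = 0 -> t = g y.
  move=> yr th rt; have [gh rg] := gP _ yr.
  case: (ltgtP t (g y)) => [lt|gt|//].
    have := incr _ _ _ yr (ltW th) (ltW gh) lt.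
    by rewrite rg rt subrr pmulr_rle0// leNgt subr_gt0 lt.
  have := incr _ _ _ yr (ltW gh) (ltW th) gt.
  by rewrite rg rt subrr pmulr_rle0// leNgt subr_gt0 gt.
pose G j x := - (partial (lift k j) rho x / partial k rho x).
pose L := 3 * M / m.
have L0 : 0 <= L by rewrite divr_ge0 ?mulr_ge0 ?(ltW M0) ?(ltW m0).
(* Since [rho] vanishes at both ends of a chord of the graph, the mean value theorem on the chord
   can be solved for the increment of [g]. This gives first the Lipschitz bound and then, by
   continuity of [G j], the derivative. *)
have incg y v : `|y - y0| < r -> `|y + v - y0| < r -> exists2 q, 0 < q < 1 &
    let xi := ins k y (g y) + q *: ins k v (g (y + v) - g y) in
    `|xi - p0| < d /\ g (y + v) - g y = \sum_j v 0 j * G j xi.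
  move=> yr vr; have [gh rg] := gP _ yr; have [gh' rg'] := gP _ vr.
  have [q q01 E] := row_MVT (f := rho) (x := ins k y (g y))
    (v := ins k v (g (y + v) - g y)) (fun t _ => rho_diff _).
  exists q => //=.
  have xid : `|ins k y (g y) + q *: ins k v (g (y + v) - g y) - p0| < d.
    apply: convex_ball; first by apply: inb => //; exact: ltW.
      by rewrite -insD subrKC; apply: inb => //; exact: ltW.
    by case/andP: q01 => a b; rewrite !ltW.
  split=> //; set xi := ins k y (g y) + q *: _ in E xid *.
  have kn0 : partial k rho xi != 0 by rewrite gt_eqF//; apply: lt_le_trans m0 (HB _ xid).1.
  move: E; rewrite -insD subrKC rg rg' subrr (sum_ins k) ins_at => /esym E.
  apply: (mulIf kn0); move/eqP: E; rewrite addr_eq0 => /eqP ->.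
  rewrite mulr_suml -sumrN; apply: eq_bigr => j _.
  by rewrite ins_lift /G; field.
have Gle j xi : `|xi - p0| < d -> `|G j xi| <= M / m.
  move=> xid; have [mk Mi] := HB _ xid.
  rewrite normrN normrM normfV ler_pM ?invr_ge0// ?Mi//.
  by rewrite lef_pV2 ?posrE ?normr_gt0 ?gt_eqF ?(lt_le_trans m0 mk)// (le_trans mk (ler_norm _)).
have Lip y v : `|y - y0| < r -> `|y + v - y0| < r -> `|g (y + v) - g y| <= L * `|v|.
  move=> yr vr; have [q _ [xid ->]] := incg _ _ yr vr.
  apply: le_trans (ler_norm_sum _ _ _) _.
  apply: (@le_trans _ _ (\sum_(j < 3) `|v| * (M / m))).
    by apply: ler_sum => j _; rewrite normrM ler_pM ?norm_coord_le ?Gle.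
  by rewrite sumr_const card_ord -[leLHS]mulr_natl /L mulrCA mulrC !mulrA.
have Gc j xi : `|xi - p0| < d -> {for xi, continuous (G j)}.
  move=> xid; have kn0 : partial k rho xi != 0.
    by rewrite gt_eqF//; apply: lt_le_trans m0 (HB _ xid).1.
  have c1 : {for xi, continuous (partial (lift k j) rho)} by exact: drho.
  have c2 : {for xi, continuous (fun x => (partial k rho x)^-1)}.
    exact: (continuousV kn0 (@drho _ _)).
  exact: continuousN (continuousM c1 c2).
have L1 : 0 < L + 1 by rewrite ltr_wpDl.
have insL y v q : `|y - y0| < r -> `|y + v - y0| < r -> 0 <= q <= 1 ->
    `|q *: ins k v (g (y + v) - g y)| <= (L + 1) * `|v|.
  move=> yr vr /andP[q0 q1]; rewrite normrZ ger0_norm//.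
  apply: (@le_trans _ _ `|ins k v (g (y + v) - g y)|); first by rewrite ler_piMl.
  apply: norm_ins_le; first by rewrite mulr_ge0// ltW.
    by rewrite ler_peMl// lerDr.
  by apply: le_trans (Lip _ _ yr vr) _; rewrite ler_wpM2r// lerDl.
have sub y : `|y - y0| < r -> exists2 e, 0 < e & forall v, `|v| < e -> `|y + v - y0| < r.
  move=> yr; exists (r - `|y - y0|); first by rewrite subr_gt0.
  move=> v ve; rewrite addrAC; apply: le_lt_trans (ler_normD _ _) _.
  by rewrite -ltrBrDl.
have Dg y : `|y - y0| < r -> differentiable g y /\
    forall j, partial j g y = G j (ins k y (g y)).
  move=> yr; apply: differentiable_approx => e e0.
  have e3 : 0 < e / 3 by rewrite divr_gt0.
  have Xd : `|ins k y (g y) - p0| < d.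
    by apply: inb => //; apply/ltW; exact: (gP _ yr).1.
  have /choice[dd ddP] : forall j, exists d1, 0 < d1 /\ forall v, `|v| < d1 ->
      `|G j (ins k y (g y) + v) - G j (ins k y (g y))| <= e / 3.
    by move=> j; have /continuous_rowP/(_ _ e3)[d1 d10 Hd] := Gc j _ Xd; exists d1.
  have [d2 d20 Hd2] := sub _ yr.
  pose d1 := \big[Num.min/1]_j dd j.
  have d10 : 0 < d1.
    by rewrite /d1; elim/big_ind : _ => // [a b a0 b0|i _]; [rewrite lt_min a0|case: (ddP i)].
  exists (Num.min d2 (d1 / (L + 1))); first by rewrite lt_min d20 divr_gt0.
  move=> v; rewrite lt_min => /andP[/Hd2 vr v1].
  have [q /andP[q0 q1] [xid ->]] := incg _ _ yr vr.
  rewrite -sumrB; apply: le_trans (ler_norm_sum _ _ _) _.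
  apply: (@le_trans _ _ (\sum_(j < 3) `|v| * (e / 3))); last first.
    rewrite sumr_const card_ord -[leLHS]mulr_natl.
    by rewrite (_ : 3 * _ = e * `|v|)//; field.
  apply: ler_sum => j _; rewrite -mulrBr normrM ler_pM ?norm_coord_le//.
  apply: (ddP j).2; apply: (@lt_le_trans _ _ d1); last exact: bigmin_le.
  have qq : 0 <= q <= 1 by rewrite !ltW.
  apply: le_lt_trans (insL _ _ _ yr vr qq) _.
  by rewrite mulrC -ltr_pdivlMr.
have C1g : C1_on [set y | `|y - y0| < r] g.
  move=> y /= yr; split; first exact: (Dg _ yr).1.
  move=> j; apply/continuous_rowP => e e0.
  have Xd : `|ins k y (g y) - p0| < d.
    by apply: inb => //; apply/ltW; exact: (gP _ yr).1.
  have /continuous_rowP/(_ _ e0)[d1 d10 Hd] := Gc j _ Xd.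
  have [d2 d20 Hd2] := sub _ yr.
  exists (Num.min d2 (d1 / (L + 1))); first by rewrite lt_min d20 divr_gt0.
  move=> v; rewrite lt_min => /andP[/Hd2 vr v1].
  rewrite (Dg _ yr).2 (Dg _ vr).2.
  have -> : ins k (y + v) (g (y + v)) = ins k y (g y) + 1 *: ins k v (g (y + v) - g y).
    by rewrite scale1r -insD subrKC.
  apply: Hd; apply: le_lt_trans (insL _ _ _ yr vr _) _; first by rewrite ler01 lexx.
  by rewrite mulrC -ltr_pdivlMr.
exists r, h, g; split.
- by rewrite r0; apply: le_lt_trans hc.
- by rewrite h0.
- move=> y yr; split; first exact: (gP _ yr).1.
  by move=> t th; split=> [|->]; [exact: uniq|exact: (gP _ yr).2].
- exact: C1g.
- move=> y t yr th; rewrite gt_eqF//; apply: lt_le_trans m0 _.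
  by apply: (HB _ _).1; apply: inb => //; exact: ltW.
Qed.

End ImplicitFunction.

Lemma implicit_graph {R : realType} (rho : 'rV[R]_4 -> R) (p0 : 'rV[R]_4) (k : 'I_4)
    (c : R) : C1_on setT rho -> rho p0 = 0 -> partial k rho p0 != 0 -> 0 < c ->
  exists (r h : R) (g : 'rV[R]_3 -> R),
  [/\ 0 < r < c, 0 < h < c,
      forall y, `|y - del k p0| < r -> `|g y - p0 0 k| < h /\
        forall t, `|t - p0 0 k| < h -> (rho (ins k y t) = 0 <-> t = g y),
      C1_on [set y | `|y - del k p0| < r] g &
      forall y t, `|y - del k p0| < r -> `|t - p0 0 k| < h ->
        partial k rho (ins k y t) != 0].
Proof.
move=> C1 rho0; rewrite neq_lt => /orP[d0|d0] c0; last exact: implicit_graph_pos.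
have pN x i : partial i (fun x => - rho x) x = - partial i rho x.
  by rewrite /partial deriveN//; apply: diff_derivable; have [] := C1 _ (I : setT x).
have C1N : C1_on setT (fun x => - rho x).
  move=> x _; have [df pf] := C1 _ (I : setT x); split; first exact: differentiableN.
  move=> i; rewrite (_ : partial i _ = (fun x => - partial i rho x)).
    exact: continuousN (pf i).
  by apply/funext => z; exact: pN.
have [||r [h [g [r0 h0 gP C1g nz]]]] := implicit_graph_pos C1N _ _ c0 (k := k) (p0 := p0).
- by rewrite rho0 oppr0.
- by rewrite pN oppr_gt0.
exists r, h, g; split=> //.
- move=> y yr; have [gh gu] := gP _ yr; split=> // t th.
  by rewrite -(gu _ th); split => [->|/eqP]; rewrite ?oppr0// oppr_eq0 => /eqP.
- by move=> y t yr th; have := nz _ _ yr th; rewrite pN oppr_eq0.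
Qed.

(** * The boundary of the domain *)

Lemma closure_sub_closed {T : topologicalType} (A C : set T) :
  closed C -> A `<=` C -> closure A `<=` C.
Proof. by move=> /closure_id {2}-> ; exact: closure_subset. Qed.

Section DefiningFunction.
Context {R : realType}.
Variables (Omega : set (quat R)) (rho : quat R -> R).
Hypothesis drho : defining_function rho Omega.
Hypothesis bOmega : bounded_set Omega.
Local Notation S := (boundary Omega).

Lemma defining_C1 (x : quat R) : differentiable rho x /\ forall k, {for x, continuous (partial k rho)}.
Proof. by have [C1 _ _] := drho; exact: C1 (I : setT x). Qed.

Lemma defining_continuous : continuous rho.
Proof. by move=> x; apply: differentiable_continuous; have [] := defining_C1 x. Qed.

Lemma defining_OmegaE : Omega = [set x | rho x < 0].
Proof. by have [] := drho. Qed.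

Lemma defining_open : open Omega.
Proof.
rewrite defining_OmegaE (_ : [set x | rho x < 0] = rho @^-1` [set y | y < 0])//.
apply: open_comp; last exact: open_lt.
by move=> x _; exact: defining_continuous.
Qed.

Lemma boundaryE : S = closure Omega `\` Omega.
Proof. by rewrite /boundary (_ : Omega° = Omega)//; apply/interior_id; exact: defining_open. Qed.

Lemma closure_rho_le0 x : closure Omega x -> rho x <= 0.
Proof.
have cl : closed [set x | rho x <= 0].
  rewrite (_ : [set x | rho x <= 0] = rho @^-1` [set y | y <= 0])//.
  by apply: closed_comp; [move=> y _; exact: defining_continuous|exact: closed_le].
have : closure Omega `<=` [set x | rho x <= 0].
  by apply: closure_sub_closed => // y; rewrite defining_OmegaE => /ltW.
by apply.
Qed.

Lemma rho_boundary x : S x -> rho x = 0.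
Proof.
rewrite boundaryE => -[/closure_rho_le0 r0]; rewrite defining_OmegaE => /negP.
by rewrite -leNgt => r1; apply/eqP; rewrite eq_le r0.
Qed.

Lemma closure_OmegaU x : closure Omega x -> Omega x \/ S x.
Proof. by move=> cx; have [|nx] := pselect (Omega x); [left|right; rewrite boundaryE]. Qed.

Lemma boundary_closure x : S x -> closure Omega x.
Proof. by rewrite boundaryE => -[]. Qed.

Lemma boundary_notin x : S x -> ~ Omega x.
Proof. by rewrite boundaryE => -[]. Qed.

Lemma boundary_closed : closed S.
Proof.
rewrite boundaryE; apply: closedI; first exact: closed_closure.
exact/open_closedC/defining_open.
Qed.

Lemma bounded_closure : bounded_set (closure Omega).
Proof.
have [M [Mr HM]] := bOmega; exists M; split=> // m Mm x cx.
have cl : closed [set x : quat R | `|x| <= m].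
  rewrite (_ : mkset _ = (fun x : quat R => `|x|) @^-1` [set y | y <= m])//.
  by apply: closed_comp; [move=> y _; exact: norm_continuous|exact: closed_le].
have : closure Omega `<=` [set x : quat R | `|x| <= m].
  by apply: closure_sub_closed => // y /(HM _ Mm).
by apply.
Qed.

Lemma boundary_compact : compact S.
Proof.
apply: bounded_closed_compact; last exact: boundary_closed.
have [M [Mr HM]] := bounded_closure; exists M; split=> // m Mm x /boundary_closure.
exact: HM.
Qed.

Lemma boundary_grad x : S x -> exists k, partial k rho x != 0.
Proof. by have [_ _] := drho; exact. Qed.

(** A defining function may also vanish outside the closure, at critical points. Where a partial
    derivative is nonzero, a small move against its sign makes [rho] negative, so the zero is a
    limit of points of [Omega]. *)
Lemma rho0_boundary x k : rho x = 0 -> partial k rho x != 0 -> S x.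
Proof.
move=> r0 dk; rewrite boundaryE defining_OmegaE; split; last by rewrite /= r0 ltxx.
move=> B /nbhs_rowP[d d0 Hd].
have p0 : 0 < `|partial k rho x| / 2 by rewrite divr_gt0// normr_gt0.
have /continuous_rowP/(_ _ p0)[d1 d10 Hd1] := (defining_C1 x).2 k.
pose t := Num.min d d1 / 2.
have md : 0 < Num.min d d1 by rewrite lt_min d0.
have t0 : 0 < t by rewrite divr_gt0.
have tm : t < Num.min d d1 by rewrite /t ltr_pdivrMr// ltr_pMr// ltr1n.
pose v : quat R := (- Num.sg (partial k rho x) * t) *: 'e_k.
have sg1 : `|- Num.sg (partial k rho x)| = 1.
  by rewrite normrN normr_sg dk.
have vt : `|v| <= t.
  rewrite normrZ normrM sg1 mul1r gtr0_norm//.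
  by rewrite -[leRHS]mulr1 ler_wpM2l ?(ltW t0)// norm_basis_le.
exists (x + v); split; last first.
  by apply: Hd; apply: le_lt_trans vt _; apply: lt_le_trans tm _; rewrite ge_min lexx.
have [q /andP[q0 q1] E] := row_MVT (f := rho) (x := x) (v := v) (fun t _ => (defining_C1 _).1).
rewrite /= -(subr0 (rho (x + v))) -r0 E (bigD1 k)//= big1 ?addr0; last first.
  by move=> i ik; rewrite !mxE eqxx (negbTE ik) mulr0 mul0r.
rewrite !mxE !eqxx mulr1.
have qv : `|q *: v| < d1.
  rewrite normrZ gtr0_norm//; apply: (@le_lt_trans _ _ t).
    by apply: le_trans vt; rewrite ler_piMl// ltW.
  by apply: lt_le_trans tm _; rewrite ge_min lexx orbT.
have := Hd1 _ qv; set P := partial k rho _ => HP.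
rewrite r0 -mulrA mulNr oppr_lt0 mulrCA pmulr_rgt0//.
move: HP; rewrite ler_norml.
have [pos|neg|E0] := sgrP (partial k rho x).
- by move: dk; rewrite pos eqxx.
- by rewrite mul1r => /andP[H _]; lra.
- by rewrite mulN1r => /andP[_ H]; lra.
Qed.

Lemma boundary_chart (p0 : quat R) (c : R) : S p0 -> 0 < c ->
  exists (k : 'I_4) (r h : R) (g : 'rV[R]_3 -> R),
  [/\ 0 < r < c, 0 < h < c, C1_on [set y | `|y - del k p0| < r] g, g (del k p0) = p0 0 k &
     S `&` [set x | `|del k x - del k p0| < r /\ `|x 0 k - p0 0 k| < h] =
     graph_pt k g @` [set y | `|y - del k p0| < r]].
Proof.
move=> Sp c0; have [k dk] := boundary_grad Sp.
have [C1 _ _] := drho.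
have [r [h [g [r0 h0 gP C1g nz]]]] := implicit_graph C1 (rho_boundary Sp) dk c0.
exists k, r, h, g; split=> //.
  have y0r : `|del k p0 - del k p0| < r by rewrite subrr normr0; case/andP: r0.
  apply/esym/(gP _ y0r).2.
    by rewrite subrr normr0; case/andP: h0.
  by rewrite ins_del rho_boundary.
apply/seteqP; split=> [x /= [Sx [xr xh]]|x /= [y yr <-]].
  exists (del k x) => //; rewrite graph_ptE.
  rewrite -[RHS](ins_del k); congr ins; apply/esym/(gP _ xr).2 => //.
  by rewrite ins_del rho_boundary.
have [gh gu] := gP _ yr.
rewrite graph_ptE del_ins ins_at; split=> //.
(* The derivative in direction [k] is nonzero on the whole box, so every zero of [rho] in the box is
   a boundary point. *)
apply: (@rho0_boundary _ k); first exact/(gu _ gh).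
exact: nz.
Qed.

End DefiningFunction.

(** * Surface integrals of the Poisson kernel *)

(** A countable base of cubes with rational centres and radii 1/(m+1); it reduces Borel
    measurability of a row-valued map to that of its coordinates. *)
Lemma borel_open_bigcup {R : realType} (n : nat) (U : set 'rV[R]_n) : open U ->
  U = \bigcup_(q in
        [set q : 'rV[rat]_n * nat | [set v : 'rV[R]_n | forall i, `|v 0 i - ratr (q.1 0 i)| < (q.2.+1%:R)^-1] `<=` U])
      [set v : 'rV[R]_n | forall i, `|v 0 i - ratr (q.1 0 i)| < (q.2.+1%:R)^-1].
Proof.
move=> oU; apply/seteqP; split=> [x Ux|x [q qU /qU//]].
have /nbhs_rowP[d d0 Hd] : nbhs x U by exact: open_nbhs_nbhs.
have [m Hm] : exists m : nat, (m.+1%:R)^-1 < d / 2.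
  have := @cvg_harmonic R; move/cvgrPdist_lt => /(_ (d / 2)) [|m _ Hm]; first by rewrite divr_gt0.
  by exists m; have := Hm _ (leqnn m); rewrite /= sub0r normrN ger0_norm// invr_ge0.
have mm : 0 < (m.+1%:R : R)^-1 by [].
have /choice[q qP] : forall i, exists q : rat, `|x 0 i - ratr q| < (m.+1%:R)^-1.
  move=> i; have [|q] := @rat_in_itvoo R (x 0 i - (m.+1%:R)^-1) (x 0 i + (m.+1%:R)^-1).
    by rewrite ltrBlDr -addrA ltrDl addr_gt0.
  rewrite in_itv /=; set e := (m.+1%:R)^-1; move=> /andP[a b]; exists q; rewrite ltr_norml; apply/andP; split; lra.
exists (\row_i q i, m) => /=; last by move=> i; rewrite mxE.
move=> v vq; rewrite -(subrKC x v); apply: Hd; apply: norm_row_lt => // i.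
rewrite !mxE (_ : v 0 i - x 0 i = (v 0 i - ratr (q i)) - (x 0 i - ratr (q i))); last by ring.
apply: le_lt_trans (ler_normB _ _) _; rewrite (splitr d) ltrD//.
  by apply: lt_trans Hm; have := vq i; rewrite mxE.
by apply: lt_trans Hm.
Qed.

Lemma measurable_to_borel {R : realType} d (X : measurableType d) (n : nat)
    (f : X -> 'rV[R]_n) :
  (forall i, measurable_fun setT (fun x => f x 0 i)) ->
  measurable_fun setT (f : X -> borel n).
Proof.
move=> mf; apply: (@measurability _ _ X (borel n) setT f (@open 'rV[R]_n) erefl) => //.
move=> _ [U oU <-]; rewrite setTI [in X in measurable X](borel_open_bigcup oU).
rewrite preimage_bigcup bigcup_mkcond; apply: countable_bigcupT_measurable.
  exact: countableP.
move=> q; case: ifPn => // _.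
rewrite (_ : _ @^-1` _ = \bigcap_(i in [set: 'I_n])
   [set x | `|f x 0 i - ratr (q.1 0 i)| < (q.2.+1%:R)^-1]); last first.
  by apply/seteqP; split=> [x H i _|x H i]; exact: H.
apply: fin_bigcap_measurable; first exact: finite_finset.
move=> i _.
have mg : measurable_fun setT (fun x => `|f x 0 i - ratr (q.1 0 i)|).
  by apply: measurableT_comp => //; exact: measurable_funB.
rewrite (_ : [set x | _] = (fun x => `|f x 0 i - ratr (q.1 0 i)|) @^-1` `]-oo, (q.2.+1%:R)^-1[).
  by rewrite -[X in measurable X]setTI; apply: mg => //; exact: measurable_itv.
by apply/seteqP; split=> x /=; rewrite in_itv.
Qed.

Section Transfer.
Context {R : realType} d1 d2 (X : measurableType d1) (Y : measurableType d2).
Variables (mu : {measure set X -> \bar R}) (nu : {measure set Y -> \bar R}).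
Local Open Scope ereal_scope.

Lemma ge0_integral_mrestr d (T : measurableType d) (m : {measure set T -> \bar R})
    (D : set T) (mD : measurable D) (f : T -> \bar R) :
  (forall x, 0 <= f x) -> measurable_fun setT f ->
  \int[mrestr m mD]_x f x = \int[m]_(x in D) f x.
Proof.
move=> f0 mf; rewrite -(setUv D) ge0_integral_setU//; last 3 first.
- exact: measurableC.
- by apply: measurable_funS mf.
- exact/disj_setPCl.
rewrite [X in _ + X](_ : _ = 0) ?adde0.
  apply: eq_measure_integral => A mA AD.
  by change (m (A `&` D) = m A); rewrite setIidl.
rewrite -[RHS](@integral_measure_zero _ T R (~` D) f).
apply: eq_measure_integral => A mA AD; change (m (A `&` D) = 0).
by rewrite (_ : A `&` D = set0) ?measure0//; apply/disjoints_subset.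
Qed.

Variables (phi : X -> Y) (D : set X) (B : set Y).
Hypotheses (mphi : measurable_fun setT phi) (mD : measurable D) (mB : measurable B).
Variables (c : {nonneg R}) (f : Y -> \bar R).
Hypotheses (f0 : forall y, 0 <= f y) (mf : measurable_fun setT f).

(** The surface measure is prescribed on sets, through an area density. On a small chart this
    density is nearly constant, so a two-sided comparison with a constant multiple of Lebesgue
    measure can replace an exact change of variables. *)
Lemma ge0_integral_push_le :
  (forall A, measurable A -> nu (A `&` B) <= c%:num%:E * mu (phi @^-1` A `&` D)) ->
  \int[nu]_(y in B) f y <= c%:num%:E * \int[mu]_(x in D) f (phi x).
Proof.
move=> H; rewrite -(@ge0_integral_mrestr _ _ _ _ mB)//.
rewrite -(@ge0_integral_mrestr _ _ _ _ mD)//; last exact: measurableT_comp.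
have -> : \int[mrestr mu mD]_x f (phi x) = \int[pushforward (mrestr mu mD) phi]_y f y.
  by rewrite ge0_integral_pushforward.
rewrite -ge0_integral_mscale//.
by apply: ge0_le_measure_integral => // A mA; exact: H.
Qed.

Lemma ge0_integral_push_ge :
  (forall A, measurable A -> c%:num%:E * mu (phi @^-1` A `&` D) <= nu (A `&` B)) ->
  c%:num%:E * \int[mu]_(x in D) f (phi x) <= \int[nu]_(y in B) f y.
Proof.
move=> H; rewrite -(@ge0_integral_mrestr _ _ _ _ mB)//.
rewrite -(@ge0_integral_mrestr _ _ _ _ mD)//; last exact: measurableT_comp.
have -> : \int[mrestr mu mD]_x f (phi x) = \int[pushforward (mrestr mu mD) phi]_y f y.
  by rewrite ge0_integral_pushforward.
rewrite -ge0_integral_mscale//.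
by apply: ge0_le_measure_integral => // A mA; exact: H.
Qed.

End Transfer.

Lemma for_continuous_sum {R : realType} {T : topologicalType} (I : finType)
    (F : I -> T -> R) (x : T) : (forall i, {for x, continuous (F i)}) ->
  {for x, continuous (fun y => \sum_i F i y)}.
Proof.
move=> cF; elim: (index_enum I) => [|j s IHs].
  rewrite (_ : (fun y => _) = (fun=> 0)); first exact: cst_continuous.
  by apply/funext => y; rewrite big_nil.
rewrite (_ : (fun y => _) = (fun y => F j y + \sum_(i <- s) F i y)).
  exact: continuousD (cF j) IHs.
by apply/funext => y; rewrite big_cons.
Qed.

Definition area_density {R : realType} (g : 'rV[R]_3 -> R) (y : 'rV[R]_3) : R :=
  Num.sqrt (1 + \sum_(j < 3) partial j g y ^+ 2).

(** Squared length of the tangent vector over [u] of a graph with gradient [a]; [tilted_form] is the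
    same form in scalar coordinates. *)
Definition graph_form {R : realType} (a u : 'rV[R]_3) : R := sqn u + dot a u ^+ 2.

Section Charts.
Context {R : realType}.
Variables (Omega : set (quat R)) (rho : quat R -> R).
Hypothesis drho : defining_function rho Omega.
Local Notation S := (boundary Omega).

Lemma cube_open (n : nat) (y : 'rV[R]_n) (r : R) : open [set z | `|z - y| < r].
Proof.
rewrite (_ : mkset _ = (fun z => `|z - y|) @^-1` [set t | t < r])//.
apply: open_comp; last exact: open_lt.
move=> z _; apply: continuous_comp; last exact: norm_continuous.
by apply: continuousB; [exact: cvg_id|exact: cst_continuous].
Qed.

Lemma area_density_continuous (V : set 'rV[R]_3) (g : 'rV[R]_3 -> R) y :
  C1_on V g -> V y -> {for y, continuous (area_density g)}.
Proof.
move=> C1 Vy.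
have c1 : {for y, continuous (fun z => 1 + \sum_(j < 3) partial j g z ^+ 2)}.
  apply: continuousD; first exact: cst_continuous.
  by apply: for_continuous_sum => j; apply: continuousM; exact: (C1 _ Vy).2.
exact: continuous_comp c1 (@sqrt_continuous R _).
Qed.

(** A chart so small that areas and squared distances agree, up to the relative error [e], with
    those of the tangent hyperplane at [p0]. *)
Lemma boundary_good_chart (p0 : quat R) (e : R) : S p0 -> 0 < e ->
  exists (k : 'I_4) (a : 'rV[R]_3) (r h : R) (g : 'rV[R]_3 -> R),
  [/\ 0 < r, 0 < h, C1_on [set y | `|y - del k p0| < r] g,
      measurable_fun setT (g : borel 3 -> R) &
     [/\ g (del k p0) = p0 0 k,
      S `&` [set x | `|del k x - del k p0| < r /\ `|x 0 k - p0 0 k| < h] =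
       graph_pt k g @` [set y | `|y - del k p0| < r],
      forall y, `|y - del k p0| < r ->
        `|area_density g y - Num.sqrt (1 + sqn a)| <= e * Num.sqrt (1 + sqn a) &
      forall y z, `|y - del k p0| < r -> `|z - del k p0| < r ->
        `|sqn (y - z) + (g y - g z) ^+ 2 - graph_form a (y - z)| <= e * graph_form a (y - z)]].
Proof.
move=> Sp e0.
have [k [r0 [h [g0 [/andP[r00 r01] /andP[h0 h1] C1g0 gp0 SW0]]]]] := boundary_chart drho Sp ltr01.
pose y0 := del k p0.
pose a : 'rV[R]_3 := \row_j partial j g0 y0.
have y0r : `|y0 - y0| < r0 by rewrite subrr normr0.
have J1 : 1 <= Num.sqrt (1 + sqn a).
  by rewrite -[leLHS]sqrtr1 ler_wsqrtr// lerDl sqn_ge0.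
have J0 : area_density g0 y0 = Num.sqrt (1 + sqn a).
  by rewrite /area_density /sqn; congr (Num.sqrt (1 + _)); apply: eq_bigr => j _; rewrite mxE.
have /continuous_rowP/(_ _ e0)[r1 r10 Hr1] := area_density_continuous C1g0 y0r.
(* With remainder |th| <= e1 |v|, the squared chord differs from the flat one by 2 A th + th^2, at
   most 2 e1 (sqn v + A^2) as long as e1 <= 1. *)
pose e1 := Num.min 1 (e / 2).
have e10 : 0 < e1 by rewrite lt_min ltr01 divr_gt0.
have [r2 /andP[r20 r2r] Hr2] := C1_strict r00 C1g0 e10.
pose r := Num.min r1 r2.
have rr0 : 0 < r by rewrite lt_min r10.
have rr : r <= r0 by apply: le_trans r2r; rewrite ge_min lexx orbT.
pose V := [set y : 'rV[R]_3 | `|y - y0| < r].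
have oV : open V by exact: cube_open.
(* Extension by 0 off [V] makes the chart function measurable on the whole space. *)
pose g := g0 \_ V.
have gE y : V y -> g y = g0 y by move=> Vy; rewrite /g patchE mem_set.
have C1V0 : C1_on V g0 by move=> y Vy; apply: C1g0; exact: lt_le_trans rr.
have C1V : C1_on V g by apply: eq_C1_on oV _ C1V0 => y /gE.
have pE j y : V y -> partial j g y = partial j g0 y.
  move=> Vy; apply: near_eq_partial.
  have : nbhs y V by exact: open_nbhs_nbhs.
  by apply: filterS => z /gE.
have AE y : V y -> area_density g y = area_density g0 y.
  by move=> Vy; rewrite /area_density; congr (Num.sqrt (1 + _)); apply: eq_bigr => j _; rewrite pE.
exists k, a, r, h, g; split=> //.
  apply/(measurable_restrictT (g0 : borel 3 -> R)); first exact: borel_open.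
  apply: within_continuous_measurable; first exact: borel_open.
  apply: within_continuous_fun => y Vy.
  by apply: differentiable_continuous; have [] := C1V0 _ Vy.
split.
- by rewrite gE ?gp0// /V /= subrr normr0.
- apply/seteqP; split=> [x [Sx [xr xh]]|x [y yr <-]].
    have : (graph_pt k g0 @` [set y | `|y - del k p0| < r0]) x.
      by rewrite -SW0; split=> //; split=> //; exact: lt_le_trans rr.
    move=> [y yr yx]; have yE : y = del k x by rewrite -yx graph_ptE del_ins.
    exists (del k x) => //; rewrite -[RHS]yx !graph_ptE yE gE//.
  rewrite graph_ptE gE//.
  have : (S `&` [set x | `|del k x - del k p0| < r0 /\ `|x 0 k - p0 0 k| < h]) (graph_pt k g0 y).
    by rewrite SW0; exists y => //; exact: lt_le_trans rr.
  by rewrite graph_ptE /= del_ins ins_at => -[Sx [_ ?]]; split.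
- move=> y yr; rewrite AE//.
  have := Hr1 (y - y0); rewrite subrKC J0 => H.
  apply: (le_trans (H _)); first by apply: lt_le_trans yr _; rewrite ge_min lexx.
  by rewrite ler_peMr// ltW.
move=> y z yr zr; rewrite !gE//.
have yr2 : `|y - y0| < r2 by apply: lt_le_trans yr _; rewrite ge_min lexx orbT.
have zr2 : `|z - y0| < r2 by apply: lt_le_trans zr _; rewrite ge_min lexx orbT.
have := Hr2 z (y - z) zr2; rewrite subrKC => /(_ yr2).
have -> : \sum_i (y - z) 0 i * partial i g0 (del k p0) = dot a (y - z).
  by apply: eq_bigr => i _; rewrite mulrC [a 0 i]mxE.
set v := y - z; set A := dot a v; set th := _ - A => Hth.
have -> : g0 y - g0 z = A + th by rewrite /th subrKC.
have Hth2 : th ^+ 2 <= e1 ^+ 2 * `|v| ^+ 2.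
  by rewrite -exprMn -(real_normK (num_real th)) lerXn2r// ?nnegrE// mulr_ge0// ltW.
have v2 := sqn_ge_norm v; have s0 := sqn_ge0 v.
have HA : `|2 * A * th| <= e1 * (`|v| ^+ 2 + A ^+ 2).
  rewrite !normrM normr_nat.
  have h2 : 0 <= (`|v| - `|A|) ^+ 2 by exact: sqr_ge0.
  have h3 : `|A| ^+ 2 = A ^+ 2 by rewrite real_normK// num_real.
  apply: (@le_trans _ _ (2 * `|A| * (e1 * `|v|))); first by rewrite ler_wpM2l.
  rewrite (_ : 2 * `|A| * (e1 * `|v|) = e1 * (2 * `|v| * `|A|)); last by ring.
  by rewrite ler_wpM2l ?(ltW e10)// -h3; nra.
have e1e : 2 * e1 <= e.
  have : e1 <= e / 2 by rewrite ge_min lexx orbT.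
  by lra.
have e11 : e1 <= 1 by rewrite ge_min lexx.
rewrite /graph_form -/A.
rewrite (_ : _ - _ = 2 * A * th + th ^+ 2); last by ring.
apply: le_trans (ler_normD _ _) _; rewrite (ger0_norm (sqr_ge0 th)).
have A2 := sqr_ge0 A.
have e12 : e1 ^+ 2 <= e1 by rewrite expr2 ler_piMl// ltW.
apply: (@le_trans _ _ (e1 * (`|v| ^+ 2 + A ^+ 2) + e1 * `|v| ^+ 2)).
  by rewrite lerD//; apply: le_trans Hth2 _; rewrite ler_wpM2r// sqr_ge0.
apply: (@le_trans _ _ (2 * e1 * (sqn v + A ^+ 2))); last first.
  by rewrite ler_wpM2r// addr_ge0.
have : 0 <= e1 * (sqn v - `|v| ^+ 2) by rewrite mulr_ge0 ?(ltW e10)// subr_ge0.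
have : 0 <= e1 * A ^+ 2 by rewrite mulr_ge0// ltW.
nra.
Qed.

End Charts.

Section ChartIntegral.
Context {R : realType}.
Variables (S : set (quat R)) (sigma : {measure set (@borel R 4) -> \bar R}).
Hypothesis surf : surface_measure S sigma.
Variables (k : 'I_4) (a y0 : 'rV[R]_3) (r e : R) (g : 'rV[R]_3 -> R).
Hypotheses (r0 : 0 < r) (e0 : 0 < e) (e1 : e < 1).
Local Notation V := [set y : 'rV[R]_3 | `|y - y0| < r].
Local Notation B := (graph_pt k g @` V).
Local Notation J0 := (Num.sqrt (1 + sqn a)).
Let oV : open V. Proof. exact: cube_open. Qed.
Hypothesis C1g : C1_on V g.
Hypothesis mg : measurable_fun setT (g : borel 3 -> R).
Hypothesis BS : B `<=` S.
Hypothesis mB : measurable (B : set (borel 4)).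
Hypothesis HJ : forall y, V y -> `|area_density g y - J0| <= e * J0.
Hypothesis HQ : forall y z, V y -> V z ->
  `|sqn (y - z) + (g y - g z) ^+ 2 - graph_form a (y - z)| <= e * graph_form a (y - z).

Local Notation X := (measurableTypeR R * measurableTypeR R * measurableTypeR R)%type.

Definition chart_map (p : X) : borel 4 := graph_pt k g (row3 p).

Let mrow3 : measurable_fun setT (@row3 R : X -> borel 3).
Proof.
apply: measurable_to_borel => i.
case: i => -[|[|[|//]]] i3.
- rewrite (_ : (fun x => _) = (fun p : X => p.1.1)).
    by apply: measurableT_comp; exact: measurable_fst.
  by apply/funext => p; rewrite mxE.
- rewrite (_ : (fun x => _) = (fun p : X => p.1.2)).
    by apply: measurableT_comp; [exact: measurable_snd|exact: measurable_fst].
  by apply/funext => p; rewrite mxE.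
- rewrite (_ : (fun x => _) = (fun p : X => p.2)); first exact: measurable_snd.
  by apply/funext => p; rewrite mxE.
Qed.

Let mrow3_at i : measurable_fun setT (fun p : X => row3 p 0 i).
Proof.
apply: (@measurableT_comp _ _ _ _ _ _ (fun y : borel 3 => (y : 'rV[R]_3) 0 i)) => //.
apply: (@within_continuous_measurable R 3 setT) => //.
by apply: within_continuous_fun => y _; exact: coord_continuous.
Qed.

Let mchart : measurable_fun setT chart_map.
Proof.
apply: measurable_to_borel => i; rewrite /chart_map.
case: (unliftP k i) => [j ->|->].
  rewrite (_ : (fun x => _) = (fun p : X => row3 p 0 j)); first exact: mrow3_at.
  by apply/funext => p; rewrite graph_ptE ins_lift.
rewrite (_ : (fun x => _) = (fun p : X => g (row3 p))).
  exact: (measurableT_comp mg mrow3).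
by apply/funext => p; rewrite graph_ptE ins_at.
Qed.

Let D : set X := [set p | V (row3 p)].
Let mD : measurable D.
Proof.
rewrite -[X in measurable X]setTI; apply: mrow3 => //.
by apply: borel_open; exact: cube_open.
Qed.

Let J0_gt0 : 0 < J0.
Proof. by rewrite sqrtr_gt0 ltr_wpDr// sqn_ge0. Qed.

Let c1_ge0 : 0 <= (1 - e) * J0. Proof. by rewrite mulr_ge0 ?subr_ge0 ?(ltW e1)// ltW. Qed.
Let c2_ge0 : 0 <= (1 + e) * J0. Proof. by rewrite mulr_ge0 ?addr_ge0 ?(ltW e0)// ltW. Qed.

Let J_bounds p : D p -> (1 - e) * J0 <= area_density g (row3 p) <= (1 + e) * J0.
Proof. by move=> /HJ; rewrite ler_norml => /andP[a1 a2]; apply/andP; split; lra. Qed.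

Let sigma_chart A : measurable (A : set (borel 4)) ->
  ((((1 - e) * J0)%:E * @lebesgue3 R (chart_map @^-1` A `&` D) <= sigma (A `&` B)) /\
   (sigma (A `&` B) <= ((1 + e) * J0)%:E * @lebesgue3 R (chart_map @^-1` A `&` D)))%E.
Proof.
move=> mA.
have -> := surf.2 k V g oV C1g BS A mA.
have -> : [set p | V (row3 p) /\ A (graph_pt k g (row3 p))] = chart_map @^-1` A `&` D.
  by apply/seteqP; split=> p [].
have mE : measurable (chart_map @^-1` A `&` D).
  by apply: measurableI => //; rewrite -[X in measurable X]setTI; exact: mchart.
have mJ : measurable_fun (chart_map @^-1` A `&` D) (fun p => (area_density g (row3 p))%:E).
  apply/measurable_EFinP; apply: (@measurable_comp _ _ _ _ _ _ (V : set (borel 3))).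
  - by apply: borel_open; exact: cube_open.
  - by move=> _ [p [_ Dp] <-].
  - apply: within_continuous_measurable; first by apply: borel_open; exact: cube_open.
    by apply: within_continuous_fun => y Vy; exact: area_density_continuous Vy.
  - exact: measurable_funS mrow3.
split.
  rewrite -integral_cst//; apply: ge0_le_integral => //.
  - by move=> p [_ /J_bounds/andP[? _]]; rewrite lee_fin.
rewrite -integral_cst//; apply: ge0_le_integral => //.
- by move=> p [_ /J_bounds/andP[_ ?]]; rewrite lee_fin.
Qed.

(** Up to a constant factor, the Poisson kernel of a half-space of R^4, at height [d] above the
    boundary point [p]. *)
Definition poisson (d : R) (p z : quat R) : R := d / (sqn (z - p) + d ^+ 2) ^+ 2.

Lemma poisson_ge0 d p z : 0 < d -> 0 <= poisson d p z.
Proof. by move=> d0; rewrite divr_ge0 ?sqr_ge0// ltW. Qed.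

Lemma poisson_continuous d p : 0 < d -> continuous (poisson d p).
Proof.
move=> d0 z.
have c1 : {for z, continuous (fun z : quat R => sqn (z - p) + d ^+ 2)}.
  apply: continuousD; last exact: cst_continuous.
  apply: for_continuous_sum => i.
  have c2 : {for z, continuous (fun z : quat R => (z - p) 0 i)}.
    apply: (continuous_comp (f := fun z : quat R => z - p) (g := fun z : quat R => z 0 i)).
      by apply: continuousB; [exact: cvg_id|exact: cst_continuous].
    exact: coord_continuous.
  exact: (continuousM c2 c2).
have n0 : (sqn (z - p) + d ^+ 2) * (sqn (z - p) + d ^+ 2) != 0.
  by rewrite mulf_eq0 orbb gt_eqF// ltr_wpDl ?sqn_ge0// exprn_gt0.
have cc : {for z, continuous (fun=> d)} by exact: cst_continuous.
have c3 : {for z, continuous (fun z : quat R =>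
    ((sqn (z - p) + d ^+ 2) * (sqn (z - p) + d ^+ 2))^-1)}.
  apply: (@continuousV _ _ (fun z : quat R => (sqn (z - p) + d ^+ 2) * (sqn (z - p) + d ^+ 2)) z n0).
  exact: (continuousM c1 c1).
exact: (continuousM cc c3).
Qed.

Lemma poisson_measurable d p : 0 < d ->
  measurable_fun setT (fun z : borel 4 => (poisson d p z)%:E).
Proof.
move=> d0; apply/measurable_EFinP.
apply: (@within_continuous_measurable R 4 setT) => //.
by apply: within_continuous_fun => y _; exact: poisson_continuous.
Qed.

Let flat (d : R) (y p : 'rV[R]_3) : R := d / (graph_form a (p - y) + d ^+ 2) ^+ 2.

Let graph_form_ge0 (u : 'rV[R]_3) : 0 <= graph_form a u.
Proof. by rewrite addr_ge0 ?sqn_ge0 ?sqr_ge0. Qed.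

Let graph_form_tilted (p : X) (y : 'rV[R]_3) : graph_form a (row3 p - y) =
  tilted_form (a 0 0) (a 0 1) (a 0 2) (p.1.1 + - y 0 0) (p.1.2 + - y 0 1) (p.2 + - y 0 2).
Proof.
rewrite /graph_form /tilted_form /sqn /dot !big_ord_recl !big_ord0 !mxE /=.
have -> : lift ord0 (ord0 : 'I_2) = 1 :> 'I_3 by exact: val_inj.
have -> : lift ord0 (lift ord0 (ord0 : 'I_1)) = 2 :> 'I_3 by exact: val_inj.
have -> : ord0 = 0 :> 'I_3 by [].
by rewrite !addr0 !addrA.
Qed.

Let flat_integral d y : 0 < d ->
  (\int[@lebesgue3 R]_p (flat d y (row3 p))%:E = (pi ^+ 2 / J0)%:E)%E.
Proof.
move=> d0; under eq_integral do rewrite /flat graph_form_tilted.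
rewrite integral_tilted//; congr (_ / Num.sqrt _)%:E.
rewrite /sqn !big_ord_recl big_ord0.
have -> : lift ord0 (ord0 : 'I_2) = 1 :> 'I_3 by exact: val_inj.
have -> : lift ord0 (lift ord0 (ord0 : 'I_1)) = 2 :> 'I_3 by exact: val_inj.
by rewrite !addr0 !addrA.
Qed.

Let flat_ge0 d y p : 0 < d -> 0 <= flat d y p.
Proof. by move=> d0; rewrite divr_ge0 ?sqr_ge0// ltW. Qed.

Let flat_measurable d y : 0 < d -> measurable_fun setT (fun p : X => (flat d y (row3 p))%:E).
Proof.
move=> d0; apply/measurable_EFinP.
rewrite (_ : (fun p => _) = (fun p : X => d / (tilted_form (a 0 0) (a 0 1) (a 0 2)
  (p.1.1 + - y 0 0) (p.1.2 + - y 0 1) (p.2 + - y 0 2) + d ^+ 2) ^+ 2)).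
  apply: measurable_tilted => //.
  + by apply: measurable_funD => //; apply: measurableT_comp => //; exact: measurable_fst.
  + by apply: measurable_funD => //; apply: measurableT_comp => //; exact: measurable_fst.
  + by apply: measurable_funD => //; exact: measurable_snd.
by apply/funext => p; rewrite /flat graph_form_tilted.
Qed.

(** The chord is within a factor 1 - e to 1 + e of the flat form; adding d^2 to both preserves this,
    and the power -2 of the kernel squares the factor. *)
Let poisson_flat d (y : 'rV[R]_3) (p : X) : 0 < d -> V y -> D p ->
  (1 + e) ^- 2 * flat d y (row3 p) <= poisson d (graph_pt k g y) (chart_map p) <=
  (1 - e) ^- 2 * flat d y (row3 p).
Proof.
move=> d0 Vy Dp; rewrite /poisson /chart_map !graph_ptE -insB sqn_ins.
have := HQ Dp Vy; set Q := graph_form a _; set E := sqn _ + _.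
have Q0 : 0 <= Q by exact: graph_form_ge0.
have dd0 : 0 < d ^+ 2 by rewrite exprn_gt0.
rewrite [_ ^+ 2 + sqn _]addrC -/E ler_norml => /andP[l1 l2].
have ed : 0 <= e * d ^+ 2 by rewrite mulr_ge0 ?(ltW e0)// ltW.
have e1' : 0 < 1 - e by rewrite subr_gt0.
have e2' : 0 < 1 + e by rewrite addr_gt0.
have F1 : 0 < Q + d ^+ 2 by rewrite ltr_wpDl.
have E0 : 0 <= E by rewrite addr_ge0 ?sqn_ge0 ?sqr_ge0.
have F2 : 0 < E + d ^+ 2 by rewrite ltr_wpDl.
rewrite /flat -/Q !mulrA ![_ ^- 2 * d]mulrC -!mulrA -!invfM -!exprMn.
rewrite !ler_pM2l// !lef_pV2 ?posrE ?exprn_gt0 ?mulr_gt0//.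
rewrite !lerXn2r ?nnegrE ?mulr_ge0 ?(ltW F1) ?(ltW F2) ?(ltW e1') ?(ltW e2')//=.
by lra.
by lra.
Qed.

Let mpush (f : borel 4 -> \bar R) : measurable_fun setT f -> measurable_fun setT (fun p => f (chart_map p)).
Proof. by move=> mf; exact: measurableT_comp. Qed.

(** The numerator 1 + e comes from the area density and the denominator from the kernel; replacing
    the chart by all of R^3 only enlarges the flat integral. *)
Lemma chart_poisson_le d y : 0 < d -> V y ->
  (\int[sigma]_(z in B) (poisson d (graph_pt k g y) z)%:E <=
   ((1 + e) / (1 - e) ^+ 2 * pi ^+ 2)%:E)%E.
Proof.
move=> d0 Vy.
have P0 z : (0 <= (poisson d (graph_pt k g y) z)%:E)%E by rewrite lee_fin poisson_ge0.
have mP := poisson_measurable (graph_pt k g y) d0.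
apply: (le_trans (@ge0_integral_push_le _ _ _ _ _ (@lebesgue3 R) sigma _ _ _
   mchart mD mB (NngNum c2_ge0) _ P0 mP _)) => /=.
  by move=> A mA; exact: (sigma_chart mA).2.
have inv0 : 0 <= (1 - e) ^- 2 by rewrite invr_ge0 sqr_ge0.
have H : (\int[@lebesgue3 R]_(x in D) (poisson d (graph_pt k g y) (chart_map x))%:E <=
   ((1 - e) ^- 2 * (pi ^+ 2 / J0))%:E)%E.
  rewrite EFinM -(flat_integral y d0) -ge0_integralZl_EFin//; last 2 first.
  - by move=> p _; rewrite lee_fin flat_ge0.
  - exact: flat_measurable.
  apply: (@le_trans _ _ (\int[@lebesgue3 R]_(x in D) (((1 - e) ^- 2)%:E * (flat d y (row3 x))%:E))%E).
    apply: ge0_le_integral => //.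
    - exact: measurable_funS (mpush mP).
    - apply: measurable_funS (measurableT) _ _ => //.
      by apply: measurable_funeM; exact: flat_measurable.
    - by move=> p Dp; rewrite -EFinM lee_fin; case/andP: (poisson_flat d0 Vy Dp).
  apply: ge0_subset_integral => //.
  - by apply: measurable_funeM; exact: flat_measurable.
  - by move=> p _; rewrite -EFinM lee_fin mulr_ge0// flat_ge0.
apply: (le_trans (lee_wpmul2l _ H)); first by rewrite lee_fin.
rewrite -EFinM lee_fin le_eqVlt; apply/orP; left; apply/eqP.
by field; rewrite !gt_eqF// subr_gt0.
Qed.

Lemma chart_poisson_ge d y : 0 < d -> `|y - y0| < r / 2 ->
  ((((1 - e) / (1 + e) ^+ 2) * pi ^+ 2 * (1 - 8 * d / r))%:E <=
  \int[sigma]_(z in B) (poisson d (graph_pt k g y) z)%:E)%E.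
Proof.
move=> d0 Vy2; have r20 : 0 < r / 2 by rewrite divr_gt0.
have Vy : V y by apply: lt_trans Vy2 _; rewrite ltr_pdivrMr// ltr_pMr// ltr1n.
have P0 z : (0 <= (poisson d (graph_pt k g y) z)%:E)%E by rewrite lee_fin poisson_ge0.
have mP := poisson_measurable (graph_pt k g y) d0.
apply: (le_trans _ (@ge0_integral_push_ge _ _ _ _ _ (@lebesgue3 R) sigma _ _ _
   mchart mD mB (NngNum c1_ge0) _ P0 mP _)) => /=; last first.
  by move=> A mA; exact: (sigma_chart mA).1.
have inv0 : 0 <= (1 + e) ^- 2 by rewrite invr_ge0 sqr_ge0.
have mf := flat_measurable y d0.
have mfr := flat_measurable y r20.
(* As [y] is within r/2 of the centre, the flat form is at least (r/2)^2 off the chart. There the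
   kernel of height [d] is at most 4 d / (r/2) times the kernel of height r/2, whose total mass is
   known. *)
have tail : (\int[@lebesgue3 R]_(x in ~` D) (flat d y (row3 x))%:E <=
    (4 * d / (r / 2) * (pi ^+ 2 / J0))%:E)%E.
  have c0 : 0 <= 4 * d / (r / 2) by rewrite divr_ge0 ?mulr_ge0// ltW.
  rewrite EFinM -(flat_integral y r20) -ge0_integralZl_EFin//; last first.
    by move=> p _; rewrite lee_fin flat_ge0.
  apply: (@le_trans _ _ (\int[@lebesgue3 R]_(x in ~` D)
     ((4 * d / (r / 2))%:E * (flat (r / 2) y (row3 x))%:E))%E).
    apply: ge0_le_integral => //.
    - exact: measurableC.
    - by move=> p _; rewrite lee_fin flat_ge0.
    - exact: measurable_funS mf.
    - apply: measurable_funS (measurableT) _ _ => //.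
      by apply: measurable_funeM.
    - move=> p nDp; rewrite -EFinM lee_fin.
      have far : (r / 2) ^+ 2 <= graph_form a (row3 p - y).
        have : r / 2 <= `|row3 p - y|.
          rewrite leNgt; apply/negP => H; apply: nDp; rewrite /D /=.
          rewrite (_ : row3 p - y0 = (row3 p - y) + (y - y0)); last by rewrite addrA subrK.
          by apply: le_lt_trans (ler_normD _ _) _; rewrite (splitr r) ltrD.
        move=> H; apply: (@le_trans _ _ (sqn (row3 p - y))); last by rewrite lerDl sqr_ge0.
        apply: le_trans (sqn_ge_norm _); by rewrite lerXn2r ?nnegrE ?(ltW r20) ?normr_ge0.
      rewrite /flat; set Q := graph_form a _ in far *; set s := r / 2 in far r20 *.
      have s2 : 0 < s ^+ 2 by rewrite exprn_gt0.
      have Qs : 0 < Q by apply: lt_le_trans far.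
      have dd : 0 < d ^+ 2 by rewrite exprn_gt0.
      rewrite [leRHS](_ : _ = d * (4 / (Q + s ^+ 2) ^+ 2)); last first.
        by field; rewrite !gt_eqF// addr_gt0.
      have F0 : 0 < (Q + d ^+ 2) ^+ 2 by rewrite exprn_gt0// addr_gt0.
      have G0 : 0 < (Q + s ^+ 2) ^+ 2 by rewrite exprn_gt0// addr_gt0.
      rewrite ler_pM2l// -[leLHS]div1r ler_pdivrMr// mulrAC ler_pdivlMr// mul1r.
      rewrite (_ : 4 * _ = (2 * (Q + d ^+ 2)) ^+ 2); last by ring.
      have A1 : 0 <= Q + s ^+ 2 by rewrite addr_ge0// ltW.
      have A2 : 0 <= 2 * (Q + d ^+ 2) by rewrite mulr_ge0// addr_ge0// ltW.
      by rewrite lerXn2r ?nnegrE//; lra.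
  apply: ge0_subset_integral => //.
  - exact: measurableC.
  - by apply: measurable_funeM.
  - by move=> p _; rewrite -EFinM lee_fin mulr_ge0// flat_ge0.
have H : (((1 + e) ^- 2 * ((pi ^+ 2 / J0) * (1 - 8 * d / r)))%:E <=
  \int[@lebesgue3 R]_(x in D) (poisson d (graph_pt k g y) (chart_map x))%:E)%E.
  apply: (@le_trans _ _ (\int[@lebesgue3 R]_(x in D) (((1 + e) ^- 2)%:E * (flat d y (row3 x))%:E))%E); last first.
    apply: ge0_le_integral => //.
    - by move=> p _; rewrite -EFinM lee_fin mulr_ge0// flat_ge0.
    - apply: measurable_funS (measurableT) _ _ => //.
      by apply: measurable_funeM.
    - exact: measurable_funS (mpush mP).
    - by move=> p Dp; rewrite -EFinM lee_fin; case/andP: (poisson_flat d0 Vy Dp).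
  rewrite ge0_integralZl_EFin//; last 2 first.
  - by move=> p _; rewrite lee_fin flat_ge0.
  - exact: measurable_funS mf.
  rewrite EFinM lee_wpmul2l ?lee_fin//.
  have := flat_integral y d0; rewrite -(setUv D) ge0_integral_setU//; last 4 first.
  - exact: measurableC.
  - by rewrite setUv.
  - by move=> p _; rewrite lee_fin flat_ge0.
  - exact/disj_setPCl.
  move=> E; rewrite (_ : pi ^+ 2 / J0 * (1 - 8 * d / r) =
    pi ^+ 2 / J0 - 4 * d / (r / 2) * (pi ^+ 2 / J0)); last by field; rewrite !gt_eqF.
  by rewrite EFinB -E leeBlDr// leeD2l.
apply: (le_trans _ (lee_wpmul2l _ H)); last by rewrite lee_fin.
rewrite -EFinM lee_fin le_eqVlt; apply/orP; left; apply/eqP.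
by field; rewrite !gt_eqF// addr_gt0.
Qed.

End ChartIntegral.

Lemma ler_sqr_ge0 {R : realDomainType} (a b : R) : 0 <= a -> a <= b -> a ^+ 2 <= b ^+ 2.
Proof. by move=> a0 ab; rewrite lerXn2r ?nnegrE// (le_trans a0). Qed.

Section PoissonArithmetic.
Context {R : realFieldType}.
Implicit Types (e k x q eps : R).

Lemma ratio_upper e : 0 < e -> e <= 2^-1 -> (1 + e) / (1 - e) ^+ 2 <= 1 + 12 * e.
Proof.
move=> e0 e2; rewrite ler_pdivrMr ?exprn_gt0 ?subr_gt0//; last by lra.
rewrite -subr_ge0 (_ : _ - _ = e * ((1 - 2 * e) * (9 - 5 * e) + 2 * e ^+ 2)); last by ring.
apply: mulr_ge0; first exact: ltW.
have : 0 <= (1 - 2 * e) * (9 - 5 * e) by apply: mulr_ge0; lra.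
by have := sqr_ge0 e; lra.
Qed.

Lemma ratio_lower e : 0 < e -> e <= 2^-1 ->
  1 - 4 * e <= (1 - e) / (1 + e) ^+ 2 /\ (1 - e) / (1 + e) ^+ 2 <= 1.
Proof.
move=> e0 e2; rewrite ler_pdivlMr ?ler_pdivrMr ?exprn_gt0 ?addr_gt0//.
by split; nra.
Qed.

Lemma poisson_upper e k q eps : k <= 1 + 12 * e -> 24 * e * q <= eps -> 0 <= q -> 0 < eps ->
  k * q + eps / 2 <= q + eps.
Proof. by move=> ke ee q0 eps0; have := ler_wpM2r q0 ke; lra. Qed.

Lemma poisson_lower e k x q eps : 1 - 4 * e <= k -> k <= 1 -> 0 <= x -> x * q <= eps / 6 ->
  24 * e * q <= eps -> 0 <= q -> 0 < eps -> q - eps <= k * q * (1 - x).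
Proof.
move=> H1 H2 x0 xr ee q0 eps0; have := ler_wpM2r q0 H1.
have : 0 <= q * x * (1 - k) by apply: mulr_ge0; [exact: mulr_ge0|rewrite subr_ge0].
by lra.
Qed.

Lemma poisson_scale (d r q eps : R) : d * 48 * q <= r * eps -> 8 * d * q <= eps / 6 * r.
Proof. by lra. Qed.

End PoissonArithmetic.

Section PoissonLimit.
Context {R : realType}.
Variables (Omega : set (quat R)) (rho : quat R -> R).
Variable sigma : {measure set (@borel R 4) -> \bar R}.
Hypothesis drho : defining_function rho Omega.
Hypothesis bOmega : bounded_set Omega.
Local Notation S := (boundary Omega).
Hypothesis surf : surface_measure S sigma.

Lemma box_open (k : 'I_4) (y0 : 'rV[R]_3) (t0 r h : R) :
  open [set x : quat R | `|del k x - y0| < r /\ `|x 0 k - t0| < h].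
Proof.
rewrite (_ : mkset _ = [set x : quat R | `|del k x - y0| < r] `&`
  [set x : quat R | `|x 0 k - t0| < h])//.
apply: openI.
  rewrite openE => x /= xr; apply/nbhs_rowP.
  exists (r - `|del k x - y0|); first by rewrite subr_gt0.
  move=> v vr /=; rewrite (_ : del k (x + v) - y0 = (del k x - y0) + del k v); last first.
    by apply/rowP => j; rewrite !mxE; ring.
  apply: le_lt_trans (ler_normD _ _) _; rewrite -ltrBrDl.
  by apply: le_lt_trans (norm_del_le _ _) vr.
rewrite openE => x /= xr; apply/nbhs_rowP.
exists (h - `|x 0 k - t0|); first by rewrite subr_gt0.
move=> v vr /=; rewrite mxE addrAC.
apply: le_lt_trans (ler_normD _ _) _; rewrite -ltrBrDl.
by apply: le_lt_trans (norm_coord_le _ _) vr.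
Qed.

Let mS : measurable (S : set (borel 4)).
Proof. by apply: borel_closed; exact: boundary_closed drho. Qed.

(** Finiteness is not part of the definition of the surface measure. It follows locally from the
    bound on the Poisson integral at height 1, because the kernel is bounded below on a bounded
    chart. *)
Let finite_chart p0 : S p0 -> exists W : set (quat R),
  [/\ open W, W p0 & (sigma (S `&` W) < +oo)%E].
Proof.
move=> Sp; have e0 : 0 < 2^-1 :> R by [].
have [k [a [r [h [g [r0 h0 C1g mg [gp SW HJ HQ]]]]]]] := boundary_good_chart drho Sp e0.
pose W := [set x | `|del k x - del k p0| < r /\ `|x 0 k - p0 0 k| < h].
have oW : open W by exact: box_open.
have mB : measurable (graph_pt k g @` [set y | `|y - del k p0| < r] : set (borel 4)).
  by rewrite -SW; apply: measurableI => //; exact: borel_open.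
have BS : graph_pt k g @` [set y | `|y - del k p0| < r] `<=` S by rewrite -SW => x [].
exists W; split=> //.
  by rewrite /W /= !subrr !normr0.
have y0r : `|del k p0 - del k p0| < r by rewrite subrr normr0.
have e1 : 2^-1 < 1 :> R by rewrite invf_lt1// ltr1n.
have pE : graph_pt k g (del k p0) = p0 by rewrite graph_ptE gp ins_del.
have := chart_poisson_le surf e0 e1 C1g mg BS mB HJ HQ ltr01 y0r; rewrite pE => HP.
rewrite SW; set B := _ @` _ in BS mB HP *.
pose m := r + h; pose K := ((4 * m ^+ 2 + 1) ^+ 2)^-1.
have m0 : 0 < m by rewrite addr_gt0.
have K0 : 0 < K by rewrite invr_gt0 exprn_gt0// ltr_wpDl// mulr_ge0// sqr_ge0.
have lower : (K%:E * sigma B <= \int[sigma]_(z in B) (poisson 1 p0 z)%:E)%E.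
  rewrite -integral_cst//; apply: ge0_le_integral => //.
  - by move=> z _; rewrite lee_fin ltW.
  - by apply: measurable_funS (poisson_measurable _ _).
  move=> z Bz; rewrite lee_fin /poisson div1r lef_pV2 ?posrE ?exprn_gt0//; last first.
  - by rewrite ltr_wpDl// sqn_ge0.
  - by rewrite ltr_wpDl// mulr_ge0// sqr_ge0.
  apply: ler_sqr_ge0; first by rewrite addr_ge0 ?sqn_ge0.
  rewrite expr1n lerD2r; apply: le_trans (sqn_le_norm _) _.
  rewrite ler_wpM2l// ler_sqr_ge0//.
  move: Bz; rewrite /B -SW => -[_ [zr zh]]; rewrite -(ins_del k z) -[p0 in X in X <= _](ins_del k p0) -insB.
  apply: norm_ins_le; first exact: ltW.
    by apply: le_trans (ltW zr) _; rewrite lerDl ltW.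
  by apply: le_trans (ltW zh) _; rewrite lerDr ltW.
rewrite ltey; apply/eqP => E; move: (le_trans lower HP); by rewrite E gt0_muley.
Qed.

Lemma boundary_finite : (sigma S < +oo)%E.
Proof.
have /choice[W WP] : forall p, exists W : set (quat R),
    open W /\ (S p -> W p /\ (sigma (S `&` W) < +oo)%E).
  move=> p; have [/finite_chart[W [? ? ?]]|nS] := pselect (S p); first by exists W.
  by exists setT; split=> //; exact: openT.
have := boundary_compact drho bOmega; rewrite compact_cover => /(_ _ S W) [].
- by move=> p _; exact: (WP p).1.
- by move=> p Sp; exists p => //; exact: ((WP p).2 Sp).1.
move=> D' D'S SD'.
have mSW p : measurable (S `&` W p : set (borel 4)).
  by apply: measurableI => //; apply: borel_open; exact: (WP p).1.
have key (s : seq (quat R)) : (forall p, p \in s -> S p) ->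
    measurable (\big[setU/set0]_(p <- s) (S `&` W p) : set (borel 4)) /\
    (sigma (\big[setU/set0]_(p <- s) (S `&` W p)) < +oo)%E.
  elim: s => [|p s IHs] sS; first by rewrite big_nil measure0.
  have [|m1 m2] := IHs; first by move=> q qs; apply: sS; rewrite inE qs orbT.
  rewrite big_cons; split; first exact: measurableU.
  set A := S `&` W p; set C := \big[setU/set0]_(_ <- _) _ in m1 m2 *.
  have -> : A `|` C = A `|` (C `\` A).
    apply/seteqP; split=> z [Az|Cz]; [by left| |by left|by right; case: Cz].
    by have [Az|nAz] := pselect (A z); [left|right].
  have Af : (sigma A < +oo)%E by apply: ((WP p).2 (sS p _)).2; rewrite inE eqxx.
  rewrite measureU//; last by apply/disjoints_subset => z Az [_].
    apply: lte_add_pinfty => //; apply: le_lt_trans m2.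
    by apply: le_measure; [apply/mem_set; exact: (measurableD m1 (mSW p))|exact/mem_set|exact: subDsetl].
  - exact: (mSW p).
  - exact: (measurableD m1 (mSW p)).
have [p /D'S/set_mem//|m1 m2] := key (finmap.enum_fset D').
apply: le_lt_trans m2; apply: le_measure; rewrite ?inE//.
move=> x Sx; have [p /= pD Wx] := SD' _ Sx.
rewrite -bigcup_seq; exists p => //=; by split.
Qed.

Let cS : compact S. Proof. exact: boundary_compact drho bOmega. Qed.

(** The limit is uniform in the base point [p], as the jump relation requires: there [p] is a
    nearest boundary point and moves with the interior point. *)
Lemma poisson_limit p0 (eps : R) : S p0 -> 0 < eps ->
  exists2 eta, 0 < eta & forall p, S p -> `|p - p0| < eta -> forall d, 0 < d < eta ->
    `|\int[sigma]_(z in S) poisson d p z - pi ^+ 2| <= eps.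
Proof.
move=> Sp eps0; have pi0 := pi_gt0 R; have pi2 : 0 < (pi : R) ^+ 2 by rewrite exprn_gt0// pi_gt0.
(* The chart bounds lose a factor of at most 1 + 12 e, and 12 e pi^2 has to stay below eps / 2. *)
pose e := Num.min 2^-1 (eps / (24 * pi ^+ 2)) : R.
have e0 : 0 < e by rewrite lt_min invr_gt0 ltr0n divr_gt0// mulr_gt0.
have e2 : e <= 2^-1 by rewrite ge_min lexx.
have e1 : e < 1 by apply: le_lt_trans e2 _; rewrite invf_lt1// ltr1n.
have ee : 24 * e * pi ^+ 2 <= eps.
  have : e <= eps / (24 * pi ^+ 2) by rewrite ge_min lexx orbT.
  by rewrite ler_pdivlMr ?mulr_gt0// => H; lra.
clearbody e.
have [k [a [r [h [g [r0 h0 C1g mg [gp SW HJ HQ]]]]]]] := boundary_good_chart drho Sp e0.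
pose W := [set x | `|del k x - del k p0| < r /\ `|x 0 k - p0 0 k| < h].
have oW : open W by exact: box_open.
have mB : measurable (graph_pt k g @` [set y | `|y - del k p0| < r] : set (borel 4)).
  by rewrite -SW; apply: measurableI => //; exact: borel_open.
have BS : graph_pt k g @` [set y | `|y - del k p0| < r] `<=` S by rewrite -SW => x [].
set B := _ @` _ in BS mB SW.
pose m := Num.min r h.
have m0 : 0 < m by rewrite lt_min r0.
pose s := fine (sigma S).
have s0 : 0 <= s by rewrite fine_ge0.
have sE : sigma S = s%:E by rewrite fineK// ge0_fin_numE// boundary_finite.
pose c := (2 / m) ^+ 4 * s.
have c0 : 0 <= c by rewrite mulr_ge0// exprn_ge0// divr_ge0// ltW.
(* The first entry keeps [p] well inside the chart. The second bounds the integral off the chart,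
   where the kernel is at most d (2/m)^4. The third makes the missing tail, of relative size 8 d /
   r, cost at most eps / 6. *)
pose eta := Num.min (m / 2) (Num.min (eps / (2 * (c + 1))) (r * eps / (48 * pi ^+ 2))).
exists eta.
  by rewrite !lt_min !divr_gt0// ?mulr_gt0// ltr_wpDl.
move=> p Sp' pp0 d /andP[d0 deta].
have pm : `|p - p0| < m / 2 by apply: lt_le_trans pp0 _; rewrite ge_min lexx.
have dm : d < eps / (2 * (c + 1)).
  by apply: lt_le_trans deta _; rewrite ge_min; apply/orP; right; rewrite ge_min lexx.
have dr : d < r * eps / (48 * pi ^+ 2).
  by apply: lt_le_trans deta _; rewrite ge_min; apply/orP; right; rewrite ge_min lexx orbT.
have mr : m <= r by rewrite ge_min lexx.
have mh : m <= h by rewrite ge_min lexx orbT.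
have yr2 : `|del k p - del k p0| < r / 2.
  rewrite -delB; apply: le_lt_trans (norm_del_le _ _) _; apply: lt_le_trans pm _.
  by rewrite ler_wpM2r.
have yr : `|del k p - del k p0| < r by apply: lt_trans yr2 _; rewrite ltr_pdivrMr// ltr_pMr// ltr1n.
have pB : B p.
  rewrite -SW; split=> //; split=> //.
  rewrite (_ : p 0 k - p0 0 k = (p - p0) 0 k); last by rewrite !mxE.
  apply: le_lt_trans (norm_coord_le _ _) _; apply: lt_trans pm _.
  by apply: lt_le_trans mh; rewrite ltr_pdivrMr// ltr_pMr// ltr1n.
have pE : p = graph_pt k g (del k p).
  by case: pB => y _ <-; rewrite graph_ptE del_ins.
have up := chart_poisson_le surf e0 e1 C1g mg BS mB HJ HQ d0 yr.
have lo := chart_poisson_ge surf r0 e0 e1 C1g mg BS mB HJ HQ d0 yr2.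
rewrite -pE -/B in up lo.
have P0 z : (0 <= (poisson d p z)%:E)%E by rewrite lee_fin poisson_ge0.
have mP := poisson_measurable p d0.
have far : (\int[sigma]_(z in S `\` B) (poisson d p z)%:E <= (eps / 2)%:E)%E.
  apply: (@le_trans _ _ (\int[sigma]_(z in S `\` B) (cst (d * (2 / m) ^+ 4)%:E z))%E).
    apply: ge0_le_integral => //.
    - exact: measurableD.
    - exact: measurable_funS mP.
    move=> z [Sz nBz]; rewrite lee_fin /poisson ler_wpM2l ?(ltW d0)//.
    have zp : m / 2 <= `|z - p|.
      rewrite leNgt; apply/negP => zp; apply: nBz; rewrite -SW; split=> //.
      have zp0 : `|z - p0| < m.
        rewrite (_ : z - p0 = (z - p) + (p - p0)); last by rewrite addrA subrK.
        by apply: le_lt_trans (ler_normD _ _) _; rewrite (splitr m) ltrD.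
      split.
        by rewrite -delB; apply: le_lt_trans (norm_del_le _ _) _; exact: lt_le_trans mr.
      rewrite (_ : z 0 k - p0 0 k = (z - p0) 0 k); last by rewrite !mxE.
      by apply: le_lt_trans (norm_coord_le _ _) _; exact: lt_le_trans mh.
    have m20 : 0 < m / 2 by rewrite divr_gt0.
    rewrite (_ : (2 / m) ^+ 4 = (((m / 2) ^+ 2) ^+ 2)^-1); last by field; rewrite gt_eqF.
    have q0 : 0 < (m / 2) ^+ 2 by rewrite exprn_gt0.
    have sq : (m / 2) ^+ 2 <= sqn (z - p) + d ^+ 2.
      apply: (@le_trans _ _ (sqn (z - p))); last by rewrite lerDl sqr_ge0.
      apply: le_trans (sqn_ge_norm _).
      by rewrite lerXn2r ?nnegrE ?normr_ge0 ?(ltW m20).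
    have q1 : 0 < sqn (z - p) + d ^+ 2 by exact: lt_le_trans sq.
    rewrite lef_pV2 ?posrE ?(exprn_gt0 2 q0) ?(exprn_gt0 2 q1)//.
    by rewrite lerXn2r ?nnegrE ?(ltW q0) ?(ltW q1).
  rewrite integral_cst; last exact: measurableD.
  have dm0 : 0 <= d * (2 / m) ^+ 4 by rewrite mulr_ge0 ?(ltW d0)// exprn_ge0// divr_ge0// ltW.
  apply: (@le_trans _ _ ((d * (2 / m) ^+ 4)%:E * sigma S)%E).
    apply: lee_wpmul2l; first by rewrite lee_fin.
    by apply: le_measure; [apply/mem_set; exact: measurableD|exact/mem_set|exact: subDsetl].
  rewrite sE -EFinM lee_fin -mulrA -/c.
  move: dm; rewrite ltr_pdivlMr ?mulr_gt0 ?ltr_wpDl// => dm.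
  by rewrite ler_pdivlMr//; nra.
have SE : (\int[sigma]_(z in S) (poisson d p z)%:E =
   \int[sigma]_(z in B) (poisson d p z)%:E + \int[sigma]_(z in S `\` B) (poisson d p z)%:E)%E.
  rewrite -ge0_integral_setU//.
  - by rewrite setDUK.
  - exact: measurableD.
  - exact: measurable_funS mP.
  - by rewrite disj_set2E; apply/eqP/disjoints_subset => z Bz [_].
have far0 : (0 <= \int[sigma]_(z in S `\` B) (poisson d p z)%:E)%E by exact: integral_ge0.
have UP : (\int[sigma]_(z in S) (poisson d p z)%:E <= (pi ^+ 2 + eps)%:E)%E.
  rewrite SE; apply: (le_trans (leeD up far)); rewrite -EFinD lee_fin.
  exact: poisson_upper (ratio_upper e0 e2) ee (ltW pi2) eps0.
have LO : ((pi ^+ 2 - eps)%:E <= \int[sigma]_(z in S) (poisson d p z)%:E)%E.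
  rewrite SE; apply: (@le_trans _ _ (\int[sigma]_(z in B) (poisson d p z)%:E)%E); last by rewrite leeDl.
  apply: le_trans lo; rewrite lee_fin.
  have x0 : 0 <= 8 * d / r by rewrite divr_ge0 ?mulr_ge0// ltW.
  have xr : 8 * d / r * pi ^+ 2 <= eps / 6.
    rewrite mulrAC ler_pdivrMr//; move: dr; rewrite ltr_pdivlMr ?mulr_gt0//.
    by rewrite mulrA => /ltW; exact: poisson_scale.
  have [H1 H2] := ratio_lower e0 e2.
  exact: poisson_lower H1 H2 x0 xr ee (ltW pi2) eps0.
have fin : (\int[sigma]_(z in S) (poisson d p z)%:E)%E \is a fin_num.
  rewrite ge0_fin_numE; last exact: integral_ge0.
  by apply: le_lt_trans UP _; rewrite ltry.
rewrite /Rintegral; move: UP LO; rewrite -(fineK fin) !lee_fin /= => UP LO.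
by rewrite ler_distl UP andbT LO.
Qed.

End PoissonLimit.

(** * The jump relation *)

Lemma sqn_ball_le {R : realType} {n : nat} (v : 'rV[R]_n) (d : R) : 0 <= d ->
  sqn v <= d ^+ 2 -> `|v| <= d.
Proof.
move=> d0 vd; rewrite -[leLHS]ger0_norm// -[leRHS]ger0_norm// -ler_sqr ?nnegrE//.
by rewrite !ger0_norm//; apply: le_trans (sqn_ge_norm v) vd.
Qed.

Section Normal.
Context {R : realType}.
Variables (Omega : set (quat R)) (rho : quat R -> R).
Hypothesis drho : defining_function rho Omega.
Hypothesis bOmega : bounded_set Omega.
Local Notation S := (boundary Omega).

Definition gradr (x : quat R) : quat R := \row_k partial k rho x.
Definition unit_normal (x : quat R) : quat R := (Num.sqrt (sqn (gradr x)))^-1 *: gradr x.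

Lemma gradr_neq0 x k : partial k rho x != 0 -> gradr x != 0.
Proof. by apply: contraNneq => g0; have := congr1 (fun v : quat R => v 0 k) g0; rewrite !mxE => ->. Qed.

Lemma gradr_neq0_ex x : gradr x != 0 -> exists k, partial k rho x != 0.
Proof.
move=> g0; apply/existsP; apply: contraNT g0; rewrite negb_exists => /forallP H.
by apply/eqP/rowP => k; rewrite !mxE; apply/eqP; have := H k; rewrite negbK.
Qed.

Lemma boundary_gradr x : S x -> gradr x != 0.
Proof. by move=> /(boundary_grad drho)[k]; exact: gradr_neq0. Qed.

Lemma sqn_unit_normal x : gradr x != 0 -> sqn (unit_normal x) = 1.
Proof.
move=> g0; rewrite sqnZ exprVn sqr_sqrtr ?sqn_ge0// mulVf//.
by rewrite sqn_eq0.
Qed.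

Lemma unit_normal_continuous x a : gradr x != 0 ->
  {for x, continuous (fun y => unit_normal y 0 a)}.
Proof.
move=> g0; rewrite (_ : (fun y => _) =
   (fun y => (Num.sqrt (\sum_k partial k rho y ^+ 2))^-1 * partial a rho y)); last first.
  apply/funext => y; rewrite !mxE; congr ((Num.sqrt _)^-1 * _).
  by apply: eq_bigr => k _; rewrite mxE.
have c k : {for x, continuous (partial k rho)} by exact: (defining_C1 drho x).2.
have c1 : {for x, continuous (fun y => \sum_k partial k rho y ^+ 2)}.
  by apply: for_continuous_sum => k; apply: continuousM; exact: c.
have c2 : {for x, continuous (fun y => Num.sqrt (\sum_k partial k rho y ^+ 2))}.
  exact: continuous_comp c1 (@sqrt_continuous R _).
apply: continuousM; last exact: c.
apply: (@continuousV _ _ (fun y => Num.sqrt (\sum_k partial k rho y ^+ 2))) => //.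
rewrite (_ : \sum_k _ = sqn (gradr x)); last by apply: eq_bigr => k _; rewrite mxE.
by rewrite gt_eqF// sqrtr_gt0 sqn_gt0.
Qed.

Lemma unit_normal_within a : {within S, continuous (fun y => unit_normal y 0 a)}.
Proof.
by apply: within_continuous_fun => x Sx; apply: unit_normal_continuous; exact: boundary_gradr.
Qed.

Lemma rho_MVT x v : exists2 t : R, 0 < t < 1 & rho (x + v) - rho x = dot v (gradr (x + t *: v)).
Proof.
have [t t01 E] := row_MVT (f := rho) (x := x) (v := v) (fun t _ => (defining_C1 drho _).1).
by exists t => //; rewrite E; apply: eq_bigr => i _; rewrite !mxE.
Qed.

(** The last clause is what a C^1 boundary offers about chords: a small angle with the tangent
    plane, without a rate. By the mean value theorem the chord is orthogonal to the gradient at an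
    intermediate point, and gradients near [p0] differ little. *)
Lemma local_normal p0 (e : R) : S p0 -> 0 < e -> exists2 r, 0 < r &
  [/\ forall x, `|x - p0| < r -> gradr x != 0,
      forall x y, `|x - p0| < r -> `|y - p0| < r -> 0 < dot (unit_normal y) (gradr x) &
      forall p z, `|p - p0| < r -> `|z - p0| < r -> rho p = 0 -> rho z = 0 ->
        dot (z - p) (unit_normal p) ^+ 2 <= e ^+ 2 * sqn (z - p)].
Proof.
move=> Sp e0; set G0 := gradr p0.
have G00 : 0 < sqn G0 by rewrite sqn_gt0 boundary_gradr.
(* Two gradients near [p0] then differ by at most 2 e1 |G0| and have length at least |G0| / 2, so
   their relative difference is at most 4 e1 <= e. *)
pose e1 := Num.min 1 e / 8.
have e10 : 0 < e1 by rewrite divr_gt0// lt_min ltr01.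
have e11 : e1 <= 1 / 8 by rewrite ler_wpM2r// ge_min lexx.
have e12 : e1 <= e / 8 by rewrite ler_wpM2r// ge_min lexx orbT.
clearbody e1.
have q0 : 0 < e1 ^+ 2 * sqn G0 by rewrite mulr_gt0// exprn_gt0.
have cf : {for p0, continuous (fun x => \sum_k (partial k rho x - partial k rho p0) ^+ 2)}.
  apply: for_continuous_sum => k.
  have c : {for p0, continuous (fun x => partial k rho x - partial k rho p0)}.
    by apply: continuousB; [exact: (defining_C1 drho p0).2|exact: cst_continuous].
  exact: (continuousM c c).
have /continuous_rowP/(_ _ q0)[r r0 Hr] := cf.
have close x : `|x - p0| < r -> sqn (gradr x - G0) <= e1 ^+ 2 * sqn G0.
  move=> /Hr; rewrite subrKC [X in `|_ - X|]big1; last by move=> i _; rewrite subrr expr0n.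
  rewrite subr0 ger0_norm; last by apply: sumr_ge0 => i _; exact: sqr_ge0.
  by congr (_ <= _); apply: eq_bigr => i _; rewrite !mxE.
clearbody G0; clear cf Hr.
have sq2 (a b : quat R) : sqn (a + b) <= 2 * sqn a + 2 * sqn b.
  have := sqn_ge0 (a - b); rewrite !sqnD sqnN (dotC a (- b)) dotNl (dotC b a); lra.
have e14 : e1 ^+ 2 * sqn G0 <= sqn G0 / 64.
  have : e1 ^+ 2 <= 1 / 64.
    by rewrite (_ : 1 / 64 = (1 / 8) ^+ 2); [apply: ler_sqr_ge0 => //; exact: ltW|field].
  by move=> /(ler_wpM2r (ltW G00)); lra.
have big x : `|x - p0| < r -> sqn G0 / 4 <= sqn (gradr x).
  move=> xr; have := close _ xr => H1.
  have := sq2 (gradr x) (- (gradr x - G0)); rewrite opprB subrKC -opprB sqnN => H2.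
  by lra.
have diff x y : `|x - p0| < r -> `|y - p0| < r ->
    sqn (gradr x - gradr y) <= 4 * (e1 ^+ 2 * sqn G0).
  move=> /close Hx /close Hy.
  have := sq2 (gradr x - G0) (- (gradr y - G0)); rewrite sqnN opprB addrA subrK.
  by lra.
have nz x : `|x - p0| < r -> gradr x != 0.
  by move=> /big H; rewrite -sqn_gt0; lra.
exists r => //; split=> //.
  move=> x y xr yr; rewrite dotZl mulr_gt0 ?invr_gt0 ?sqrtr_gt0 ?sqn_gt0 ?nz//.
  have := diff _ _ xr yr; rewrite sqnD sqnN (dotC (gradr x)) dotNl => H.
  by have := big _ xr; have := big _ yr; lra.
move=> p z pr zr rp rz; have [t /andP[t0 t1]] := rho_MVT p (z - p).
rewrite subrKC rp rz subrr => /esym E.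
set w := z - p in E *; set xi := p + _ in E.
have xir : `|xi - p0| < r.
  rewrite (_ : xi - p0 = (1 - t) *: (p - p0) + t *: (z - p0)); last first.
    by apply/rowP => i; rewrite !mxE; ring.
  apply: le_lt_trans (ler_normD _ _) _; rewrite !normrZ (gtr0_norm t0) gtr0_norm ?subr_gt0//.
  have s0 : 0 < 1 - t by rewrite subr_gt0.
  have := ltr_pM2l s0 `|p - p0| r; rewrite pr => H1.
  have := ltr_pM2l t0 `|z - p0| r; rewrite zr => H2.
  by lra.
have -> : dot w (unit_normal p) = (Num.sqrt (sqn (gradr p)))^-1 * dot w (gradr p - gradr xi).
  by rewrite /unit_normal dotZr dotDr (dotC w (- _)) dotNl (dotC _ w) E oppr0 addr0.
rewrite exprMn exprVn sqr_sqrtr ?sqn_ge0// mulrC ler_pdivrMr ?sqn_gt0 ?nz//.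
apply: le_trans (cauchy_schwarz _ _) _; rewrite -mulrA mulrCA.
apply: ler_wpM2l; first exact: sqn_ge0.
apply: le_trans (diff _ _ pr xir) _.
have H1 : 16 * e1 ^+ 2 <= e ^+ 2.
  rewrite (_ : 16 * e1 ^+ 2 = (4 * e1) ^+ 2); last by ring.
  by apply: ler_sqr_ge0; lra.
have := big _ pr => H2.
have := ler_wpM2l (sqr_ge0 e) H2; have := ler_wpM2r (ltW G00) H1; lra.
Qed.

(** The open ball about [x] with [p] on its sphere lies in {rho < 0}, so [rho] cannot increase from
    [p] along a direction that enters the ball; this forces the gradient at [p] to be a negative
    multiple of [x - p]. The factors 2 and 3 come from comparing Euclidean distance with the maximum
    norm. *)
Lemma nearest_normal p0 (r : R) x :
  (forall y, `|y - p0| < r -> gradr y != 0) -> S p0 -> Omega x -> `|x - p0| < r / 4 ->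
  exists (p : quat R) (d : R),
    [/\ S p, 0 < d, `|p - p0| <= 3 * `|x - p0|, d <= 2 * `|x - p0| & x = p - d *: unit_normal p].
Proof.
move=> nz Sp0 Ox xr.
have cq : {within S, continuous (fun z => sqn (z - x))}.
  apply: within_continuous_fun => z _; apply: for_continuous_sum => i.
  have c : {for z, continuous (fun z : quat R => (z - x) 0 i)}.
    rewrite (_ : (fun z : quat R => _) = (fun z => z 0 i - x 0 i)); last by apply/funext => y; rewrite !mxE.
    by apply: continuousB; [exact: coord_continuous|exact: cst_continuous].
  exact: (continuousM c c).
have [|p /set_mem Sp pmin] := compact_EVT_min _ (boundary_compact drho bOmega) cq; first by exists p0.
pose d := Num.sqrt (sqn (p - x)).
have px0 : p - x != 0.
  by apply/eqP => /subr0_eq px; apply: (boundary_notin drho Sp); rewrite px.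
have d0 : 0 < d by rewrite sqrtr_gt0 sqn_gt0.
have d2 : d ^+ 2 = sqn (p - x) by rewrite sqr_sqrtr ?sqn_ge0.
have min z : S z -> d ^+ 2 <= sqn (z - x) by move=> Sz; rewrite d2 pmin// inE.
have dle : d <= 2 * `|x - p0|.
  rewrite -ler_sqr ?nnegrE ?(ltW d0) ?mulr_ge0//.
  apply: le_trans (min _ Sp0) _; apply: le_trans (sqn_le_norm _) _.
  by rewrite distrC exprMn; lra.
have inball y : sqn (y - x) <= d ^+ 2 -> `|y - p0| <= 3 * `|x - p0|.
  move=> /(sqn_ball_le (ltW d0)) H; rewrite (_ : y - p0 = (y - x) + (x - p0)); last by rewrite addrA subrK.
  by apply: le_trans (ler_normD _ _) _; lra.
have r0 : 0 < r by have := normr_ge0 (x - p0); lra.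
have inball' y : sqn (y - x) <= d ^+ 2 -> `|y - p0| < r by move=> /inball; lra.
(* If [rho] were nonnegative at [y], it would vanish somewhere on the segment from [x] to [y], at a
   point with nonzero gradient, that is at a boundary point closer to [x] than [p]. *)
have neg y : sqn (y - x) < d ^+ 2 -> rho y < 0.
  move=> yd; rewrite ltNge; apply/negP => ry.
  have rx : rho x < 0 by move: Ox; rewrite (defining_OmegaE drho).
  pose f t := rho (x + t *: (y - x)).
  have cf : {within `[0, 1], continuous f}.
    apply: continuous_subspaceT => t.
    apply: continuous_comp; last exact: (defining_continuous drho).
    apply: continuousD; first exact: cst_continuous.
    by apply: continuousZl; exact: cvg_id.
  have [|t] := IVT ler01 cf (v := 0).
    rewrite /f scale0r addr0 scale1r subrKC ge_min le_max ry (ltW rx) orbT /=.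
    by [].
  rewrite in_itv /= => /andP[t0 t1] ft.
  set z := x + t *: (y - x) in ft.
  have zd : sqn (z - x) < d ^+ 2.
    rewrite /z addrAC subrr add0r sqnZ; apply: le_lt_trans yd.
    by rewrite ler_piMl ?sqn_ge0// expr_le1.
  have /gradr_neq0_ex[k zk] := nz _ (inball' _ (ltW zd)).
  by have := min _ (rho0_boundary drho ft zk); rewrite leNgt zd.
set u := x - p; set N := gradr p.
have uE : sqn u = d ^+ 2 by rewrite d2 -opprB sqnN.
have N0 : N != 0 by exact: boundary_gradr.
have half w : 0 < dot w u -> dot w N <= 0.
  move=> wu; rewrite leNgt; apply/negP => wN.
  have cw : {for p, continuous (fun y => dot w (gradr y))}.
    apply: for_continuous_sum => k; apply: continuousM; first exact: cst_continuous.
    rewrite (_ : (fun y => _) = partial k rho); last by apply/funext => y; rewrite mxE.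
    exact: (defining_C1 drho p).2.
  have wN2 : 0 < dot w N / 2 by rewrite divr_gt0.
  have /continuous_rowP/(_ _ wN2)[d1 d10 Hd1] := cw.
  have w1 : 0 < `|w| + 1 by rewrite ltr_wpDl.
  have s1 : 0 < sqn w + 1 by rewrite ltr_wpDl// sqn_ge0.
  pose t := Num.min (d1 / (`|w| + 1)) (dot w u / (sqn w + 1)).
  have t0 : 0 < t by rewrite lt_min !divr_gt0.
  have td : t * (`|w| + 1) <= d1 by rewrite -ler_pdivlMr// ge_min lexx.
  have tu : t * (sqn w + 1) <= dot w u by rewrite -ler_pdivlMr// ge_min lexx orbT.
  have yd : sqn (p + t *: w - x) < d ^+ 2.
    rewrite (_ : p + t *: w - x = t *: w - u); last by apply/rowP => i; rewrite !mxE; ring.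
    rewrite sqnD sqnN uE sqnZ (dotC _ (- u)) dotNl dotZr (dotC u w).
    have := ler_wpM2l (ltW t0) tu; have := mulr_gt0 t0 wu; nra.
  have := neg _ yd.
  have [s /andP[s0 s1'] E] := rho_MVT p (t *: w).
  move: E; rewrite (rho_boundary drho Sp) subr0 => ->; rewrite dotZl pmulr_rlt0// ltNge.
  move/negP; apply.
  have sw : `|s *: (t *: w)| < d1.
    rewrite !normrZ !gtr0_norm//.
    apply: (@le_lt_trans _ _ (t * `|w|)).
      by rewrite ler_piMl ?mulr_ge0 ?(ltW t0)// ltW.
    by lra.
  by have := Hd1 _ sw; rewrite ler_norml => /andP[H _]; rewrite -/N in H; lra.
pose a := dot N u / d ^+ 2.
have dd0 : 0 < d ^+ 2 by rewrite exprn_gt0.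
pose b := N - a *: u.
have NE : N = a *: u + b by rewrite subrKC.
have bu : dot b u = 0.
  by rewrite dotDl dotNl dotZl dotvv uE /a; field; rewrite gt_eqF.
clearbody b.
(* A part [b] of the gradient orthogonal to [u] would make [t *: u + b] a direction that enters the
   ball and along which [rho] increases, once [t] is small. *)
have b0 : b = 0.
  apply/eqP/negPn/negP => b0; have sb : 0 < sqn b by rewrite sqn_gt0.
  have c1 : 0 < 2 * (`|dot u N| + 1) by rewrite mulr_gt0// ltr_wpDl.
  pose t := sqn b / (2 * (`|dot u N| + 1)).
  have t0 : 0 < t by rewrite divr_gt0.
  have tE : t * (2 * (`|dot u N| + 1)) = sqn b by rewrite divfK// gt_eqF.
  have := half (t *: u + b); rewrite !dotDl !dotZl bu addr0 dotvv uE mulr_gt0// => /(_ isT).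
  have -> : dot b N = sqn b by rewrite NE dotDr dotZr bu mulr0 add0r.
  have : - (t * `|dot u N|) <= t * dot u N.
    by rewrite -mulrN ler_wpM2l ?(ltW t0)// lerNl -normrN ler_norm.
  by lra.
have a0 : a < 0.
  have : a <= 0.
    have := half u; rewrite dotvv uE dd0 NE b0 addr0 dotZr dotvv uE => /(_ isT).
    by rewrite pmulr_lle0.
  rewrite le_eqVlt => /orP[/eqP a0|//]; move: N0; by rewrite NE b0 a0 scale0r addr0 eqxx.
exists p, d; split=> //.
  by apply: inball; rewrite d2.
have -> : unit_normal p = - d^-1 *: u.
  rewrite /unit_normal -/N NE b0 addr0 sqnZ uE -exprMn sqrtr_sqr normrM (ltr0_norm a0) (gtr0_norm d0).
  rewrite scalerA; congr (_ *: _); field; rewrite gt_eqF//=; by rewrite lt_eqF.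
by rewrite scalerA mulrN divff ?gt_eqF// scaleN1r opprK /u subrKC.
Qed.

End Normal.

(** The two vectors have squared lengths D + 2 d s and D - 2 d s. When [s] is small these nearly
    agree: the parts of the kernels along [w] cancel and the parts along [n] add up to the main
    term. *)
Lemma ker_pair {R : realType} (w n : quat R) (d e : R) a :
  let D := sqn w + d ^+ 2 in let s := dot w n in
  0 < d -> 0 <= e -> sqn n = 1 -> s ^+ 2 <= e ^+ 2 * sqn w ->
  4 * d ^+ 2 * s ^+ 2 <= e * D ^+ 2 -> 4 * d ^+ 2 * s ^+ 2 <= D ^+ 2 / 4 ->
  `|ker a (w + d *: n) - ker a (w - d *: n) - 2 * n 0 a * (d / D ^+ 2)| <= 25 * e * (d / D ^+ 2).
Proof.
move=> D s d0 e0 n1 se t1 t2.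
have D0 : 0 < D by rewrite ltr_wpDl ?sqn_ge0// exprn_gt0.
have A : sqn (w + d *: n) = D + 2 * d * s.
  by rewrite sqnD dotZr sqnZ n1 /D /s; ring.
have B : sqn (w - d *: n) = D - 2 * d * s.
  by rewrite sqnD sqnN (dotC w) dotNl (dotC _ w) dotZr sqnZ n1 /D /s; ring.
set X := (D + 2 * d * s) * (D - 2 * d * s).
pose tau := 4 * d ^+ 2 * s ^+ 2.
have XE : X = D ^+ 2 - tau by rewrite /X /tau; ring.
have tau0 : 0 <= tau by rewrite (_ : tau = (2 * d * s) ^+ 2) ?sqr_ge0// /tau; ring.
have X34 : 3 / 4 * D ^+ 2 <= X by rewrite XE; move: t2; rewrite -/tau; lra.
have DD0 : 0 < D ^+ 2 by rewrite exprn_gt0.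
have X0 : 0 < X by lra.
have ABn0 : ((D + 2 * d * s) != 0) && ((D - 2 * d * s) != 0).
  by rewrite -negb_or -mulf_eq0 gt_eqF.
have [An0 Bn0] := andP ABn0.
have m1 : `|n 0 a| <= 1.
  by rewrite -(@expr_le1 _ 2)// real_normK ?num_real// -n1 coord2_le_sqn.
have Ws : `|w 0 a * s| <= e * D.
  have ws : 0 <= sqn w by exact: sqn_ge0.
  rewrite -ler_sqr ?nnegrE ?mulr_ge0 ?(ltW D0)// real_normK ?num_real// !exprMn.
  apply: (@le_trans _ _ (sqn w * (e ^+ 2 * sqn w))).
    by apply: ler_pM; rewrite ?sqr_ge0// coord2_le_sqn.
  rewrite mulrCA; apply: ler_wpM2l; first exact: sqr_ge0.
  rewrite expr2; apply: ler_pM => //; rewrite lerDl sqr_ge0//.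
set E := (X in `|X|).
have EX : E * X ^+ 2 = - 8 * (w 0 a * s) * d * D + 2 * d * n 0 a * tau * (3 * D ^+ 2 - tau) / D ^+ 2.
  have Dn0 : D != 0 by rewrite gt_eqF.
  rewrite /E /ker /newton A B !mxE 2!mulrBl.
  rewrite (_ : (_ + _) * _ * X ^+ 2 = (w 0 a + d * n 0 a) * (D - 2 * d * s) ^+ 2); last first.
    by rewrite /X; field.
  rewrite (_ : (_ - _) * _ * X ^+ 2 = (w 0 a - d * n 0 a) * (D + 2 * d * s) ^+ 2); last first.
    by rewrite /X; field.
  by rewrite XE /tau; field.
have bound : `|E| * X ^+ 2 <= 14 * e * d * D ^+ 2.
  rewrite -[X ^+ 2]ger0_norm ?sqr_ge0// -normrM EX.
  apply: le_trans (ler_normD _ _) _.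
  have h1 : `|- 8 * (w 0 a * s) * d * D| <= 8 * e * d * D ^+ 2.
    have p0 : 0 <= 8 * d * D by rewrite !mulr_ge0// ltW.
    rewrite (_ : -8 * _ * d * D = - (8 * d * D * (w 0 a * s))); last by ring.
    rewrite normrN normrM (ger0_norm p0).
    have := ler_wpM2l p0 Ws; lra.
  have h2 : `|2 * d * n 0 a * tau * (3 * D ^+ 2 - tau) / D ^+ 2| <= 6 * e * d * D ^+ 2.
    have h0 : 0 <= 3 * D ^+ 2 - tau by rewrite subr_ge0; move: t2; rewrite -/tau; lra.
    have h4 : 0 <= tau * (3 * D ^+ 2 - tau) by rewrite mulr_ge0.
    have p0 : 0 <= 2 * d by rewrite mulr_ge0// ltW.
    rewrite (_ : 2 * d * _ * tau * _ / _ = 2 * d * (n 0 a * (tau * (3 * D ^+ 2 - tau))) / D ^+ 2); last by ring.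
    rewrite normrM normfV (gtr0_norm DD0) normrM (ger0_norm p0) normrM (ger0_norm h4).
    rewrite ler_pdivrMr//.
    have h3 : tau * (3 * D ^+ 2 - tau) <= e * D ^+ 2 * (3 * D ^+ 2).
      by apply: ler_pM => //; rewrite lerBlDr lerDl.
    have h5 : `|n 0 a| * (tau * (3 * D ^+ 2 - tau)) <= e * D ^+ 2 * (3 * D ^+ 2).
      by apply: le_trans h3; rewrite ler_piMl.
    have := ler_wpM2l p0 h5; lra.
  lra.
(* The 14 is 8 + 6, from [h1] and [h2]; since X >= 3/4 D^2, it becomes 14 * 16 / 9, which is below
   25. *)
have XX : 14 * (D ^+ 2) ^+ 2 <= 25 * X ^+ 2.
  have : (3 / 4 * D ^+ 2) ^+ 2 <= X ^+ 2 by apply: ler_sqr_ge0 => //; lra.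
  by have := sqr_ge0 (D ^+ 2); lra.
have XX0 : 0 < X ^+ 2 by rewrite exprn_gt0.
rewrite -(ler_pM2r XX0); apply: le_trans bound _.
rewrite (_ : _ * _ * X ^+ 2 = 25 * e * d * X ^+ 2 / D ^+ 2); last by ring.
rewrite ler_pdivlMr//.
have ed : 0 <= e * d by rewrite mulr_ge0// ltW.
by have := ler_wpM2l ed XX; lra.
Qed.

(** There are two regimes. Near [p] the chord is almost tangent and the density is close to [h0], so
    the error is a small multiple of the Poisson kernel. Away from [p] boundedness suffices, since
    that kernel is at most d q^-4; [ker_pair] with e = 1 then gives 25 M, and the density term 2 * 2
    M, in total 29 M. *)
Lemma kernel_jump_bound {R : realType} (p z n : quat R) (h : 'I_4 -> R) (h0 d e M q : R) :
  0 < d -> 0 < e -> e <= 1 / 4 -> 0 < q -> 0 <= M -> sqn n = 1 ->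
  \sum_a `|h a| <= M -> `|\sum_a n 0 a * h a - h0| <= 2 * M ->
  dot (z - p) n ^+ 2 <= e ^+ 2 * sqn (z - p) /\ `|\sum_a n 0 a * h a - h0| <= e \/
  16 * d ^+ 2 <= sqn (z - p) /\ q ^+ 2 <= sqn (z - p) ->
  `|\sum_a (ker a (p - d *: n - z) * h a - ker a (p + d *: n - z) * h a) +
    2 * h0 * poisson d p z| <= (25 * M + 2) * e * poisson d p z + 29 * M * q ^- 4 * d.
Proof.
move=> d0 e0 e4 q0 M0 n1 hM hM2 alt; set w := z - p in alt *.
have P0 : 0 <= poisson d p z by exact: poisson_ge0.
have D0 : 0 < sqn w + d ^+ 2 by rewrite ltr_wpDl ?sqn_ge0// exprn_gt0.
have Dw : sqn w <= sqn w + d ^+ 2 by rewrite lerDl sqr_ge0.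
have xz : p - d *: n - z = - (w + d *: n) by rewrite /w; apply/rowP => i; rewrite !mxE; ring.
have yz : p + d *: n - z = - (w - d *: n) by rewrite /w; apply/rowP => i; rewrite !mxE; ring.
have PE : poisson d p z = d / (sqn w + d ^+ 2) ^+ 2 by [].
move: PE P0; set P := poisson d p z => PE P0.
set G := \sum_a _.
have gE : G + 2 * h0 * P =
    - (\sum_a (ker a (w + d *: n) - ker a (w - d *: n) - 2 * n 0 a * P) * h a) -
     2 * P * (\sum_a n 0 a * h a - h0).
  rewrite (_ : G = - \sum_a (ker a (w + d *: n) - ker a (w - d *: n)) * h a); last first.
    by rewrite /G -sumrN; apply: eq_bigr => a _; rewrite xz yz !kerN; ring.
  rewrite [X in _ = - X - _](_ : _ = \sum_a (ker a (w + d *: n) - ker a (w - d *: n)) * h a -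
    2 * P * \sum_a n 0 a * h a); first by ring.
  by rewrite mulr_sumr -sumrB; apply: eq_bigr => a _; ring.
clearbody w P G.
have key (e' : R) : 0 <= e' -> (forall a,
    `|ker a (w + d *: n) - ker a (w - d *: n) - 2 * n 0 a * P| <= 25 * e' * P) ->
    `|G + 2 * h0 * P| <= 25 * e' * M * P + 2 * P * `|\sum_a n 0 a * h a - h0|.
  move=> e'0 Ha; rewrite gE; apply: le_trans (ler_normB _ _) _; apply: lerD; last first.
    by rewrite normrM ger0_norm// mulr_ge0.
  rewrite normrN; apply: le_trans (ler_norm_sum _ _ _) _.
  apply: (@le_trans _ _ (\sum_a (25 * e' * P) * `|h a|)).
    by apply: ler_sum => a _; rewrite normrM ler_wpM2r.
  rewrite -mulr_sumr mulrAC; apply: ler_wpM2r => //; apply: ler_wpM2l hM.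
  by rewrite !mulr_ge0.
have Q0 : 0 <= 29 * M * q ^- 4 * d.
  by rewrite !mulr_ge0 ?invr_ge0 ?exprn_ge0 ?(ltW d0) ?(ltW q0).
have p2 : 0 <= 2 * P by rewrite mulr_ge0.
have DD := sqr_ge0 (sqn w + d ^+ 2).
case: alt => -[].
  move=> se h1.
  have amgm : 4 * d ^+ 2 * sqn w <= (sqn w + d ^+ 2) ^+ 2.
    by have := sqr_ge0 (sqn w - d ^+ 2); lra.
  have t1 : 4 * d ^+ 2 * dot w n ^+ 2 <= e ^+ 2 * (sqn w + d ^+ 2) ^+ 2.
    apply: (@le_trans _ _ (e ^+ 2 * (4 * d ^+ 2 * sqn w))).
      have d4 : 0 <= 4 * d ^+ 2 by rewrite mulr_ge0// sqr_ge0.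
      by have := ler_wpM2l d4 se; lra.
    by rewrite ler_wpM2l ?sqr_ge0.
  have e2 : e ^+ 2 <= e by rewrite expr2 ler_piMl ?(ltW e0)//; lra.
  have e2D := ler_wpM2r DD e2; have e4D := ler_wpM2r DD e4.
  apply: le_trans (key e (ltW e0) _) _.
    move=> a; rewrite PE; apply: ker_pair => //; first exact: ltW.
      by apply: le_trans t1 e2D.
    by apply: le_trans t1 _; apply: le_trans e2D _; lra.
  by have := ler_wpM2l p2 h1; lra.
move=> d16 wq.
have se : dot w n ^+ 2 <= sqn w.
  by apply: le_trans (cauchy_schwarz _ _) _; rewrite n1 mulr1.
have t1 : 4 * d ^+ 2 * dot w n ^+ 2 <= (sqn w + d ^+ 2) ^+ 2 / 4.
  apply: (@le_trans _ _ (4 * d ^+ 2 * sqn w)).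
    by apply: ler_wpM2l se; rewrite mulr_ge0// sqr_ge0.
  have := ler_wpM2r (sqn_ge0 w) d16.
  have : sqn w ^+ 2 <= (sqn w + d ^+ 2) ^+ 2 by apply: ler_sqr_ge0 => //; exact: sqn_ge0.
  by lra.
apply: le_trans (key 1 ler01 _) _.
  move=> a; rewrite PE; apply: ker_pair => //; first by rewrite expr1n mul1r.
  by apply: le_trans t1 _; lra.
have r4 : 0 < q ^+ 2 by rewrite exprn_gt0.
have Pd : P <= d * q ^- 4.
  rewrite PE ler_wpM2l ?(ltW d0)// (_ : q ^+ 4 = (q ^+ 2) ^+ 2); last by ring.
  rewrite lef_pV2 ?posrE ?(exprn_gt0 2 r4) ?(exprn_gt0 2 D0)//.
  by apply: ler_sqr_ge0; [exact: ltW|exact: le_trans Dw].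
have M29 : 0 <= 29 * M by rewrite mulr_ge0.
have := ler_wpM2l p2 hM2; have := ler_wpM2l M29 Pd.
have : 0 <= (25 * M + 2) * e * P by rewrite !mulr_ge0 ?addr_ge0 ?mulr_ge0// ltW.
by lra.
Qed.

(** Here [a] stands for |x - p0|, [b] for |p - p0| and [d] for the Euclidean distance from [x] to
    its nearest boundary point [p]. *)
Lemma jump_radii {R : realFieldType} (a b d r r2 r3 m eps : R) : 0 < d -> r <= r2 -> 0 < m ->
  a < r / 16 -> a < r3 / 4 -> a < eps / (4 * m) -> b <= 3 * a -> d <= 2 * a ->
  [/\ b < r / 2, d < r / 8, b < r3, 0 < d < r3 & b + d < r2] /\ d * m <= eps / 2.
Proof.
move=> d0 rr m0 ar a3; rewrite ltr_pdivlMr ?mulr_gt0// => am ba da.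
split; last by have := ler_wpM2r (ltW m0) da; lra.
by split; rewrite ?d0/=; lra.
Qed.

Lemma jump_far {R : realDomainType} (d r : R) : 0 < d -> d < r -> 16 * d ^+ 2 <= (4 * r) ^+ 2.
Proof.
move=> d0 dr; have := ler_sqr_ge0 (ltW d0) (ltW dr).
by rewrite exprMn => /(ler_wpM2l (ler0n R 16)); rewrite -natrX.
Qed.

Lemma jump_total {R : realFieldType} (M e q eps J d c s t1 t2 : R) :
  0 <= M -> 0 < e -> e <= 1 / 4 -> 0 < d -> 0 <= c * s ->
  e * (2 * ((25 * M + 2) * (q + 1) + 2 * M + 1)) <= eps ->
  d * (c * s + 1) <= eps / 2 -> J - q <= e ->
  t1 <= (25 * M + 2) * e * J + c * d * s -> t2 <= 2 * M * e -> t1 + t2 <= eps.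
Proof.
move=> M0 e0 e4 d0 cs eK de Jq h1 h2.
have J1 : J <= q + 1 by lra.
have q0 : 0 <= (25 * M + 2) * e by apply: mulr_ge0; lra.
have := ler_wpM2l q0 J1; lra.
Qed.

Lemma within_near {R : realType} {n : nat} (S : set 'rV[R]_n) (f : 'rV[R]_n -> R) p0 (e : R) :
  {within S, continuous f} -> S p0 -> 0 < e ->
  exists2 d, 0 < d & forall z, S z -> `|z - p0| < d -> `|f z - f p0| <= e.
Proof.
move=> /subspace_continuousP cf Sp e0.
have /cvgrPdist_le/(_ _ e0) := cf _ Sp; rewrite near_withinE => /nbhs_rowP[d d0 Hd].
exists d => // z Sz zp; rewrite distrC; have := Hd _ zp; rewrite subrKC; exact.
Qed.

Section Jump.
Context {R : realType}.
Variables (Omega : set (quat R)) (rho : quat R -> R).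
Variable sigma : {measure set (@borel R 4) -> \bar R}.
Hypothesis drho : defining_function rho Omega.
Hypothesis bOmega : bounded_set Omega.
Local Notation S := (boundary Omega).
Hypothesis surf : surface_measure S sigma.
Variable H : 'I_4 -> quat R -> R.
Hypothesis cH : forall a, {within S, continuous (H a)}.
Local Notation N := (unit_normal rho).

Let cS : compact S. Proof. exact: boundary_compact drho bOmega. Qed.
Let finS : (sigma S < +oo)%E. Proof. exact: boundary_finite drho bOmega surf. Qed.

Lemma ker_off0 a : continuous_off0 (@ker R 4 a).
Proof. by move=> v v0; apply: differentiable_continuous; exact: (has_grad_ker a v0).1. Qed.

Lemma unit_normal_coord x a : gradr rho x != 0 -> `|N x 0 a| <= 1.
Proof.
by move=> g0; rewrite -(@expr_le1 _ 2)// real_normK ?num_real// -(sqn_unit_normal g0) coord2_le_sqn.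
Qed.

(** The normal is taken at [p] and the density at [z]: the kernel difference produces the normal at
    the nearest point, which need not be the one at the integration point. *)
Lemma normal_combination_near p0 (e : R) : S p0 -> 0 < e ->
  exists2 r, 0 < r & forall p z, S p -> S z -> `|p - p0| < r -> `|z - p0| < r ->
    `|\sum_a N p 0 a * H a z - \sum_a N p0 0 a * H a p0| <= e.
Proof.
move=> Sp e0; have e2 : 0 < e / 2 by rewrite divr_gt0.
have c1 : {within S, continuous (fun z => \sum_a `|H a z - H a p0|)}.
  apply: within_continuous_sum => a; apply: within_continuous_norm.
  by apply: within_continuousD => //; exact: within_continuous_cst.
have c2 : {within S, continuous (fun p => \sum_a N p 0 a * H a p0)}.
  apply: within_continuous_sum => a; apply: within_continuousM; last exact: within_continuous_cst.
  exact: (unit_normal_within drho).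
have [r1 r10 H1] := within_near c1 Sp e2.
have [r2 r20 H2] := within_near c2 Sp e2.
exists (Num.min r1 r2); first by rewrite lt_min r10.
move=> p z Sp' Sz; rewrite !lt_min => /andP[_ pr] /andP[zr _].
rewrite (_ : _ - _ = \sum_a N p 0 a * (H a z - H a p0) +
  (\sum_a N p 0 a * H a p0 - \sum_a N p0 0 a * H a p0)); last first.
  rewrite addrA -big_split/=; congr (_ - _); apply: eq_bigr => a _; ring.
apply: le_trans (ler_normD _ _) _; rewrite (splitr e); apply: lerD; last exact: H2.
have := H1 _ Sz zr; rewrite [X in `|_ - X|]big1 ?subr0; last by move=> a _; rewrite subrr normr0.
rewrite ger0_norm; last by apply: sumr_ge0 => a _; exact: normr_ge0.
apply: le_trans; apply: le_trans (ler_norm_sum _ _ _) _; apply: ler_sum => a _.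
by rewrite normrM ler_piMl// unit_normal_coord// (boundary_gradr drho).
Qed.

Hypothesis W0 : forall x, ~ closure Omega x -> \sum_a potential sigma S (ker a) (H a) x = 0.

(** Subtracting the zero exterior value before estimating replaces limits of singular integrals by a
    pointwise bound: a small multiple of the Poisson kernel, whose mass stays bounded, plus a term
    linear in [d]. *)
Theorem jump p0 (eps : R) : S p0 -> 0 < eps -> exists2 eta, 0 < eta &
  forall x, Omega x -> `|x - p0| < eta ->
    `|\sum_a potential sigma S (ker a) (H a) x + 2 * pi ^+ 2 * \sum_a N p0 0 a * H a p0| <= eps.
Proof.
move=> Sp eps0; have pi2 : 0 < (pi : R) ^+ 2 by rewrite exprn_gt0// pi_gt0.
have cabs : {within S, continuous (fun z => \sum_a `|H a z|)}.
  by apply: within_continuous_sum => a; apply: within_continuous_norm.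
have [M M0 HM] := within_continuous_bounded cS cabs.
have {}HM z : S z -> \sum_a `|H a z| <= M.
  by move=> /HM; apply: le_trans; rewrite ler_norm.
set h0 := \sum_a N p0 0 a * H a p0.
have comb p z : S p -> S z -> `|\sum_a N p 0 a * H a z| <= M.
  move=> Sp' Sz; apply: le_trans (HM _ Sz); apply: le_trans (ler_norm_sum _ _ _) _.
  by apply: ler_sum => a _; rewrite normrM ler_piMl// unit_normal_coord// (boundary_gradr drho).
have h0M : `|h0| <= M by exact: comb.
pose K := (25 * M + 2) * (pi ^+ 2 + 1) + 2 * M + 1.
have K0 : 0 < K.
  have : 0 <= (25 * M + 2) * (pi ^+ 2 + 1) by apply: mulr_ge0; lra.
  by rewrite /K; lra.
pose e := Num.min (1 / 4) (eps / (2 * K)) : R.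
have e0 : 0 < e by rewrite lt_min !divr_gt0// mulr_gt0.
have e4 : e <= 1 / 4 by rewrite ge_min lexx.
have eK : e * (2 * K) <= eps by rewrite -ler_pdivlMr ?mulr_gt0// ge_min lexx orbT.
clearbody e.
have [r1 r10 Hcomb] := normal_combination_near Sp e0.
have [r2 r20 [gnz gpos gtan]] := local_normal drho Sp e0.
have [r3 r30 Hpois] := poisson_limit drho bOmega surf Sp e0.
pose s := fine (sigma S).
have s0 : 0 <= s by rewrite fine_ge0.
pose r := Num.min r1 r2.
have r0 : 0 < r by rewrite lt_min r10.
have rr1 : r <= r1 by rewrite ge_min lexx.
have rr2 : r <= r2 by rewrite ge_min lexx orbT.
clearbody r.
pose c := 29 * M * (r / 2) ^- 4.
have c0 : 0 <= c.
  by rewrite /c mulr_ge0 ?mulr_ge0 ?invr_ge0 ?exprn_ge0 ?divr_ge0 ?(ltW M0) ?(ltW r0).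
have cs0 : 0 < c * s + 1 by rewrite ltr_wpDl// mulr_ge0.
(* Since |p - p0| <= 3 |x - p0| and d <= 2 |x - p0|, the first entry gives |p - p0| < r/2 and d <
   r/8, the second allows [poisson_limit], and the third bounds d (c s + 1) by eps / 2. *)
pose eta := Num.min (r / 16) (Num.min (r3 / 4) (eps / (4 * (c * s + 1)))).
exists eta; first by rewrite !lt_min !divr_gt0// mulr_gt0.
move=> x Ox; rewrite !lt_min => /andP[xr /andP[xr3 xe]].
have xr2 : `|x - p0| < r2 / 4.
  apply: lt_le_trans xr _; apply: ler_pM; rewrite ?(ltW r0) ?invr_ge0// lef_pV2 ?posrE// ler_nat.
  by [].
have [p [d [Sp' d0 pp0 dx xE]]] := nearest_normal drho bOmega gnz Sp Ox xr2.
have [[pr dr pr3 dr3 bd] de] := jump_radii d0 rr2 cs0 xr xr3 xe pp0 dx.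
have prr : `|p - p0| < r by apply: lt_trans pr _; rewrite ltr_pdivrMr// ltr_pMr// ltr1n.
clear xr xr3 xr2 xe pp0 dx.
set n := N p in xE.
have n1 : sqn n = 1 by apply: sqn_unit_normal; exact: (boundary_gradr drho).
have nn1 : `|n| <= 1 by apply: sqn_ball_le => //; rewrite n1 expr1n.
pose y := p + d *: n.
have nSx : ~ S x by move=> /(boundary_notin drho).
(* The normal at [p] makes an acute angle with all gradients near [p0], so [rho] is positive at the
   outer point. *)
have Ey : ~ closure Omega y.
  move=> /(closure_rho_le0 drho); apply/negP; rewrite -ltNge.
  have [t /andP[t0 t1] E] := rho_MVT drho p (d *: n).
  move: E; rewrite (rho_boundary drho Sp') subr0 /y => ->; rewrite dotZl mulr_gt0//.
  apply: gpos; last by apply: lt_le_trans rr2.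
  rewrite addrAC; apply: le_lt_trans (ler_normD _ _) _.
  rewrite 2!normrZ (gtr0_norm t0) (gtr0_norm d0).
  have h1 : t * (d * `|n|) <= d.
    rewrite -[leRHS]mul1r; apply: ler_pM; rewrite ?(ltW t0) ?(ltW t1)//.
      by rewrite mulr_ge0// ltW.
    by rewrite ler_piMr// ltW.
  by apply: le_lt_trans bd; rewrite lerD2l.
have nSy : ~ S y by move=> /(boundary_closure drho).
pose P := poisson d p.
have P0 z : 0 <= P z by exact: poisson_ge0.
have cP : {within S, continuous P}.
  by apply: within_continuous_fun => z _; exact: poisson_continuous.
pose g z := \sum_a (ker a (x - z) * H a z - ker a (y - z) * H a z).
have ck a u : ~ S u -> {within S, continuous (fun z => ker a (u - z) * H a z)}.
  by move=> nSu; apply: potential_within => //; exact: ker_off0.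
have cg : {within S, continuous g}.
  apply: within_continuous_sum => a; apply: within_continuousD; first exact: ck.
  by apply: within_continuousN; exact: ck.
have -> : \sum_a potential sigma S (ker a) (H a) x = \int[sigma]_(z in S) g z.
  rewrite -[LHS]subr0 -[X in _ - X](W0 Ey) -sumrB /g (sint_sum cS finS); last first.
    move=> a; apply: within_continuousD; first exact: ck.
    by apply: within_continuousN; exact: ck.
  by apply: eq_bigr => a _; rewrite (sintB cS finS (ck a _ nSx) (ck a _ nSy)).
have pw z : S z -> `|g z + 2 * h0 * P z| <= (25 * M + 2) * e * P z + c * d.
  move=> Sz; rewrite /g xE.
  have hM2 : `|\sum_a n 0 a * H a z - h0| <= 2 * M.
    apply: le_trans (ler_normB _ _) _; rewrite mulr2n mulrDl mul1r; exact: lerD (comb _ _ Sp' Sz) h0M.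
  have rr20 : 0 < r / 2 by exact: divr_gt0.
  apply: (kernel_jump_bound d0 e0 e4 rr20 (ltW M0) n1 (HM z Sz) hM2).
  have [zr|zr] := ltP `|z - p0| r.
    left; split.
      exact: (gtan _ _ (lt_le_trans prr rr2) (lt_le_trans zr rr2) (rho_boundary drho Sp')
        (rho_boundary drho Sz)).
    exact: (Hcomb _ _ Sp' Sz (lt_le_trans prr rr1) (lt_le_trans zr rr1)).
  have wr : r / 2 <= `|z - p|.
    rewrite -(lerD2r (r / 2)) -splitr; apply: le_trans zr _.
    rewrite -[z in leLHS](subrK p) -addrA; apply: le_trans (ler_normD _ _) _.
    by rewrite lerD2l ltW.
  have wr2 : (r / 2) ^+ 2 <= sqn (z - p).
    by apply: le_trans (sqn_ge_norm _); apply: ler_sqr_ge0 wr; exact: ltW.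
  right; split; last exact: wr2.
  apply: le_trans wr2; rewrite (_ : r / 2 = 4 * (r / 8)); last by field.
  exact: jump_far d0 dr.
have cst_cont (k : R) : {within S, continuous (fun=> k)} by exact: within_continuous_cst.
have ch0 : {within S, continuous (fun z => 2 * h0 * P z)} by exact: (within_continuousM (cst_cont _) cP).
have ceP : {within S, continuous (fun z => (25 * M + 2) * e * P z)}.
  exact: (within_continuousM (cst_cont _) cP).
have I1 := sint_norm_le cS finS (within_continuousD cg ch0) (within_continuousD ceP (cst_cont _)) pw.
have IP := Hpois p Sp' pr3 d dr3; rewrite -/P in IP.
have mS : measurable (S : set (borel 4)) by apply: compact_borel cS.
rewrite (sintD cS finS cg ch0) (sintD cS finS ceP (cst_cont _)) in I1.
rewrite !(sintZ cS finS _ cP) (Rintegral_cst _ mS) -/s in I1.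
move: I1 IP; set J := \int[sigma]_(z in S) P z; set G := \int[sigma]_(z in S) g z => I1 IP.
rewrite (_ : G + _ = (G + 2 * h0 * J) - 2 * h0 * (J - pi ^+ 2)); last by ring.
apply: le_trans (ler_normB _ _) _.
have h2 : `|2 * h0 * (J - pi ^+ 2)| <= 2 * M * e.
  rewrite normrM; apply: ler_pM (normr_ge0 _) (normr_ge0 _) _ IP.
  by rewrite normrM ger0_norm// ler_pM2l.
have cs1 : 0 <= c * s by exact: mulr_ge0.
exact: (jump_total (ltW M0) e0 e4 d0 cs1 eK de (le_trans (ler_norm _) IP) I1 h2).
Qed.

End Jump.

(** * The Cauchy-type integral *)

Lemma near_eq_continuous_at {R : realType} {n : nat} (f g : 'rV[R]_n -> R) x :
  {near x, f =1 g} -> {for x, continuous f} -> {for x, continuous g}.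
Proof.
move=> E H; rewrite /prop_for /continuous_at -(nbhs_singleton E).
by apply: cvg_trans H; exact: (near_eq_cvg E).
Qed.

Lemma sum_ord4 {V : nmodType} (F : 'I_4 -> V) :
  \sum_(a < 4) F a = F (inord 0) + F (inord 1) + F (inord 2) + F (inord 3).
Proof.
rewrite !big_ord_recr big_ord0 /= add0r.
by congr (F _ + F _ + F _ + F _); apply: val_inj; rewrite /= inordK.
Qed.

Lemma ord4_cases (i : 'I_4) : [\/ i = inord 0, i = inord 1, i = inord 2 | i = inord 3].
Proof.
case: i => -[|[|[|[|//]]]] H.
- by apply: Or41; apply: val_inj; rewrite /= inordK.
- by apply: Or42; apply: val_inj; rewrite /= inordK.
- by apply: Or43; apply: val_inj; rewrite /= inordK.
- by apply: Or44; apply: val_inj; rewrite /= inordK.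
Qed.

Section CauchyForm.
Context {R : realType}.
Implicit Types (w n f : quat R).
Local Notation "v # k" := (v 0 (inord k)) (at level 2, format "v # k").

(** With rows read as pairs of complex numbers, [form_ar] and [form_ai] are the parts of conj(w_1)
    n_1 + conj(w_2) n_2, and [form_br], [form_bi] those of the conjugate of w_1 n_2 - w_2 n_1. For w
    = n the first is |n|^2 and the second vanishes. *)
Definition form_ar w n := w#0 * n#0 + w#1 * n#1 + w#2 * n#2 + w#3 * n#3.
Definition form_ai w n := w#0 * n#1 - w#1 * n#0 + w#2 * n#3 - w#3 * n#2.
Definition form_br w n := w#0 * n#2 - w#1 * n#3 - w#2 * n#0 + w#3 * n#1.
Definition form_bi w n := - (w#0 * n#3) - w#1 * n#2 + w#2 * n#1 + w#3 * n#0.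

(* With alpha = form_ar + i form_ai, beta = form_br + i form_bi and f = f1 + f2 j,
   the components of (alpha f1 - beta f2^* ) + (alpha f2 + beta f1^* ) j; the
   integrand of the Cauchy-type integral is [cauchy_form _ k n f] for the
   gradient kernel k. *)
Definition cauchy_form (i : 'I_4) w n f : R :=
  let ar := form_ar w n in let ai := form_ai w n in
  let br := form_br w n in let bi := form_bi w n in
  [:: ar * f#0 - ai * f#1 - (br * f#2 + bi * f#3);
      ar * f#1 + ai * f#0 - (bi * f#2 - br * f#3);
      ar * f#2 - ai * f#3 + (br * f#0 + bi * f#1);
      ar * f#3 + ai * f#2 + (bi * f#0 - br * f#1)]`_i.

Lemma cauchy_formE w n f :
  (cauchy_form (inord 0) w n f = form_ar w n * f#0 - form_ai w n * f#1 -
     (form_br w n * f#2 + form_bi w n * f#3)) *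
  (cauchy_form (inord 1) w n f = form_ar w n * f#1 + form_ai w n * f#0 -
     (form_bi w n * f#2 - form_br w n * f#3)) *
  (cauchy_form (inord 2) w n f = form_ar w n * f#2 - form_ai w n * f#3 +
     (form_br w n * f#0 + form_bi w n * f#1)) *
  (cauchy_form (inord 3) w n f = form_ar w n * f#3 + form_ai w n * f#2 +
     (form_bi w n * f#0 - form_br w n * f#1)).
Proof. by rewrite /cauchy_form !inordK. Qed.

Lemma cauchy_form_lin i (c : R) w v n f :
  cauchy_form i (c *: w + v) n f = c * cauchy_form i w n f + cauchy_form i v n f.
Proof.
by have [] := ord4_cases i => ->; rewrite !cauchy_formE /form_ar /form_ai /form_br /form_bi !mxE; ring.
Qed.

Lemma cauchy_form_basis i w n f :
  \sum_a w 0 a * cauchy_form i 'e_a n f = cauchy_form i w n f.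
Proof.
rewrite [w in RHS]row_basis_sum; elim: (index_enum _) => [|j s IHs]; last first.
  by rewrite !big_cons cauchy_form_lin IHs.
rewrite !big_nil; have := cauchy_form_lin i (-1) 0 0 n f.
by rewrite scaler0 addr0 mulN1r addrC subrr.
Qed.

Lemma cauchy_form_normal i n f : sqn n = 1 -> cauchy_form i n n f = f 0 i.
Proof.
rewrite /sqn sum_ord4 => n1.
have [] := ord4_cases i => ->; rewrite cauchy_formE /form_ar /form_ai /form_br /form_bi.
- rewrite -[RHS]mul1r -n1; ring.
- rewrite -[RHS]mul1r -n1; ring.
- rewrite -[RHS]mul1r -n1; ring.
- rewrite -[RHS]mul1r -n1; ring.
Qed.

(** Real and imaginary parts of the two complex equations of psi-regularity, with [D i b] in the
    role of the derivative of component [i] in direction [b]. *)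
Definition cr_equations (D : 'I_4 -> 'I_4 -> R) :=
  let d i b := D (inord i) (inord b) in
  [/\ d 0%N 0%N - d 1%N 1%N = d 2%N 2%N - d 3%N 3%N,
      d 0%N 1%N + d 1%N 0%N = - (d 2%N 3%N + d 3%N 2%N),
      d 0%N 2%N - d 1%N 3%N = - (d 2%N 0%N - d 3%N 1%N) &
      d 0%N 3%N + d 1%N 2%N = d 2%N 1%N + d 3%N 0%N].

(** Column [b] of [m] plays the derivative of the gradient kernel in direction [b]; symmetry and
    zero trace express that this kernel is curl-free and divergence-free, and the equations follow
    for all [n] and [f]. *)
Lemma cauchy_form_regular (m : 'I_4 -> 'I_4 -> R) n f :
  (forall a b, m a b = m b a) -> \sum_a m a a = 0 ->
  cr_equations (fun i b => cauchy_form i (\row_a m a b) n f).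
Proof.
move=> ms m0; rewrite /cr_equations.
have m33 : m (inord 3) (inord 3) =
    - (m (inord 0) (inord 0) + m (inord 1) (inord 1) + m (inord 2) (inord 2)).
  by move: m0; rewrite sum_ord4 => H; apply/eqP; rewrite -addr_eq0 addrC H.
split; rewrite !cauchy_formE /form_ar /form_ai /form_br /form_bi !mxE m33
  (ms (inord 1) (inord 0)) (ms (inord 2) (inord 0)) (ms (inord 3) (inord 0))
  (ms (inord 2) (inord 1)) (ms (inord 3) (inord 1)) (ms (inord 3) (inord 2)); ring.
Qed.

End CauchyForm.

Section CauchyPotential.
Context {R : realType}.
Variables (Omega : set (quat R)) (rho : quat R -> R).
Variable sigma : {measure set (@borel R 4) -> \bar R}.
Hypothesis drho : defining_function rho Omega.
Hypothesis bOmega : bounded_set Omega.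
Local Notation S := (boundary Omega).
Hypothesis surf : surface_measure S sigma.
Variable f : quat R -> quat R.
Hypothesis cf : forall i, {within S, continuous (fun x => f x 0 i)}.
Local Notation N := (unit_normal rho).

Let cS : compact S. Proof. exact: boundary_compact drho bOmega. Qed.
Let finS : (sigma S < +oo)%E. Proof. exact: boundary_finite drho bOmega surf. Qed.

(** [cauchy_form] is linear in the kernel, so each component of the integral splits into four scalar
    potentials, with these coefficients. *)
Definition density (i a : 'I_4) (z : quat R) : R := cauchy_form i 'e_a (N z) (f z).

Definition cauchy_potential (i : 'I_4) (x : quat R) : R :=
  \sum_a potential sigma S (ker a) (density i a) x.

Lemma density_within i a : {within S, continuous (density i a)}.
Proof.
have cN b : {within S, continuous (fun z => N z 0 b)} by exact: (unit_normal_within drho).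
have cC (c : R) : {within S, continuous (fun=> c)} by exact: within_continuous_cst.
have c1 (c : R) b : {within S, continuous (fun z => c * N z 0 b)}.
  exact: (within_continuousM (cC c) (cN b)).
have c2 (c : R) b : {within S, continuous (fun z => - (c * N z 0 b))}.
  exact: (within_continuousN (c1 c b)).
have D := @within_continuousD R _ S.
have A1 : {within S, continuous (fun z => form_ar 'e_a (N z))}.
  exact: (D _ _ (D _ _ (D _ _ (c1 _ _) (c1 _ _)) (c1 _ _)) (c1 _ _)).
have A2 : {within S, continuous (fun z => form_ai 'e_a (N z))}.
  exact: (D _ _ (D _ _ (D _ _ (c1 _ _) (c2 _ _)) (c1 _ _)) (c2 _ _)).
have A3 : {within S, continuous (fun z => form_br 'e_a (N z))}.
  exact: (D _ _ (D _ _ (D _ _ (c1 _ _) (c2 _ _)) (c2 _ _)) (c1 _ _)).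
have A4 : {within S, continuous (fun z => form_bi 'e_a (N z))}.
  exact: (D _ _ (D _ _ (D _ _ (c2 _ _) (c2 _ _)) (c1 _ _)) (c1 _ _)).
have M (g : quat R -> R) : {within S, continuous g} -> forall b, {within S, continuous (fun z => g z * f z 0 b)}.
  by move=> cg b; exact: (within_continuousM cg (@cf b)).
have NN := @within_continuousN R _ S.
rewrite /density; have [] := ord4_cases i => ->.
- rewrite (_ : (fun z => _) = (fun z => form_ar 'e_a (N z) * f z 0 (inord 0) -
     form_ai 'e_a (N z) * f z 0 (inord 1) - (form_br 'e_a (N z) * f z 0 (inord 2) +
     form_bi 'e_a (N z) * f z 0 (inord 3)))); last by apply/funext => z; rewrite cauchy_formE.
  exact: (D _ _ (D _ _ (M _ A1 _) (NN _ (M _ A2 _))) (NN _ (D _ _ (M _ A3 _) (M _ A4 _)))).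
- rewrite (_ : (fun z => _) = (fun z => form_ar 'e_a (N z) * f z 0 (inord 1) +
     form_ai 'e_a (N z) * f z 0 (inord 0) - (form_bi 'e_a (N z) * f z 0 (inord 2) -
     form_br 'e_a (N z) * f z 0 (inord 3)))); last by apply/funext => z; rewrite cauchy_formE.
  exact: (D _ _ (D _ _ (M _ A1 _) (M _ A2 _)) (NN _ (D _ _ (M _ A4 _) (NN _ (M _ A3 _))))).
- rewrite (_ : (fun z => _) = (fun z => form_ar 'e_a (N z) * f z 0 (inord 2) -
     form_ai 'e_a (N z) * f z 0 (inord 3) + (form_br 'e_a (N z) * f z 0 (inord 0) +
     form_bi 'e_a (N z) * f z 0 (inord 1)))); last by apply/funext => z; rewrite cauchy_formE.
  exact: (D _ _ (D _ _ (M _ A1 _) (NN _ (M _ A2 _))) (D _ _ (M _ A3 _) (M _ A4 _))).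
- rewrite (_ : (fun z => _) = (fun z => form_ar 'e_a (N z) * f z 0 (inord 3) +
     form_ai 'e_a (N z) * f z 0 (inord 2) + (form_bi 'e_a (N z) * f z 0 (inord 0) -
     form_br 'e_a (N z) * f z 0 (inord 1)))); last by apply/funext => z; rewrite cauchy_formE.
  exact: (D _ _ (D _ _ (M _ A1 _) (M _ A2 _)) (D _ _ (M _ A4 _) (NN _ (M _ A3 _)))).
Qed.

Lemma ker1_off0 a b : continuous_off0 (@ker1 R 4 a b).
Proof. by move=> v v0; apply: differentiable_continuous; exact: (has_grad_ker1 a b v0).1. Qed.

Lemma ker2_off0 a b c : continuous_off0 (@ker2 R 4 a b c).
Proof. by move=> v v0; apply: differentiable_continuous; exact: differentiable_ker2. Qed.

Lemma sum_potential_diff (k : 'I_4 -> quat R -> R) (kd : 'I_4 -> 'I_4 -> quat R -> R) i x :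
  (forall a v, v != 0 -> has_grad (k a) v (fun b => kd a b v)) ->
  (forall a b, continuous_off0 (kd a b)) -> ~ S x ->
  has_grad (fun x => \sum_a potential sigma S (k a) (density i a) x) x
    (fun b => \sum_a potential sigma S (kd a b) (density i a) x).
Proof.
move=> kg ck nSx.
apply: (@has_grad_sum _ _ _ (fun a => potential sigma S (k a) (density i a)) x
  (fun a b => potential sigma S (kd a b) (density i a) x)) => a.
exact: (potential_diff cS finS (kg a) (ck a) (@density_within i a) nSx).
Qed.

Definition cauchy_potential1 (i b : 'I_4) (x : quat R) : R :=
  \sum_a potential sigma S (ker1 a b) (density i a) x.

Definition cauchy_potential2 (i b c : 'I_4) (x : quat R) : R :=
  \sum_a potential sigma S (ker2 a b c) (density i a) x.

Lemma cauchy_potential_grad i x : ~ S x ->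
  has_grad (cauchy_potential i) x (fun b => cauchy_potential1 i b x).
Proof.
move=> nSx; apply: sum_potential_diff => //; first by move=> a v v0; exact: has_grad_ker.
exact: ker1_off0.
Qed.

Lemma cauchy_potential1_grad i b x : ~ S x ->
  has_grad (cauchy_potential1 i b) x (fun c => cauchy_potential2 i b c x).
Proof.
move=> nSx; apply: (@sum_potential_diff (fun a => ker1 a b) (fun a c => ker2 a b c)) => //.
  by move=> a v v0; exact: has_grad_ker1.
by move=> a c; exact: ker2_off0.
Qed.

Lemma cauchy_potential2_sym i b c x : cauchy_potential2 i b c x = cauchy_potential2 i c b x.
Proof.
rewrite /cauchy_potential2; apply: eq_bigr => a _.
by rewrite (_ : ker2 a b c = ker2 a c b)//; apply/funext => v; exact: ker2C23.
Qed.

Lemma cauchy_potential_C1 i : C1_on (~` S) (cauchy_potential i).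
Proof.
move=> x nSx; split=> [|b]; first by have [] := cauchy_potential_grad i nSx.
have oS : open (~` S) by apply: closed_openC; exact: boundary_closed drho.
have : {for x, continuous (cauchy_potential1 i b)}.
  by apply: differentiable_continuous; have [] := cauchy_potential1_grad i b nSx.
have E : {near x, cauchy_potential1 i b =1 partial b (cauchy_potential i)}.
  have : nbhs x (~` S) by apply: open_nbhs_nbhs.
  by apply: filterS => y nSy; rewrite (cauchy_potential_grad i nSy).2.
exact: near_eq_continuous_at.
Qed.

Lemma cauchy_potential1E i b x : ~ S x -> cauchy_potential1 i b x =
  \int[sigma]_(z in S) cauchy_form i (\row_a ker1 a b (x - z)) (N z) (f z).
Proof.
move=> nSx; rewrite /cauchy_potential1 /potential -(sint_sum cS finS); last first.
  by move=> a; apply: potential_within nSx; [exact: ker1_off0|exact: density_within].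
by apply: eq_Rintegral => z _; rewrite -cauchy_form_basis; apply: eq_bigr => a _; rewrite mxE.
Qed.

Lemma form1_within i b x : ~ S x ->
  {within S, continuous (fun z => cauchy_form i (\row_a ker1 a b (x - z)) (N z) (f z))}.
Proof.
move=> nSx; rewrite (_ : (fun z => _) = (fun z => \sum_a ker1 a b (x - z) * density i a z)).
  apply: within_continuous_sum => a.
  by apply: potential_within nSx; [exact: ker1_off0|exact: density_within].
by apply/funext => z; rewrite -cauchy_form_basis; apply: eq_bigr => a _; rewrite mxE.
Qed.

(** The equations hold for the integrand at each [z]; being linear, they pass to the integral. *)
Lemma cauchy_potential_regular x : ~ S x ->
  cr_equations (fun i b => cauchy_potential1 i b x).
Proof.
move=> nSx.
pose j i b z := cauchy_form i (\row_a ker1 a b (x - z)) (N z) (f z).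
have c i b : {within S, continuous (j i b)} by exact: form1_within.
have -> : (fun i b => cauchy_potential1 i b x) = (fun i b => \int[sigma]_(z in S) j i b z).
  by apply/funext => i; apply/funext => b; exact: cauchy_potential1E.
have reg z : S z -> cr_equations (fun i b => j i b z).
  move=> Sz; exact: (cauchy_form_regular (m := fun a b => ker1 a b (x - z)) (N z) (f z)
    (fun a b => ker1C a b _) (ker1_trace (off_sub nSx Sz))).
clearbody j.
have mN (g : quat R -> R) : {within S, continuous g} ->
    - (\int[sigma]_(z in S) g z) = \int[sigma]_(z in S) (- 1 * g z).
  by move=> cg; rewrite (sintZ cS finS) ?mulN1r.
have sB i b k d := sintB cS finS (c i b) (c k d).
have sD i b k d := sintD cS finS (c i b) (c k d).
have cB i b k d := within_continuousD (c i b) (within_continuousN (c k d)).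
have cD i b k d := within_continuousD (c i b) (c k d).
split.
- apply: (etrans (esym (sB _ _ _ _))); apply: (etrans _ (sB _ _ _ _)).
  by apply: eq_Rintegral => z /set_mem Sz; have [] := reg z Sz.
- apply: (etrans (esym (sD _ _ _ _))); rewrite -sD mN; last exact: cD.
  by apply: eq_Rintegral => z /set_mem Sz; rewrite mulN1r; have [] := reg z Sz.
- apply: (etrans (esym (sB _ _ _ _))); rewrite -sB mN; last exact: cB.
  by apply: eq_Rintegral => z /set_mem Sz; rewrite mulN1r; have [] := reg z Sz.
- apply: (etrans (esym (sD _ _ _ _))); apply: (etrans _ (sD _ _ _ _)).
  by apply: eq_Rintegral => z /set_mem Sz; have [] := reg z Sz.
Qed.

Lemma cauchy_potentialE i x : ~ S x -> cauchy_potential i x =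
  \int[sigma]_(z in S) cauchy_form i (\row_a ker a (x - z)) (N z) (f z).
Proof.
move=> nSx; rewrite /cauchy_potential /potential -(sint_sum cS finS); last first.
  by move=> a; apply: potential_within nSx; [exact: ker_off0|exact: density_within].
by apply: eq_Rintegral => z _; rewrite -cauchy_form_basis; apply: eq_bigr => a _; rewrite mxE.
Qed.

(** Contracting the densities with the unit normal puts w = n in [cauchy_form], which returns the
    component of [f] itself. *)
Lemma cauchy_potential_jump i p0 (eps : R) :
  (forall x, ~ closure Omega x -> cauchy_potential i x = 0) -> S p0 -> 0 < eps ->
  exists2 eta, 0 < eta & forall x, Omega x -> `|x - p0| < eta ->
    `|cauchy_potential i x + 2 * pi ^+ 2 * f p0 0 i| <= eps.
Proof.
move=> E0 Sp eps0; have [eta eta0 H] := jump drho bOmega surf (@density_within i) E0 Sp eps0.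
exists eta => // x Ox xp; have := H x Ox xp.
by rewrite cauchy_form_basis cauchy_form_normal// sqn_unit_normal// (boundary_gradr drho).
Qed.

End CauchyPotential.

Lemma sum_ord2 {V : nmodType} (F : 'I_2 -> V) : \sum_(k < 2) F k = F 0 + F 1.
Proof. by rewrite big_ord_recr big_ord1; congr (F _ + F _); apply: val_inj. Qed.

(** * Newtonian test functions and the two integral conditions *)

Section NewtonTest.
Context {R : realType}.
Variables (Omega : set (quat R)) (rho : quat R -> R).
Variable sigma : {measure set (@borel R 4) -> \bar R}.
Hypothesis drho : defining_function rho Omega.
Hypothesis bOmega : bounded_set Omega.
Local Notation S := (boundary Omega).
Hypothesis surf : surface_measure S sigma.
Variable f : quat R -> quat R.
Hypothesis cf : forall i, {within S, continuous (fun x => f x 0 i)}.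
Local Notation N := (unit_normal rho).

Let cS : compact S. Proof. exact: boundary_compact drho bOmega. Qed.
Let finS : (sigma S < +oo)%E. Proof. exact: boundary_finite drho bOmega surf. Qed.

Lemma has_grad_shift (k : quat R -> R) (x0 y : quat R) dk : has_grad k (y - x0) dk ->
  has_grad (fun z => k (z - x0)) y dk.
Proof.
move=> [d1 d2]; split=> [|i].
  exact: differentiable_comp.
rewrite -d2 /partial /derive; apply: (congr1 (fun g : R -> R => lim (g @ 0^'))).
by apply/funext => h /=; rewrite /shift /= addrA.
Qed.

Definition newton_test (x0 y : quat R) : R[i] := (newton (y - x0))%:C.

Section Test.
Variable x0 : quat R.
Hypothesis Ex0 : ~ closure Omega x0.

Let off y : closure Omega y -> y - x0 != 0.
Proof. by move=> cy; apply/eqP => /subr0_eq yx; apply: Ex0; rewrite -yx. Qed.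

Let u y := newton (y - x0).

Let u1 y : y - x0 != 0 -> has_grad u y (fun i => - 2 * ker i (y - x0)).
Proof.
move=> y0; apply: has_grad_shift; apply: has_grad_eq (has_grad_newton y0) _ => i.
by rewrite /ker; ring.
Qed.

Let near_off y : y - x0 != 0 -> \forall z \near y, z - x0 != 0.
Proof.
rewrite subr_eq0 => yx; have : nbhs y (~` [set x0]).
  apply: open_nbhs_nbhs; split; last by apply/eqP.
  by apply: closed_openC; exact: (accessible_closed_set1 (hausdorff_accessible (@norm_hausdorff _ _))).
by apply: filterS => z /eqP; rewrite subr_eq0.
Qed.

Let partial_u i y : y - x0 != 0 -> {near y, (fun z => - 2 * ker i (z - x0)) =1 partial i u}.
Proof. by move=> /near_off; apply: filterS => z z0; rewrite (u1 z0).2. Qed.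

Let u2 i y : y - x0 != 0 ->
  has_grad (fun z => - 2 * ker i (z - x0)) y (fun j => - 2 * ker1 i j (y - x0)).
Proof. by move=> y0; apply: has_gradZ; apply: has_grad_shift; exact: has_grad_ker. Qed.

Let ker_cont i (y : quat R) : y - x0 != 0 -> {for y, continuous (fun z : quat R => - 2 * ker i (z - x0))}.
Proof. by move=> y0; apply: differentiable_continuous; have [] := u2 i y0. Qed.

Let partial_u_cont i y : y - x0 != 0 -> {for y, continuous (partial i u)}.
Proof. by move=> y0; apply: near_eq_continuous_at (partial_u i y0) _; exact: ker_cont. Qed.

Let uC1 : C1_on Omega u.
Proof.
move=> y Oy; have y0 := off (subset_closure Oy); split; first by have [] := u1 y0.
by move=> i; exact: partial_u_cont.
Qed.

Lemma newton_harmonic : harmonic_on Omega u.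
Proof.
split; first exact: uC1.
  move=> i y Oy; have y0 := off (subset_closure Oy); split.
    by apply: near_eq_differentiable (partial_u i y0) _; have [] := u2 i y0.
  move=> j; have E z : z - x0 != 0 -> partial j (partial i u) z = - 2 * ker1 i j (z - x0).
    by move=> z0; rewrite -(near_eq_partial j (partial_u i z0)) (u2 i z0).2.
  have : {for y, continuous (fun z : quat R => - 2 * ker1 i j (z - x0))}.
    apply: differentiable_continuous.
    by have [] := has_gradZ (- 2) (has_grad_shift (has_grad_ker1 i j y0)).
  apply: near_eq_continuous_at; have := near_off y0; apply: filterS => z /E ->.
  by [].
move=> y Oy; have y0 := off (subset_closure Oy).
rewrite (eq_bigr (fun i => - 2 * ker1 i i (y - x0))); last first.
  by move=> i _; rewrite -(near_eq_partial i (partial_u i y0)) (u2 i y0).2.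
by rewrite -mulr_sumr ker1_trace// mulr0.
Qed.

Lemma newton_C1_closure : C1_closure Omega u.
Proof.
split; first exact: uC1.
  apply: within_continuous_fun => y /off y0.
  by apply: differentiable_continuous; have [] := u1 y0.
move=> k; exists (fun z => - 2 * ker k (z - x0)); split.
  by apply: within_continuous_fun => y /off y0; exact: ker_cont.
by move=> y Oy; have y0 := off (subset_closure Oy); rewrite (u1 y0).2.
Qed.

Lemma zero_harmonic : harmonic_on Omega (fun=> 0 : R).
Proof.
have P0 k : partial k (fun _ : quat R => 0 : R) = fun=> 0.
  by apply/funext => x; rewrite /partial derive_cst.
have C : C1_on Omega (fun=> 0 : R).
  by move=> x _; split; [exact: differentiable_cst|move=> k; rewrite P0; exact: cst_continuous].
split; [exact: C|by move=> k; rewrite P0; exact: C|].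
by move=> x _; rewrite big1// => k _; rewrite !P0.
Qed.

Lemma zero_C1_closure : C1_closure Omega (fun=> 0 : R).
Proof.
have [C _ _] := zero_harmonic; split; [exact: C|exact: within_continuous_cst|].
move=> k; exists (fun=> 0); split; first exact: within_continuous_cst.
by move=> x _; rewrite /partial derive_cst.
Qed.

Lemma newton_test_harm1 : harm1 Omega (newton_test x0).
Proof.
split; [exact: newton_harmonic|exact: zero_harmonic|exact: newton_C1_closure|exact: zero_C1_closure].
Qed.

Let proper_within z : S z -> ProperFilter (within Omega (nbhs z)).
Proof.
move=> Sz; apply: within_nbhs_proper; exact: (boundary_closure drho Sz).
Qed.

(** At a boundary point the trace of the neighbourhood filter on [Omega] is proper, so the limit is
    unique; it is the value at [z] because [x0] is off the closure and the derivative is continuous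
    around [z]. *)
Lemma ext_partial_newton j z : S z -> ext_partial Omega j u z = - 2 * ker j (z - x0).
Proof.
move=> Sz; have z0 := off (boundary_closure drho Sz).
have PF := proper_within Sz.
apply: cvg_lim; first exact: norm_hausdorff.
have := @ker_cont j z z0; rewrite /prop_for /continuous_at => H.
have : partial j u @ nbhs z --> - 2 * ker j (z - x0).
  by apply: cvg_trans H; exact: (near_eq_cvg (partial_u j z0)).
by apply: cvg_trans; apply: cvg_app; exact: cvg_within.
Qed.

Lemma ext_partial0 j z : S z -> ext_partial Omega j (fun=> 0 : R) z = 0.
Proof.
move=> Sz; have PF := proper_within Sz.
rewrite /ext_partial (_ : partial j _ = fun=> 0); first exact: lim_cst.
by apply/funext => x; rewrite /partial derive_cst.
Qed.

Let halfC : (2^-1 : R[i]) = (2^-1)%:C.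
Proof. by rewrite fmorphV rmorph_nat. Qed.

Let idx : (re_idx 0 = inord 0) * (im_idx 0 = inord 1) * (re_idx 1 = inord 2) * (im_idx 1 = inord 3).
Proof. by []. Qed.

Let wirtE k (a : 'I_4 -> R) :
  wirt k (fun j => (a j)%:C) = (a (re_idx k) / 2) +i* (- (a (im_idx k) / 2)).
Proof.
rewrite /wirt halfC; apply/eqP; rewrite eq_complex /=; apply/andP; split; apply/eqP; ring.
Qed.

Let wirt_barE k (a : 'I_4 -> R) :
  wirt_bar k (fun j => (a j)%:C) = (a (re_idx k) / 2) +i* (a (im_idx k) / 2).
Proof.
rewrite /wirt_bar halfC; apply/eqP; rewrite eq_complex /=; apply/andP; split; apply/eqP; ring.
Qed.

(** Each Wirtinger derivative carries a factor 1/2, hence half the Euclidean length of the gradient;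
    dividing by it produces unit normals. *)
Lemma dbar_rho_normE z : dbar_rho_norm rho z = Num.sqrt (sqn (gradr rho z)) / 2.
Proof.
have nE (a b : R) : Normc.normc (a +i* b) ^+ 2 = a ^+ 2 + b ^+ 2.
  by rewrite /= sqr_sqrtr ?addr_ge0 ?sqr_ge0.
have nz k : Normc.normc (rho_zbar rho k z) ^+ 2 =
    (partial (re_idx k) rho z / 2) ^+ 2 + (partial (im_idx k) rho z / 2) ^+ 2.
  by rewrite /rho_zbar wirt_barE nE.
rewrite /dbar_rho_norm (eq_bigr _ (fun k _ => nz k)) sum_ord2 !idx.
rewrite [X in Num.sqrt X](_ : _ = sqn (gradr rho z) * (2^-1) ^+ 2).
  by rewrite sqrtrM ?sqn_ge0// sqrtr_sqr ger0_norm// invr_ge0.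
have E (a b c d : R) : (a / 2) ^+ 2 + (b / 2) ^+ 2 + ((c / 2) ^+ 2 + (d / 2) ^+ 2) =
    (a ^+ 2 + b ^+ 2 + c ^+ 2 + d ^+ 2) * 2^-1 ^+ 2 by field.
by rewrite /sqn sum_ord4 !mxE E.
Qed.

Lemma newton_zbar k z : S z ->
  phi_zbar Omega (newton_test x0) k z = (- ker (re_idx k) (z - x0)) +i* (- ker (im_idx k) (z - x0)).
Proof.
move=> Sz; rewrite /phi_zbar (_ : (fun j => _) = (fun j => (- 2 * ker j (z - x0))%:C)).
  by rewrite wirt_barE; congr (_ +i* _); field.
by apply/funext => j; rewrite ext_partial_newton// ext_partial0.
Qed.

Let K z : quat R := \row_a ker a (z - x0).

(** This value is minus the conjugate of form_ar + i form_ai, and in [Lop_newton] it is minus the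
    conjugate of form_br + i form_bi: the integral conditions contain the very coefficients of the
    Cauchy-type integrand. *)
Lemma dbar_n_newton z : S z ->
  dbar_n rho Omega (newton_test x0) z = (- form_ar (K z) (N z)) +i* form_ai (K z) (N z).
Proof.
move=> Sz; rewrite /dbar_n sum_ord2 dbar_rho_normE -fmorphV /rho_z !wirtE !newton_zbar// !idx.
have E (r0 r1 r2 r3 k0 k1 k2 k3 h : R) : (2 * h)%:C *
    ((r0 / 2 +i* (- (r1 / 2))) * ((- k0) +i* (- k1)) + (r2 / 2 +i* (- (r3 / 2))) * ((- k2) +i* (- k3))) =
    (- (k0 * (h * r0) + k1 * (h * r1) + k2 * (h * r2) + k3 * (h * r3))) +i*
    (k0 * (h * r1) - k1 * (h * r0) + k2 * (h * r3) - k3 * (h * r2)).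
  by apply/eqP; rewrite eq_complex /=; apply/andP; split; apply/eqP; field.
by rewrite /form_ar /form_ai !mxE invf_div E.
Qed.

Lemma Lop_newton z : S z ->
  Lop rho Omega (newton_test x0) z = (- form_br (K z) (N z)) +i* form_bi (K z) (N z).
Proof.
move=> Sz; rewrite /Lop dbar_rho_normE -fmorphV /rho_zbar !wirt_barE !newton_zbar// !idx.
have E (r0 r1 r2 r3 k0 k1 k2 k3 h : R) : (2 * h)%:C *
    ((r2 / 2 +i* (r3 / 2)) * ((- k0) +i* (- k1)) - (r0 / 2 +i* (r1 / 2)) * ((- k2) +i* (- k3))) =
    (- (k0 * (h * r2) - k1 * (h * r3) - k2 * (h * r0) + k3 * (h * r1))) +i*
    (- (k0 * (h * r3)) - k1 * (h * r2) + k2 * (h * r1) + k3 * (h * r0)).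
  by apply/eqP; rewrite eq_complex /=; apply/andP; split; apply/eqP; field.
by rewrite /form_br /form_bi !mxE invf_div E.
Qed.

Let nSx0 : ~ S x0. Proof. by move=> /(boundary_closure drho). Qed.

Let form_within : [/\ {within S, continuous (fun z => form_ar (K z) (N z))},
  {within S, continuous (fun z => form_ai (K z) (N z))},
  {within S, continuous (fun z => form_br (K z) (N z))} &
  {within S, continuous (fun z => form_bi (K z) (N z))}].
Proof.
have cN b : {within S, continuous (fun z => N z 0 b)} by exact: (unit_normal_within drho).
have cK a : {within S, continuous (fun z => K z 0 a)}.
  rewrite (_ : (fun z => _) = (fun z => - 2^-1 * (- 2 * ker a (z - x0)))); last first.
    by apply/funext => z; rewrite mxE; field.
  apply: within_continuousM; first exact: within_continuous_cst.
  by apply: within_continuous_fun => z Sz; apply: ker_cont; exact: off (boundary_closure drho Sz).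
have c1 a b : {within S, continuous (fun z => K z 0 a * N z 0 b)}.
  exact: (within_continuousM (@cK a) (@cN b)).
have c2 a b : {within S, continuous (fun z => - (K z 0 a * N z 0 b))}.
  exact: (within_continuousN (c1 a b)).
have D := @within_continuousD R _ S.
split.
- exact: (D _ _ (D _ _ (D _ _ (c1 _ _) (c1 _ _)) (c1 _ _)) (c1 _ _)).
- exact: (D _ _ (D _ _ (D _ _ (c1 _ _) (c2 _ _)) (c1 _ _)) (c2 _ _)).
- exact: (D _ _ (D _ _ (D _ _ (c1 _ _) (c2 _ _)) (c2 _ _)) (c1 _ _)).
- exact: (D _ _ (D _ _ (D _ _ (c2 _ _) (c2 _ _)) (c1 _ _)) (c1 _ _)).
Qed.

(** The test function uses the kernel at [z - x0] and the potential uses it at [x0 - z]; oddness of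
    the kernel only changes the sign. *)
Let potential_zero i (A B : quat R -> R) :
  {within S, continuous A} -> {within S, continuous B} ->
  \int[sigma]_(z in S) A z = \int[sigma]_(z in S) B z ->
  (forall z, cauchy_form i (K z) (N z) (f z) = A z - B z) ->
  cauchy_potential Omega rho sigma f i x0 = 0.
Proof.
move=> cA cB AB E; rewrite (cauchy_potentialE drho bOmega surf cf i nSx0).
rewrite (_ : (\int[sigma]_(z in S) _) = \int[sigma]_(z in S) (B z - A z)).
  by rewrite (sintB cS finS cB cA) AB subrr.
apply: eq_Rintegral => z _; rewrite -[RHS]opprB -E (_ : \row_a ker a (x0 - z) = (-1) *: K z + 0).
  rewrite cauchy_form_lin mulN1r; have := cauchy_form_lin i (-1) 0 0 (N z) (f z).
  by rewrite scaler0 addr0 mulN1r addNr => ->; rewrite addr0.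
by apply/rowP => a; rewrite !mxE addr0 mulN1r -kerN opprB.
Qed.

Let dbarM k z : S z -> conjc (zcoord k (f z)) * dbar_n rho Omega (newton_test x0) z =
  (form_ai (K z) (N z) * f z 0 (im_idx k) - form_ar (K z) (N z) * f z 0 (re_idx k)) +i*
  (form_ar (K z) (N z) * f z 0 (im_idx k) + form_ai (K z) (N z) * f z 0 (re_idx k)).
Proof.
move=> Sz; rewrite dbar_n_newton// /zcoord.
have E (a b c d : R) : conjc (a +i* b) * ((- c) +i* d) = (d * b - c * a) +i* (c * b + d * a).
  by apply/eqP; rewrite eq_complex /=; apply/andP; split; apply/eqP; ring.
exact: E.
Qed.

Let LopM k z : S z -> zcoord k (f z) * Lop rho Omega (newton_test x0) z =
  (- (form_br (K z) (N z) * f z 0 (re_idx k) + form_bi (K z) (N z) * f z 0 (im_idx k))) +i*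
  (form_bi (K z) (N z) * f z 0 (re_idx k) - form_br (K z) (N z) * f z 0 (im_idx k)).
Proof.
move=> Sz; rewrite Lop_newton// /zcoord.
have E (a b c d : R) : (a +i* b) * ((- c) +i* d) = (- (c * a + d * b)) +i* (d * a - c * b).
  by apply/eqP; rewrite eq_complex /=; apply/andP; split; apply/eqP; ring.
exact: E.
Qed.

Let eqR (g h : quat R -> R) : (forall z, S z -> g z = h z) ->
  \int[sigma]_(z in S) g z = \int[sigma]_(z in S) h z.
Proof. by move=> gh; apply: eq_Rintegral => z /set_mem; exact: gh. Qed.

(** Conjugating condition (a) shows that the integral of alpha f_1 - beta conj(f_2) is zero; its
    real and imaginary parts are components 0 and 1. *)
Lemma exterior_zero_a :
  cintegral sigma S (fun x => conjc (zcoord 0 (f x)) * dbar_n rho Omega (newton_test x0) x) =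
  cintegral sigma S (fun x => zcoord 1 (f x) * Lop rho Omega (newton_test x0) x) ->
  cauchy_potential Omega rho sigma f (inord 0) x0 = 0 /\
  cauchy_potential Omega rho sigma f (inord 1) x0 = 0.
Proof.
have [c1 c2 c3 c4] := form_within.
have cD := @within_continuousD R _ S; have cN := @within_continuousN R _ S.
have cM (g : quat R -> R) : {within S, continuous g} ->
    forall b, {within S, continuous (fun z => g z * f z 0 b)}.
  by move=> cg b; exact: (within_continuousM cg (@cf b)).
move=> H; have re := congr1 (@complex.Re R) H; have im := congr1 (@complex.Im R) H.
move: re im; rewrite /cintegral /=.
rewrite (eqR (fun z Sz => congr1 (@complex.Re R) (dbarM 0 Sz))).
rewrite (eqR (fun z Sz => congr1 (@complex.Im R) (dbarM 0 Sz))).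
rewrite (eqR (fun z Sz => congr1 (@complex.Re R) (LopM 1 Sz))).
rewrite (eqR (fun z Sz => congr1 (@complex.Im R) (LopM 1 Sz))) !idx /= => re im; split.
- apply: potential_zero (esym re) _.
  + exact: (cN _ (cD _ _ (cM _ c3 _) (cM _ c4 _))).
  + exact: (cD _ _ (cM _ c2 _) (cN _ (cM _ c1 _))).
  + by move=> z; rewrite cauchy_formE; ring.
- apply: potential_zero im _.
  + exact: (cD _ _ (cM _ c1 _) (cM _ c2 _)).
  + exact: (cD _ _ (cM _ c4 _) (cN _ (cM _ c3 _))).
  + by move=> z; rewrite cauchy_formE; ring.
Qed.

(** Conjugating condition (b) shows that the integral of alpha f_2 + beta conj(f_1) is zero; its
    real and imaginary parts are components 2 and 3. *)
Lemma exterior_zero_b :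
  cintegral sigma S (fun x => conjc (zcoord 1 (f x)) * dbar_n rho Omega (newton_test x0) x) =
  - cintegral sigma S (fun x => zcoord 0 (f x) * Lop rho Omega (newton_test x0) x) ->
  cauchy_potential Omega rho sigma f (inord 2) x0 = 0 /\
  cauchy_potential Omega rho sigma f (inord 3) x0 = 0.
Proof.
have [c1 c2 c3 c4] := form_within.
have cD := @within_continuousD R _ S; have cN := @within_continuousN R _ S.
have cM (g : quat R -> R) : {within S, continuous g} ->
    forall b, {within S, continuous (fun z => g z * f z 0 b)}.
  by move=> cg b; exact: (within_continuousM cg (@cf b)).
move=> H; have re := congr1 (@complex.Re R) H; have im := congr1 (@complex.Im R) H.
move: re im; rewrite /cintegral /=.
rewrite (eqR (fun z Sz => congr1 (@complex.Re R) (dbarM 1 Sz))).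
rewrite (eqR (fun z Sz => congr1 (@complex.Im R) (dbarM 1 Sz))).
rewrite (eqR (fun z Sz => congr1 (@complex.Re R) (LopM 0 Sz))).
rewrite (eqR (fun z Sz => congr1 (@complex.Im R) (LopM 0 Sz))) !idx /=.
have mN (g : quat R -> R) : {within S, continuous g} ->
    - (\int[sigma]_(z in S) g z) = \int[sigma]_(z in S) (- 1 * g z).
  by move=> cg; rewrite (sintZ cS finS) ?mulN1r.
have cC := @within_continuous_cst R _ S (- 1).
have d1 := cN _ (cD _ _ (cM _ c3 (inord 0)) (cM _ c4 (inord 1))).
have d2 := cD _ _ (cM _ c4 (inord 0)) (cN _ (cM _ c3 (inord 1))).
rewrite (mN _ d1) (mN _ d2) => re im; split.
- apply: potential_zero (esym re) _.
  + exact: (within_continuousM cC d1).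
  + exact: (cD _ _ (cM _ c2 _) (cN _ (cM _ c1 _))).
  + by move=> z; rewrite cauchy_formE; ring.
- apply: potential_zero im _.
  + exact: (cD _ _ (cM _ c1 _) (cM _ c2 _)).
  + exact: (within_continuousM cC d2).
  + by move=> z; rewrite cauchy_formE; ring.
Qed.

End Test.
End NewtonTest.

(** * Holomorphic functions of one variable *)

Section PlaneHolomorphic.
Context {R : realType}.
Implicit Types (p q : R -> R -> R) (s t : R).

Lemma is_derive_right (v : R -> R) s (dv : R) : is_derive s 1 v dv -> 0 < dv ->
  exists2 d, 0 < d & forall h, 0 < h -> h < d -> v s < v (s + h).
Proof.
move=> [dr E] dv0; have : (fun h => h^-1 *: (v (h *: 1 + s) - v s)) @ 0^' --> dv.
  by rewrite -E.
move=> /cvgrPdist_lt/(_ _ dv0); rewrite near_withinE => /nbhs_ballP[d /= d0 H].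
exists d => // h h0 hd; have := H h; rewrite /ball/= sub0r normrN gtr0_norm// => /(_ hd).
rewrite gt_eqF// => /(_ isT); rewrite /GRing.scale/= mulr1 addrC => H1.
have {}H1 : 0 < h^-1 * (v (s + h) - v s).
  by rewrite (addrC s); move: H1; rewrite ltr_norml => /andP[_]; lra.
by move: H1; rewrite pmulr_rgt0 ?invr_gt0// subr_gt0.
Qed.

(** With a positive second derivative, [v1], which vanishes at the maximum, would be positive just
    to the right of it, and the mean value theorem would give a larger value of [v]. *)
Lemma deriv2_le0 (v v1 : R -> R) s (v2 d : R) : 0 < d ->
  (forall y, `|y - s| < d -> is_derive y 1 v (v1 y)) -> is_derive s 1 v1 v2 ->
  (forall y, `|y - s| < d -> v y <= v s) -> v2 <= 0.
Proof.
move=> d0 dv dv1 vmax; rewrite leNgt; apply/negP => v20.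
have ss : `|s - s| < d by rewrite subrr normr0.
have v1s : v1 s = 0.
  have H : is_derive s 1 v 0.
    apply: (@derive1_at_max _ v (s - d) (s + d)).
    - by rewrite lerD2l ge0_cp// ltW.
    - move=> y; rewrite in_itv/= -ltr_distl => yd; by have [] := dv y yd.
    - by rewrite in_itv/= -ltr_distl.
    - by move=> y; rewrite in_itv/= -ltr_distl => yd; exact: vmax.
  by have [_ <-] := dv s ss; have [_] := H.
have [e e0 He] := is_derive_right dv1 v20.
pose h := Num.min d e / 2.
have m0 : 0 < Num.min d e by rewrite lt_min d0.
have h0 : 0 < h by rewrite divr_gt0.
have hm : h < Num.min d e by rewrite /h ltr_pdivrMr// ltr_pMr// ltr1n.
have [hd he] : h < d /\ h < e by move: hm; rewrite lt_min => /andP.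
have near y : s <= y <= s + h -> `|y - s| < d.
  move=> /andP[y0 y1]; rewrite ger0_norm ?subr_ge0//.
  by apply: le_lt_trans hd; rewrite lerBlDl.
have [| | |c] := @MVT R v v1 s (s + h).
- by rewrite ltrDl.
- move=> y; rewrite in_itv/= => /andP[y0 y1]; apply: dv; apply: near.
  by rewrite !ltW.
- apply: derivable_within_continuous => y; rewrite in_itv/= => yy.
  by have [] := dv y (near y yy).
rewrite in_itv/= => /andP[c0 c1].
rewrite (addrC s h) addrK => E.
have cs : 0 < c - s by rewrite subr_gt0.
have ce : c - s < e by apply: lt_trans he; rewrite ltrBlDl.
have := He _ cs ce; rewrite v1s subrKC => v1c.
have := vmax (s + h) (near _ _); rewrite lerDl (ltW h0) lexx => /(_ isT).
by rewrite (addrC s) -subr_le0 E leNgt mulr_gt0.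
Qed.

(** Says that p + i q has complex derivative p1 + i q1 at s + i t; the Cauchy-Riemann equations are
    built in, since the same [p1] and [q1] serve both axes. *)
Definition cderiv p q p1 q1 s t :=
  [/\ is_derive s 1 (p^~ t) (p1 s t), is_derive t 1 (p s) (- q1 s t),
      is_derive s 1 (q^~ t) (q1 s t) & is_derive t 1 (q s) (p1 s t)].

Lemma cderiv_rot p q p1 q1 s t : cderiv p q p1 q1 s t ->
  cderiv (fun s t => - q s t) p (fun s t => - q1 s t) p1 s t.
Proof.
move=> [a b c d]; split; rewrite ?opprK//.
  exact: (is_deriveN (f := q^~ t)).
exact: (is_deriveN (f := q s)).
Qed.

Lemma is_derive_quad (f : R -> R) (y df e c : R) : is_derive y 1 f df ->
  is_derive y 1 (fun y => f y + e * (y ^+ 2 + c)) (df + 2 * e * y).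
Proof.
move=> H; have Q : is_derive y 1 (fun y => e * (y ^+ 2 + c)) (2 * e * y).
  by apply: is_derive_eq; rewrite /GRing.scale /=; ring.
exact: (is_deriveD (f := f) (g := fun y => e * (y ^+ 2 + c))).
Qed.

Lemma is_derive_lin (f : R -> R) (y df e : R) : is_derive y 1 f df ->
  is_derive y 1 (fun y => f y + 2 * e * y) (df + 2 * e).
Proof.
move=> H; have Q : is_derive y 1 (fun y => 2 * e * y) (2 * e).
  by apply: is_derive_eq; rewrite /GRing.scale /=; ring.
exact: (is_deriveD (f := f) (g := fun y => 2 * e * y)).
Qed.

(** Being harmonic, [p] could have both pure second derivatives zero at a maximum; adding e |z|^2
    makes the Laplacian 4 e and rules out interior maxima. Each point of [K] is required to be
    either harmless or interior, so [K] may have any shape. *)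
Lemma max_principle (K : set (R * R)) p q p1 q1 p2 q2 (m r : R) : compact K ->
  {within K, continuous (fun z => p z.1 z.2)} ->
  (forall s t, K (s, t) -> s ^+ 2 + t ^+ 2 <= r) ->
  (forall s t, K (s, t) -> p s t <= m \/
    exists2 d, 0 < d & forall s' t', `|s' - s| < d -> `|t' - t| < d ->
      [/\ K (s', t'), cderiv p q p1 q1 s' t' & cderiv p1 q1 p2 q2 s' t']) ->
  forall s t, K (s, t) -> p s t <= m.
Proof.
move=> cK cp Kr H s0 t0 K0; rewrite leNgt; apply/negP => pm.
have r0 : 0 <= r by apply: le_trans (Kr _ _ K0); rewrite addr_ge0 ?sqr_ge0.
(* The perturbation is at most e r on [K], which is less than the gap between [p s0 t0] and [m]. *)
pose e := (p s0 t0 - m) / (2 * (r + 1)).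
have e0 : 0 < e by rewrite divr_gt0 ?subr_gt0// mulr_gt0// ltr_wpDl.
have er : e * r < p s0 t0 - m.
  rewrite /e mulrAC ltr_pdivrMr ?mulr_gt0 ?ltr_wpDl//.
  by rewrite ltr_pM2l ?subr_gt0//; lra.
pose v s t := p s t + e * (s ^+ 2 + t ^+ 2).
have cv : {within K, continuous (fun z => v z.1 z.2)}.
  apply: within_continuousD => //; apply: within_continuous_fun => z _.
  apply: continuousM; first exact: cst_continuous.
  by apply: continuousD; apply: continuousM; first [exact: cvg_fst|exact: cvg_snd].
have [|[s t] /set_mem Kst vmax] := compact_EVT_max _ cK cv; first by exists (s0, t0).
have {}vmax s' t' : K (s', t') -> v s' t' <= v s t.
  by move=> K'; apply: (vmax (s', t')); rewrite inE.
have ps : m < p s t.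
  have := vmax _ _ K0; rewrite /v => h1.
  have := ler_wpM2l (ltW e0) (Kr _ _ Kst).
  have : 0 <= e * (s0 ^+ 2 + t0 ^+ 2) by rewrite mulr_ge0 ?addr_ge0 ?sqr_ge0// ltW.
  by lra.
have [|[d d0 D]] := H _ _ Kst; first by rewrite leNgt ps.
have dd : `|s - s| < d by rewrite subrr normr0.
have dt : `|t - t| < d by rewrite subrr normr0.
have A : p2 s t + 2 * e <= 0.
  apply: (@deriv2_le0 (v^~ t) (fun y => p1 y t + 2 * e * y) s _ d d0).
  - by move=> y yd; have [_ [a _ _ _] _] := D _ _ yd dt; exact: is_derive_quad.
  - by have [_ _ [a _ _ _]] := D _ _ dd dt; exact: is_derive_lin.
  - by move=> y yd; apply: vmax; have [] := D _ _ yd dt.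
have B : - p2 s t + 2 * e <= 0.
  apply: (@deriv2_le0 (v s) (fun y => - q1 s y + 2 * e * y) t _ d d0).
  - move=> y yd; have [_ [_ a _ _] _] := D _ _ dd yd.
    rewrite (_ : v s = (fun y => p s y + e * (y ^+ 2 + s ^+ 2))); first exact: is_derive_quad.
    by apply/funext => y'; rewrite /v (addrC (s ^+ 2)).
  - have [_ _ [_ _ _ a]] := D _ _ dd dt; apply: is_derive_lin; exact: (is_deriveN (f := q1 s)).
  - by move=> y yd; apply: vmax; have [] := D _ _ dd yd.
lra.
Qed.

Definition divz_re (p q : R -> R -> R) s t : R := (p s t * s + q s t * t) / (s ^+ 2 + t ^+ 2).
Definition divz_im (p q : R -> R -> R) s t : R := (q s t * s - p s t * t) / (s ^+ 2 + t ^+ 2).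

Lemma is_derive_frac (a b : R -> R) y (da db : R) : b y != 0 -> is_derive y 1 a da ->
  is_derive y 1 b db -> is_derive y 1 (fun y => a y / b y) ((da - a y / b y * db) / b y).
Proof.
move=> b0 Ha Hb; have Hc : is_derive y 1 (fun y => (b y)^-1) (- (b y)^-2 * db).
  exact: (is_deriveV (f := b)).
apply: (is_derive_eq (is_deriveM (f := a) (g := fun y => (b y)^-1) Ha Hc)).
by rewrite /GRing.scale /=; field.
Qed.

Lemma is_derive_mul_id (a : R -> R) (y da : R) : is_derive y 1 a da ->
  is_derive y 1 (fun y => a y * y) (da * y + a y).
Proof.
move=> Ha; apply: (is_derive_eq (is_deriveM (f := a) (g := id) Ha (is_derive_id _ _))).
by rewrite /GRing.scale /=; ring.
Qed.

Lemma is_derive_mul_cst (a : R -> R) (y da c : R) : is_derive y 1 a da ->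
  is_derive y 1 (fun y => a y * c) (da * c).
Proof.
move=> Ha; apply: (is_derive_eq (is_deriveM (f := a) (g := cst c) Ha (is_derive_cst _ _ _))).
by rewrite /GRing.scale /=; ring.
Qed.

Lemma is_derive_sqr1 (c y : R) : is_derive y 1 (fun y => y ^+ 2 + c) (2 * y).
Proof. by apply: is_derive_eq; rewrite /GRing.scale /=; ring. Qed.

Lemma is_derive_sqr2 (c y : R) : is_derive y 1 (fun y => c + y ^+ 2) (2 * y).
Proof. by apply: is_derive_eq; rewrite /GRing.scale /=; ring. Qed.

(* z g = h gives g' = (h' - g) / z *)
Lemma cderiv_divz p q p1 q1 s t : s ^+ 2 + t ^+ 2 != 0 -> cderiv p q p1 q1 s t ->
  let g s t := p1 s t - divz_re p q s t in let k s t := q1 s t - divz_im p q s t in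
  cderiv (divz_re p q) (divz_im p q) (divz_re g k) (divz_im g k) s t.
Proof.
move=> z0 [ps pt qs qt] g k.
have sp : is_derive s 1 (fun s => p s t * s + q s t * t) (p1 s t * s + p s t + q1 s t * t) :=
  is_deriveD (is_derive_mul_id ps) (is_derive_mul_cst t qs).
have tp : is_derive t 1 (fun t => p s t * s + q s t * t) (- q1 s t * s + (p1 s t * t + q s t)) :=
  is_deriveD (is_derive_mul_cst s pt) (is_derive_mul_id qt).
have sq : is_derive s 1 (fun s => q s t * s - p s t * t) (q1 s t * s + q s t - p1 s t * t) :=
  is_deriveB (is_derive_mul_id qs) (is_derive_mul_cst t ps).
have tq : is_derive t 1 (fun t => q s t * s - p s t * t) (p1 s t * s - (- q1 s t * t + p s t)) :=
  is_deriveB (is_derive_mul_cst s qt) (is_derive_mul_id pt).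
split.
- apply: (is_derive_eq (is_derive_frac (b := fun s => s ^+ 2 + t ^+ 2) z0 sp (is_derive_sqr1 _ _))).
  by rewrite /divz_re /g /k /divz_re /divz_im /=; field.
- apply: (is_derive_eq (is_derive_frac (b := fun t => s ^+ 2 + t ^+ 2) z0 tp (is_derive_sqr2 _ _))).
  by rewrite /divz_im /g /k /divz_re /divz_im /=; field.
- apply: (is_derive_eq (is_derive_frac (b := fun s => s ^+ 2 + t ^+ 2) z0 sq (is_derive_sqr1 _ _))).
  by rewrite /divz_im /g /k /divz_re /divz_im /=; field.
- apply: (is_derive_eq (is_derive_frac (b := fun t => s ^+ 2 + t ^+ 2) z0 tq (is_derive_sqr2 _ _))).
  by rewrite /divz_re /g /k /divz_re /divz_im /=; field.
Qed.

Lemma cderivB p q p1 q1 a b a1 b1 s t : cderiv p q p1 q1 s t -> cderiv a b a1 b1 s t ->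
  cderiv (fun s t => p s t - a s t) (fun s t => q s t - b s t)
    (fun s t => p1 s t - a1 s t) (fun s t => q1 s t - b1 s t) s t.
Proof.
move=> [p1' p2' p3' p4'] [a1' a2' a3' a4']; split.
- exact: (is_deriveB (f := p^~ t) (g := a^~ t)).
- by apply: (is_derive_eq (is_deriveB (f := p s) (g := a s) p2' a2')); ring.
- exact: (is_deriveB (f := q^~ t) (g := b^~ t)).
- exact: (is_deriveB (f := q s) (g := b s)).
Qed.

(** Two complex derivatives are recorded because the maximum principle uses second derivatives, and
    joint continuity because derivatives along the axes do not imply it. *)
Definition hol (D : set (R * R)) p q := exists p1 q1 p2 q2, forall s t, D (s, t) ->
  [/\ cderiv p q p1 q1 s t, cderiv p1 q1 p2 q2 s t,
      {for (s, t), continuous (fun z => p z.1 z.2)} &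
      {for (s, t), continuous (fun z => q z.1 z.2)}].

Lemma hol_sub D D' p q : D' `<=` D -> hol D p q -> hol D' p q.
Proof. by move=> DD [p1 [q1 [p2 [q2 H]]]]; exists p1, q1, p2, q2 => s t /DD /H. Qed.

Lemma hol_rot D p q : hol D p q -> hol D (fun s t => - q s t) p.
Proof.
move=> [p1 [q1 [p2 [q2 H]]]]; exists (fun s t => - q1 s t), p1, (fun s t => - q2 s t), p2 => s t Dst.
have [a b c d] := H s t Dst; split; [exact: cderiv_rot|exact: cderiv_rot| |exact: c].
exact: (continuousN d).
Qed.

(** For g = h / z the second derivative is (h'' - 2 g') / z. No third derivative of h enters, so
    [hol] is stable and the division can be iterated. *)
Lemma hol_divz D p q : (forall s t, D (s, t) -> s ^+ 2 + t ^+ 2 != 0) ->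
  hol D p q -> hol D (divz_re p q) (divz_im p q).
Proof.
move=> D0 [p1 [q1 [p2 [q2 H]]]].
pose g s t := p1 s t - divz_re p q s t; pose k s t := q1 s t - divz_im p q s t.
pose g1 s t := p2 s t - divz_re g k s t; pose k1 s t := q2 s t - divz_im g k s t.
exists (divz_re g k), (divz_im g k).
exists (divz_re (fun s t => g1 s t - divz_re g k s t) (fun s t => k1 s t - divz_im g k s t)).
exists (divz_im (fun s t => g1 s t - divz_re g k s t) (fun s t => k1 s t - divz_im g k s t)).
move=> s t Dst; have [a b c d] := H s t Dst; have z0 := D0 _ _ Dst.
have A := cderiv_divz z0 a.
have cs : {for (s, t), continuous (fun z : R * R => z.1)} by exact: cvg_fst.
have ct : {for (s, t), continuous (fun z : R * R => z.2)} by exact: cvg_snd.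
have cr : {for (s, t), continuous (fun z : R * R => (z.1 ^+ 2 + z.2 ^+ 2)^-1)}.
  apply: (@continuousV _ _ (fun z : R * R => z.1 ^+ 2 + z.2 ^+ 2)) => //.
  exact: (continuousD (continuousM cs cs) (continuousM ct ct)).
split.
- exact: A.
- exact: (cderiv_divz z0 (cderivB b A)).
- exact: (continuousM (continuousD (continuousM c cs) (continuousM d ct)) cr).
- exact: (continuousM (continuousB (continuousM d cs) (continuousM c ct)) cr).
Qed.

Lemma hol_divz_iter D p q N : (forall s t, D (s, t) -> s ^+ 2 + t ^+ 2 != 0) ->
  hol D p q -> exists P Q, hol D P Q /\ forall s t, D (s, t) ->
    (P s t ^+ 2 + Q s t ^+ 2) * (s ^+ 2 + t ^+ 2) ^+ N = p s t ^+ 2 + q s t ^+ 2.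
Proof.
move=> D0 H; elim: N => [|N [P [Q [HPQ E]]]].
  by exists p, q; split=> // s t _; rewrite expr0 mulr1.
exists (divz_re P Q), (divz_im P Q); split; first exact: hol_divz.
move=> s t Dst; rewrite -E// [(s ^+ 2 + t ^+ 2) ^+ N.+1]exprS mulrA.
have K (a b c d e : R) : e = c ^+ 2 + d ^+ 2 -> e != 0 ->
    (((a * c + b * d) / e) ^+ 2 + ((b * c - a * d) / e) ^+ 2) * e = a ^+ 2 + b ^+ 2.
  by move=> -> e0; field.
by rewrite (K (P s t) (Q s t) s t _ erefl (D0 _ _ Dst)).
Qed.

Lemma ring_open s t (lo hi : R) : lo < s ^+ 2 + t ^+ 2 -> s ^+ 2 + t ^+ 2 < hi ->
  exists2 d, 0 < d & forall s' t', `|s' - s| < d -> `|t' - t| < d ->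
    lo < s' ^+ 2 + t' ^+ 2 /\ s' ^+ 2 + t' ^+ 2 < hi.
Proof.
move=> lo1 hi1; set rho := s ^+ 2 + t ^+ 2 in lo1 hi1.
pose gap := Num.min (rho - lo) (hi - rho).
have gap0 : 0 < gap by rewrite lt_min !subr_gt0 lo1.
pose A := 2 * `|s| + 2 * `|t| + 2.
have A0 : 0 < A by rewrite ltr_wpDl// addr_ge0// mulr_ge0.
pose d := Num.min 1 (gap / (2 * A)).
have d0 : 0 < d by rewrite lt_min ltr01 divr_gt0// mulr_gt0.
have d1 : d <= 1 by rewrite ge_min lexx.
have dA : d * (2 * A) <= gap by rewrite -ler_pdivlMr ?mulr_gt0// ge_min lexx orbT.
have key (x y : R) : `|y - x| < d -> `|y ^+ 2 - x ^+ 2| <= d * (2 * `|x| + 1).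
  move=> yx; rewrite (_ : y ^+ 2 - x ^+ 2 = (y - x) * (y - x + 2 * x)); last by ring.
  rewrite normrM; apply: ler_pM => //; first exact: ltW.
  apply: le_trans (ler_normD _ _) _; rewrite normrM ger0_norm// addrC lerD2l.
  by apply: le_trans (ltW yx) d1.
exists d => // s' t' /key ss /key tt.
have : `|s' ^+ 2 + t' ^+ 2 - rho| < gap.
  rewrite (_ : _ - rho = (s' ^+ 2 - s ^+ 2) + (t' ^+ 2 - t ^+ 2)); last by rewrite /rho; ring.
  apply: le_lt_trans (ler_normD _ _) _; apply: le_lt_trans (lerD ss tt) _.
  rewrite (_ : _ + _ = d * A); last by rewrite /A; ring.
  by apply: lt_le_trans dA; rewrite ltr_pM2l// ltr_pMl// ltr1n.
rewrite ltr_norml lt_min => /andP[h1 /andP[_ h2]].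
have : gap <= rho - lo by rewrite ge_min lexx.
by split; lra.
Qed.

(** Multiplication by i exchanges real and imaginary parts up to sign, so the maximum principle
    applied to p, -q, -p and q bounds both absolute values. *)
Lemma max_modulus (K : set (R * R)) p q (m r : R) : compact K -> hol K p q ->
  (forall s t, K (s, t) -> s ^+ 2 + t ^+ 2 <= r) ->
  (forall s t, K (s, t) -> `|p s t| <= m /\ `|q s t| <= m \/
    exists2 d, 0 < d & forall s' t', `|s' - s| < d -> `|t' - t| < d -> K (s', t')) ->
  forall s t, K (s, t) -> `|p s t| <= m /\ `|q s t| <= m.
Proof.
move=> cK hK Kr H.
have MP p' q' : hol K p' q' -> (forall s t, `|p s t| <= m -> `|q s t| <= m -> p' s t <= m) ->
    forall s t, K (s, t) -> p' s t <= m.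
  move=> [p1 [q1 [p2 [q2 J]]]] B; apply: (max_principle (q := q') (p1 := p1) (q1 := q1)
    (p2 := p2) (q2 := q2) cK _ Kr).
    by apply: within_continuous_fun => -[s t] Kst; have [] := J s t Kst.
  move=> s t Kst; have [[a b]|[d d0 D]] := H s t Kst; [left; exact: B|right; exists d => //].
  by move=> s' t' ss tt; have K' := D _ _ ss tt; have [] := J _ _ K'; split.
have h1 := hol_rot hK; have h2 := hol_rot h1; have h3 := hol_rot h2.
move=> s t Kst; rewrite !ler_norml; split; apply/andP; split.
- rewrite lerNl; apply: (MP _ _ h2) Kst => s' t' a _.
  by apply: le_trans a; rewrite -normrN ler_norm.
- by apply: (MP _ _ hK) Kst => s' t' a _; apply: le_trans a; rewrite ler_norm.
- rewrite lerNl; apply: (MP _ _ h1) Kst => s' t' _ a.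
  by apply: le_trans a; rewrite -normrN ler_norm.
- have := MP _ _ h3 _ _ _ Kst; rewrite opprK; apply => s' t' _ a; rewrite opprK.
  by apply: le_trans a; rewrite ler_norm.
Qed.

Lemma ring_compact (lo hi : R) : compact [set z : R * R | lo <= z.1 ^+ 2 + z.2 ^+ 2 <= hi].
Proof.
pose B := `|hi| + 1.
have cB : compact (`[- B, B]%classic `*` `[- B, B]%classic : set (R * R)).
  by apply: compact_setX; exact: segment_compact.
apply: subclosed_compact cB _.
  have cq : continuous (fun z : R * R => z.1 ^+ 2 + z.2 ^+ 2).
    move=> z; have cs : {for z, continuous (fun z : R * R => z.1)} by exact: cvg_fst.
    have ct : {for z, continuous (fun z : R * R => z.2)} by exact: cvg_snd.
    exact: (continuousD (continuousM cs cs) (continuousM ct ct)).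
  rewrite (_ : mkset _ = (fun z : R * R => z.1 ^+ 2 + z.2 ^+ 2) @^-1` `[lo, hi]%classic).
    by apply: closed_comp; [move=> z _; exact: cq|exact: itv_closed].
  by apply/seteqP; split=> z /=; rewrite in_itv.
move=> z /= /andP[_ zh].
have B0 : 0 <= B by rewrite addr_ge0.
have key (x : R) : x ^+ 2 <= hi -> x \in `[- B, B].
  move=> xh; rewrite in_itv/= -ler_norml.
  rewrite -ler_sqr ?nnegrE// real_normK ?num_real//; apply: le_trans xh _.
  by have := ler_norm hi; rewrite /B; have := normr_ge0 hi; nra.
by split; apply: key; apply: le_trans zh; rewrite ?lerDl ?lerDr sqr_ge0.
Qed.

Lemma geometric_le0 (x C th : R) : 0 <= th -> th < 1 -> (forall N, x <= C * th ^+ N) -> x <= 0.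
Proof.
move=> th0 th1 H.
have cv : (fun N => C * th ^+ N) @ \oo --> C * 0.
  by apply: cvgMr; apply: cvg_expr; rewrite ger0_norm.
rewrite leNgt; apply/negP => x0.
have /cvgrPdist_lt/(_ _ x0)[N _ HN] := cv.
have := HN N (leqnn N); rewrite /= mulr0 sub0r normrN ltNge => /negP; apply.
by apply: le_trans (H N) _; rewrite ler_norm.
Qed.

(** An identity theorem without power series; [a] and [b] are squared radii. On the ring a/2 <=
    |z|^2 <= c the quotient of the function by z^N vanishes near the inner circle and has squared
    modulus at most M / c^N on the outer one. The maximum principle then bounds the squared modulus
    at the given point by 2 M (r0 / c)^N for every N, and r0 < c. *)
Lemma plane_identity p q (a b : R) : 0 < a ->
  hol [set z | z.1 ^+ 2 + z.2 ^+ 2 < b] p q ->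
  (forall s t, s ^+ 2 + t ^+ 2 < a -> p s t = 0 /\ q s t = 0) ->
  forall s t, s ^+ 2 + t ^+ 2 < b -> p s t = 0 /\ q s t = 0.
Proof.
move=> a0 H Z s0 t0; set r0 := s0 ^+ 2 + t0 ^+ 2 => r0b.
have [|ar0] := ltP r0 a; first exact: Z.
pose c := (r0 + b) / 2.
have [r0c cb] : r0 < c /\ c < b by rewrite /c; split; lra.
have c0 : 0 < c by apply: lt_trans r0c; exact: lt_le_trans ar0.
pose K := [set z : R * R | a / 2 <= z.1 ^+ 2 + z.2 ^+ 2 <= c].
have cK : compact K by exact: ring_compact.
have a2 : 0 < a / 2 by rewrite divr_gt0.
have Kn0 s t : K (s, t) -> s ^+ 2 + t ^+ 2 != 0.
  by move=> /andP[/= k _]; rewrite gt_eqF// (lt_le_trans a2).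
have hK : hol K p q by apply: hol_sub H => z /= /andP[_ k]; exact: le_lt_trans cb.
have [M M0 HM] : exists2 M, 0 < M & forall z, K z -> `|p z.1 z.2 ^+ 2 + q z.1 z.2 ^+ 2| <= M.
  apply: within_continuous_bounded cK _; apply: within_continuous_fun => -[s t] Kst.
  have [p1 [q1 [p2 [q2 J]]]] := hK; have [_ _ cp cq] := J s t Kst.
  exact: (continuousD (continuousM cp cp) (continuousM cq cq)).
have K0 : K (s0, t0).
  apply/andP; split => /=; last exact: ltW.
  by apply: le_trans ar0; rewrite ler_pdivrMr// ler_peMr ?(ltW a0)// ler1n.
have r00 : 0 <= r0 by rewrite addr_ge0 ?sqr_ge0.
have bound N : p s0 t0 ^+ 2 + q s0 t0 ^+ 2 <= 2 * M * (r0 / c) ^+ N.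
  have [P [Q [hPQ E]]] := hol_divz_iter N Kn0 hK.
  pose m := Num.sqrt (M / c ^+ N).
  have w0 : 0 <= M / c ^+ N by rewrite divr_ge0 ?exprn_ge0// ltW.
  have mm : m ^+ 2 = M / c ^+ N by rewrite sqr_sqrtr.
  have m0 : 0 <= m by exact: sqrtr_ge0.
  have small (x : R) : x ^+ 2 <= m ^+ 2 -> `|x| <= m.
    by move=> xm; rewrite -ler_sqr ?nnegrE// real_normK ?num_real.
  have [|s t /andP[/= k1 k2]|Pm Qm] := max_modulus (m := m) (r := c) cK hPQ _ _ K0.
  - by move=> s t /andP[].
  - have Kst : K (s, t) by apply/andP.
    have Est := E s t Kst.
    have [ka|ka] := ltP (s ^+ 2 + t ^+ 2) a.
      left; have [p0 q0] := Z s t ka.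
      move: Est; rewrite p0 q0 expr0n/= addr0 => /eqP; rewrite mulf_eq0 expf_eq0 (negbTE (Kn0 _ _ Kst)) andbF orbF.
      rewrite paddr_eq0 ?sqr_ge0// !sqrf_eq0 => /andP[/eqP -> /eqP ->].
      by rewrite normr0.
    have [kc|kc] := ltP (s ^+ 2 + t ^+ 2) c.
      right; have [|d d0 D] := @ring_open s t (a / 2) c _ kc.
        by apply: lt_le_trans ka; rewrite ltr_pdivrMr// ltr_pMr// ltr1n.
      exists d => // s' t' ss tt; have [/ltW d1 /ltW d2] := D _ _ ss tt; by apply/andP.
    left; have ec : s ^+ 2 + t ^+ 2 = c by apply/eqP; rewrite eq_le k2 kc.
    have PQ : P s t ^+ 2 + Q s t ^+ 2 <= m ^+ 2.
      rewrite mm ler_pdivlMr ?exprn_gt0// -ec Est.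
      by apply: le_trans (HM _ Kst); rewrite ler_norm.
    by split; apply: small; apply: le_trans PQ; rewrite ?lerDl ?lerDr sqr_ge0.
  rewrite -(E _ _ K0) expr_div_n mulrA.
  have sqm (x : R) : `|x| <= m -> x ^+ 2 <= m ^+ 2.
    by move=> xm; rewrite -(@real_normK _ x) ?num_real// ler_sqr ?nnegrE.
  have := lerD (sqm _ Pm) (sqm _ Qm); rewrite mm => L.
  rewrite -/r0 mulrAC; apply: le_trans (ler_wpM2r (exprn_ge0 N r00) L) _.
  by rewrite le_eqVlt; apply/orP; left; apply/eqP; ring.
have : p s0 t0 ^+ 2 + q s0 t0 ^+ 2 <= 0.
  apply: geometric_le0 bound; first by rewrite divr_ge0// ltW.
  by rewrite ltr_pdivrMr// mul1r.
have p0 := sqr_ge0 (p s0 t0); have q0 := sqr_ge0 (q s0 t0) => L.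
by split; apply/eqP; rewrite -sqrf_eq0 eq_le; apply/andP; split=> //; lra.
Qed.

Lemma plane_liouville p q : hol setT p q ->
  (forall e, 0 < e -> exists r, forall s t, r <= s ^+ 2 + t ^+ 2 -> `|p s t| <= e /\ `|q s t| <= e) ->
  forall s t, p s t = 0 /\ q s t = 0.
Proof.
move=> H V s0 t0.
have small e : 0 < e -> `|p s0 t0| <= e /\ `|q s0 t0| <= e.
  move=> e0; have [r Hr] := V e e0.
  pose c := Num.max r (s0 ^+ 2 + t0 ^+ 2).
  (* The lower bound -1 turns the ring into a full disc. *)
  have K0 : -1 <= s0 ^+ 2 + t0 ^+ 2 <= c.
    by rewrite le_max lexx orbT andbT (@le_trans _ _ 0)// ?addr_ge0 ?sqr_ge0// lerN10.
  apply: (max_modulus (r := c) (@ring_compact (-1) c) (hol_sub (@subsetT _ _) H) _ _ K0).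
    by move=> s t /andP[].
  move=> s t /andP[/= _ k]; have [kc|kc] := ltP (s ^+ 2 + t ^+ 2) c.
    right; have [|d d0 D] := @ring_open s t (-1) c _ kc.
      by apply: (@lt_le_trans _ _ 0); rewrite ?ltrN10// addr_ge0 ?sqr_ge0.
    by exists d => // s' t' ss tt; have [/ltW d1 /ltW d2] := D _ _ ss tt; apply/andP.
  by left; apply: Hr; apply: le_trans kc; rewrite le_max lexx.
by split; apply/eqP; rewrite -normr_le0; apply/ler_addgt0Pl => e /small[]; rewrite addr0.
Qed.

End PlaneHolomorphic.

(** * Vanishing on the exterior *)

Lemma seg_connected {R : realType} {n : nat} (A B : set 'rV[R]_n) (x v : 'rV[R]_n) :
  open A -> open B -> (forall y, A y -> ~ B y) ->
  (forall t, 0 <= t <= 1 -> A (x + t *: v) \/ B (x + t *: v)) -> A x -> A (x + v).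
Proof.
move=> oA oB dAB AB Ax.
pose f (t : R) : 'rV[R]_n := x + t *: v.
have cf : continuous f.
  move=> t; apply: cvgD; first exact: cvg_cst.
  by apply: cvgZr_tmp; exact: cvg_id.
have I01 : connected (`[0, 1]%classic : set R) by apply: segment_connected.
have := I01 (`[0, 1]%classic `&` f @^-1` A).
suff H : `[0, 1]%classic `&` f @^-1` A = `[0, 1]%classic.
  move=> _; have [_] : (`[0, 1]%classic `&` f @^-1` A) 1.
    by rewrite H /= in_itv/= ler01 lexx.
  by rewrite /f /= scale1r.
apply: I01.
- by exists 0; split; rewrite /= ?in_itv/= ?lexx ?ler01// /f scale0r addr0.
- by exists (f @^-1` A) => //; apply: open_comp => // t _; exact: cf.
- exists (~` (f @^-1` B)).
    by apply: open_closedC; apply: open_comp => // t _; exact: cf.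
  apply/seteqP; split=> t [t01]; split=> //; first by move=> Bt; exact: dAB Bt.
  by move: t01; rewrite /= in_itv/= => /AB[].
Qed.

Lemma inord4_eq (i j : nat) : (i < 4)%N -> (j < 4)%N -> ((inord i : 'I_4) == inord j) = (i == j).
Proof. by move=> i4 j4; rewrite -val_eqE /= !inordK. Qed.

Section ExteriorZero.
Context {R : realType}.
Variables (Omega : set (quat R)) (rho : quat R -> R).
Hypothesis drho : defining_function rho Omega.
Hypothesis bOmega : bounded_set Omega.
Hypothesis Omega0 : Omega !=set0.
Local Notation S := (boundary Omega).
Hypothesis cnS : connected S.
Local Notation E := (~` closure Omega).
Local Notation e_ k := ('e_(inord k) : quat R).

Variables (P Q : quat R -> R) (P1 Q1 : 'I_4 -> quat R -> R) (P2 Q2 : 'I_4 -> 'I_4 -> quat R -> R).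
Hypothesis gP : forall x, E x -> has_grad P x (fun b => P1 b x).
Hypothesis gQ : forall x, E x -> has_grad Q x (fun b => Q1 b x).
Hypothesis gP1 : forall b x, E x -> has_grad (P1 b) x (fun c => P2 b c x).
Hypothesis gQ1 : forall b x, E x -> has_grad (Q1 b) x (fun c => Q2 b c x).
Hypothesis symP : forall b c x, P2 b c x = P2 c b x.
Hypothesis symQ : forall b c x, Q2 b c x = Q2 c b x.
Definition cr_pair (i j : 'I_4) := forall x, E x -> P1 i x = Q1 j x /\ P1 j x = - Q1 i x.
Hypothesis CR01 : cr_pair (inord 0) (inord 1).
Hypothesis CR23 : cr_pair (inord 2) (inord 3).
Hypothesis decay : forall e, 0 < e -> exists r, forall x, r <= `|x| -> `|P x| <= e /\ `|Q x| <= e.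

Let oE : open E. Proof. by apply: closed_openC; exact: closed_closure. Qed.

Lemma slice_derive (f : quat R -> R) (df : 'I_4 -> R) x (i j : 'I_4) s t :
  has_grad f (x + s *: 'e_i + t *: 'e_j) df ->
  is_derive s 1 (fun s => f (x + s *: 'e_i + t *: 'e_j)) (df i) /\
  is_derive t 1 (fun t => f (x + s *: 'e_i + t *: 'e_j)) (df j).
Proof.
move=> [d g]; split; rewrite -g; last exact: is_derive_line.
rewrite (_ : (fun s => _) = (fun s => f ((x + t *: 'e_j) + s *: 'e_i))); last first.
  by apply/funext => s'; rewrite addrAC.
by rewrite addrAC; apply: is_derive_line; rewrite addrAC.
Qed.

(** Differentiating the Cauchy-Riemann equations in direction [i] and exchanging the second
    derivatives shows that the derivative is again holomorphic, which is the second clause of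
    [hol]. *)
Let CR2 i j : cr_pair i j -> forall x, E x -> P2 i j x = - Q2 i i x /\ P2 i i x = Q2 i j x.
Proof.
move=> CR x Ex; have nE : nbhs x E by apply: open_nbhs_nbhs.
split.
  have N : {near x, P1 j =1 (fun y => - 1 * Q1 i y)}.
    by apply: filterS nE => y Ey; rewrite mulN1r; have [_] := CR y Ey.
  rewrite symP -(gP1 j Ex).2 (near_eq_partial i N) ((has_gradZ (- 1) (gQ1 i Ex)).2 i).
  by rewrite mulN1r.
have N : {near x, P1 i =1 Q1 j} by apply: filterS nE => y Ey; have [] := CR y Ey.
by rewrite -(gP1 i Ex).2 (near_eq_partial i N) (gQ1 j Ex).2 symQ.
Qed.

Lemma slice_hol i j x (D : set (R * R)) : cr_pair i j ->
  (forall s t, D (s, t) -> E (x + s *: 'e_i + t *: 'e_j)) ->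
  hol D (fun s t => P (x + s *: 'e_i + t *: 'e_j)) (fun s t => Q (x + s *: 'e_i + t *: 'e_j)).
Proof.
move=> CR DE; pose g (f : quat R -> R) s t := f (x + s *: 'e_i + t *: 'e_j).
exists (g (P1 i)), (g (Q1 i)), (g (P2 i i)), (g (Q2 i i)) => s t /DE Ey.
have cg (f : quat R -> R) : differentiable f (x + s *: 'e_i + t *: 'e_j) ->
    {for (s, t), continuous (fun z : R * R => g f z.1 z.2)}.
  move=> /differentiable_continuous cf; apply: continuous_comp; last exact: cf.
  apply: cvgD; last by apply: cvgZr_tmp; exact: cvg_snd.
  by apply: cvgD; [exact: cvg_cst|apply: cvgZr_tmp; exact: cvg_fst].
have [a1 a2] := slice_derive (gP Ey); have [b1 b2] := slice_derive (gQ Ey).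
have [c1 c2] := slice_derive (gP1 i Ey); have [d1 d2] := slice_derive (gQ1 i Ey).
have [CR1 CRj] := CR _ Ey; have [CR3 CR4] := CR2 CR Ey.
split.
- by split; rewrite /g; [exact: a1|rewrite -CRj; exact: a2|exact: b1|rewrite CR1; exact: b2].
- by split; rewrite /g; [exact: c1|rewrite -CR3; exact: c2|exact: d1|rewrite CR4; exact: d2].
- by apply: cg; have [] := gP Ey.
- by apply: cg; have [] := gQ Ey.
Qed.

(** Local vanishing is open by definition; the identity theorem makes its complement in the exterior
    open too, so it propagates along paths in the exterior. *)
Definition zero_near (x : quat R) :=
  E x /\ exists2 d, 0 < d & forall v, `|v| < d -> P (x + v) = 0 /\ Q (x + v) = 0.

Definition slice_pt (x : quat R) (a b c d : R) : quat R :=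
  x + a *: e_ 0 + b *: e_ 1 + c *: e_ 2 + d *: e_ 3.

Lemma slice_pt_coord x a b c d :
  ((slice_pt x a b c d - x) 0 (inord 0) = a) * ((slice_pt x a b c d - x) 0 (inord 1) = b) *
  ((slice_pt x a b c d - x) 0 (inord 2) = c) * ((slice_pt x a b c d - x) 0 (inord 3) = d).
Proof. by rewrite !mxE /= !inord4_eq//=; split; [split; [split|]|]; ring. Qed.

Lemma slice_ptE x y : y = slice_pt x ((y - x) 0 (inord 0)) ((y - x) 0 (inord 1))
  ((y - x) 0 (inord 2)) ((y - x) 0 (inord 3)).
Proof.
rewrite -[y in LHS](subrKC x) [y - x in LHS]row_basis_sum sum_ord4 /slice_pt !addrA.
by [].
Qed.

Lemma slice_pt_norm x a b c d r : 0 < r -> a ^+ 2 + b ^+ 2 < r ^+ 2 -> c ^+ 2 + d ^+ 2 < r ^+ 2 ->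
  `|slice_pt x a b c d - x| < r.
Proof.
move=> r0 ab cd; apply: norm_row_lt => // i.
have key (u w : R) : u ^+ 2 + w ^+ 2 < r ^+ 2 -> `|u| < r.
  move=> uw; rewrite -ltr_sqr ?nnegrE ?(ltW r0)// real_normK ?num_real//.
  by apply: le_lt_trans uw; rewrite lerDl sqr_ge0.
have [] := ord4_cases i => ->; rewrite slice_pt_coord.
- exact: key ab.
- by apply: (@key b a); rewrite addrC.
- exact: key cd.
- by apply: (@key d c); rewrite addrC.
Qed.

(** The identity theorem is used in one complex variable at a time: in z_2 while z_1 stays near the
    centre, then in z_1 for each z_2 of the full disc. The parameter [r] is a squared radius. *)
Lemma polydisc_zero x r : zero_near x ->
  (forall a b c d, a ^+ 2 + b ^+ 2 < r -> c ^+ 2 + d ^+ 2 < r -> E (slice_pt x a b c d)) ->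
  forall a b c d, a ^+ 2 + b ^+ 2 < r -> c ^+ 2 + d ^+ 2 < r ->
    P (slice_pt x a b c d) = 0 /\ Q (slice_pt x a b c d) = 0.
Proof.
move=> [_ [del del0 Z]] HE a b c d abr cdr.
have del2 : 0 < del ^+ 2 by rewrite exprn_gt0.
have Z0 u v w y : u ^+ 2 + v ^+ 2 < del ^+ 2 -> w ^+ 2 + y ^+ 2 < del ^+ 2 ->
    P (slice_pt x u v w y) = 0 /\ Q (slice_pt x u v w y) = 0.
  by move=> uv wy; have := Z _ (slice_pt_norm x del0 uv wy); rewrite subrKC.
have Z1 u v : u ^+ 2 + v ^+ 2 < del ^+ 2 -> u ^+ 2 + v ^+ 2 < r ->
    forall w y, w ^+ 2 + y ^+ 2 < r -> P (slice_pt x u v w y) = 0 /\ Q (slice_pt x u v w y) = 0.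
  move=> uv uvr; apply: (plane_identity del2).
    by apply: (slice_hol CR23) => s t st; exact: HE.
  by move=> s t st; exact: Z0.
have swap u v w y : slice_pt x u v w y = (x + w *: e_ 2 + y *: e_ 3) + u *: e_ 0 + v *: e_ 1.
  by rewrite /slice_pt; apply/rowP => k; rewrite !mxE; ring.
have m0 : 0 < Num.min (del ^+ 2) r.
  by rewrite lt_min del2; apply: le_lt_trans abr; rewrite addr_ge0 ?sqr_ge0.
rewrite swap; apply: (plane_identity (p := fun u v => P ((x + c *: e_ 2 + d *: e_ 3) + u *: e_ 0 + v *: e_ 1))
  (q := fun u v => Q ((x + c *: e_ 2 + d *: e_ 3) + u *: e_ 0 + v *: e_ 1)) m0) abr.
  by apply: (slice_hol CR01) => s t st; rewrite -swap; exact: HE.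
by move=> s t; rewrite lt_min => /andP[s1 s2]; rewrite -swap; exact: Z1.
Qed.

Lemma zero_local x : E x -> exists2 d, 0 < d & (forall y, `|y - x| < d -> E y) /\
  forall y z, `|y - x| < d -> `|z - x| < d -> zero_near y -> zero_near z.
Proof.
move=> Ex; have /nbhs_rowP[d d0 Hd] : nbhs x E by apply: open_nbhs_nbhs.
have Hd' y : `|y - x| < d -> E y by move=> /Hd; rewrite subrKC.
(* For [y] within [k] of [x], the polydisc of radius 4 k about [y] stays within d = 5 k of [x] and
   contains all points within [k] of [x]. *)
pose k := d / 5.
have k0 : 0 < k by rewrite divr_gt0.
have kd : 5 * k = d by rewrite /k; field.
exists k => //; split; first by move=> y yk; apply: Hd'; lra.
move=> y z yk zk Zy.
have k4 : 0 < 4 * k by rewrite mulr_gt0.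
have H w : `|w - x| < k -> P w = 0 /\ Q w = 0.
  move=> wk; rewrite (slice_ptE y w).
  have wy : `|w - y| < 2 * k.
    rewrite (_ : w - y = (w - x) + (x - y)); last by rewrite addrA subrK.
    by apply: le_lt_trans (ler_normD _ _) _; rewrite (distrC x); lra.
  have c i : (w - y) 0 i ^+ 2 <= 4 * k ^+ 2.
    rewrite -[leLHS]real_normK ?num_real// (_ : 4 * k ^+ 2 = (2 * k) ^+ 2); last by ring.
    apply: ler_sqr_ge0 => //; apply: le_trans (norm_coord_le _ _) _; exact: ltW.
  have kk : 0 < k ^+ 2 by rewrite exprn_gt0.
  have k16 : (4 * k) ^+ 2 = 16 * k ^+ 2 by ring.
  apply: (polydisc_zero (r := (4 * k) ^+ 2)) => //.
  - move=> a b c' d' ab cd; apply: Hd'; have := slice_pt_norm y k4 ab cd => T.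
    rewrite (_ : slice_pt y a b c' d' - x = (slice_pt y a b c' d' - y) + (y - x)); last by rewrite addrA subrK.
    by apply: le_lt_trans (ler_normD _ _) _; lra.
  - by have := c (inord 0); have := c (inord 1); rewrite k16; lra.
  - by have := c (inord 2); have := c (inord 3); rewrite k16; lra.
split; first by apply: Hd'; lra.
exists (k - `|z - x|); first by rewrite subr_gt0.
move=> v vk; apply: H; rewrite addrAC; apply: le_lt_trans (ler_normD _ _) _; lra.
Qed.

Definition nonzero_near (x : quat R) := E x /\ ~ zero_near x.

Lemma open_zero_near : open (zero_near : set (quat R)).
Proof.
rewrite openE => x Zx; have [d d0 [_ H]] := zero_local Zx.1.
apply/nbhs_rowP; exists d => // v vd; apply: (H x); rewrite ?subrr ?normr0//.
by rewrite addrAC subrr add0r.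
Qed.

Lemma open_nonzero_near : open (nonzero_near : set (quat R)).
Proof.
rewrite openE => x Zx; have [d d0 [H1 H]] := zero_local Zx.1.
apply/nbhs_rowP; exists d => // v vd; have xv : `|x + v - x| < d by rewrite addrAC subrr add0r.
split; first exact: H1.
by move=> Zv; apply: Zx.2; apply: (H (x + v)) => //; rewrite subrr normr0.
Qed.

Lemma zero_segment x v : (forall t, 0 <= t <= 1 -> E (x + t *: v)) -> zero_near x ->
  zero_near (x + v).
Proof.
move=> xE; apply: (seg_connected open_zero_near open_nonzero_near).
  by move=> y Zy [_].
by move=> t t01; have [Z|Z] := pselect (zero_near (x + t *: v)); [left|right; split; [exact: xE|]].
Qed.

Let rho_gt0_E x : 0 < rho x -> E x.
Proof. by move=> r0 /(closure_rho_le0 drho); rewrite leNgt r0. Qed.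

(** Near [p0] the function [rho] increases along the normal, so two exterior points are joined by
    three segments: up by [s *: n], across inside a ball on which [rho] is positive, and down
    again. *)
Lemma exterior_local p0 : S p0 -> exists2 r, 0 < r & forall x y, E x -> E y ->
  `|x - p0| < r -> `|y - p0| < r -> zero_near x -> zero_near y.
Proof.
move=> Sp; have [r2 r20 [gnz gpos _]] := local_normal drho Sp ltr01.
pose n := unit_normal rho p0.
have n1 : `|n| <= 1.
  by apply: sqn_ball_le => //; rewrite expr1n sqn_unit_normal// (boundary_gradr drho).
have p00 : `|p0 - p0| < r2 by rewrite subrr normr0.
have npos x : `|x - p0| < r2 -> 0 < dot n (gradr rho x) by move=> xr; exact: gpos.
pose s := r2 / 4.
have s0 : 0 < s by rewrite divr_gt0.
have up x t : `|x - p0| < s -> 0 < t -> t <= s -> rho x < rho (x + t *: n).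
  move=> xs t0 ts; have [w /andP[w0 w1] Ew] := rho_MVT drho x (t *: n).
  rewrite -subr_gt0 Ew dotZl mulr_gt0//; apply: npos.
  rewrite addrAC; apply: le_lt_trans (ler_normD _ _) _.
  rewrite 2!normrZ (gtr0_norm w0) (gtr0_norm t0).
  have : w * (t * `|n|) <= s.
    rewrite -[leRHS]mul1r; apply: ler_pM; rewrite ?(ltW w0) ?(ltW w1)//.
      by rewrite mulr_ge0// ltW.
    by apply: le_trans ts; rewrite ler_piMr// ltW.
  by rewrite /s in xs *; lra.
pose q := p0 + s *: n.
have rq : 0 < rho q.
  by have := @up p0 s; rewrite (rho_boundary drho Sp) subrr normr0; apply.
have cq : {for q, continuous rho} by exact: (defining_continuous drho).
have rq2 : 0 < rho q / 2 by rewrite divr_gt0.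
have /continuous_rowP/(_ _ rq2)[d d0 Hd] := cq.
have qpos h : `|h| < d -> 0 < rho (q + h).
  by move=> /Hd; rewrite ler_norml => /andP[h1 _]; lra.
exists (Num.min s d); first by rewrite lt_min s0.
(* In the exterior [rho] is nonnegative, and a zero of [rho] this close to [p0] has nonzero
   gradient, hence lies on the boundary. *)
have Epos x : E x -> `|x - p0| < s -> 0 < rho x.
  move=> Ex xs; have xr : `|x - p0| < r2 by rewrite /s in xs; lra.
  rewrite lt_neqAle; apply/andP; split.
    apply/eqP => /esym r0; have [k /(rho0_boundary drho r0) Sx] := gradr_neq0_ex (gnz _ xr).
    by apply: Ex; exact: (boundary_closure drho Sx).
  rewrite leNgt; apply/negP => rx; apply: Ex; apply: subset_closure.
  by rewrite (defining_OmegaE drho).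
have col x t : E x -> `|x - p0| < s -> 0 <= t <= 1 -> E (x + t *: (s *: n)).
  move=> Ex xs /andP[t0 t1]; apply: rho_gt0_E; have rx := Epos x Ex xs.
  move: t0; rewrite le_eqVlt => /orP[/eqP <-|t0]; first by rewrite scale0r addr0.
  rewrite scalerA; apply: lt_trans rx _; apply: up => //; first by rewrite mulr_gt0.
  by rewrite ler_piMl// ltW.
move=> x y Ex Ey; rewrite !lt_min => /andP[xs xd] /andP[ys yd] Zx.
have Z1 : zero_near (x + s *: n) by apply: zero_segment Zx => t t01; exact: col.
have Z2 : zero_near (y + s *: n).
  rewrite (_ : y + s *: n = (x + s *: n) + (y - x)); last by apply/rowP => k; rewrite !mxE; ring.
  apply: zero_segment Z1 => t /andP[t0 t1]; apply: rho_gt0_E.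
  rewrite (_ : x + s *: n + t *: (y - x) = q + ((1 - t) *: (x - p0) + t *: (y - p0))); last first.
    by rewrite /q; apply/rowP => k; rewrite !mxE; ring.
  apply: qpos; apply: le_lt_trans (ler_normD _ _) _; rewrite !normrZ.
  rewrite (ger0_norm t0) ger0_norm ?subr_ge0//.
  move: t0; rewrite le_eqVlt => /orP[/eqP <-|t0]; first by rewrite subr0 mul1r mul0r addr0.
  have : t * `|y - p0| < t * d by rewrite ltr_pM2l.
  have : (1 - t) * `|x - p0| <= (1 - t) * d by rewrite ler_wpM2l ?subr_ge0// ltW.
  by lra.
rewrite -[y](addrK (s *: n)); apply: zero_segment Z2 => t /andP[t0 t1].
rewrite (_ : y + s *: n + t *: - (s *: n) = y + (1 - t) *: (s *: n)); last first.
  by apply/rowP => k; rewrite !mxE; ring.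
by apply: col => //; rewrite subr_ge0 t1 lerBlDr lerDl.
Qed.

Lemma exterior_limit p0 (d : R) : S p0 -> 0 < d -> exists2 x, E x & `|x - p0| < d.
Proof.
move=> Sp d0; have [r r0 [gnz gpos _]] := local_normal drho Sp ltr01.
pose n := unit_normal rho p0.
have n1 : `|n| <= 1.
  by apply: sqn_ball_le => //; rewrite expr1n sqn_unit_normal// (boundary_gradr drho).
pose t := Num.min d r / 2.
have m0 : 0 < Num.min d r by rewrite lt_min d0.
have t0 : 0 < t by rewrite divr_gt0.
have : t < Num.min d r by rewrite /t ltr_pdivrMr// ltr_pMr// ltr1n.
rewrite lt_min => /andP[td tr].
have tn : `|t *: n| <= t by rewrite normrZ gtr0_norm// ler_piMr// ltW.
exists (p0 + t *: n); last by rewrite addrAC subrr add0r; exact: le_lt_trans td.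
apply: rho_gt0_E; have [w /andP[w0 w1] Ew] := rho_MVT drho p0 (t *: n).
rewrite -[rho _]subr0 -[X in _ - X](rho_boundary drho Sp) Ew dotZl mulr_gt0//.
apply: gpos; last by rewrite subrr normr0.
rewrite addrAC subrr add0r normrZ (gtr0_norm w0); apply: le_lt_trans tr.
by apply: le_trans tn; rewrite ler_piMl// ltW.
Qed.

(** Otherwise [A] would be closed as well as open in the whole space, and the segment from a point
    of [A] to a point of [Omega] could not leave it. *)
Let touches (A B : set (quat R)) : open A -> open B -> (forall y, A y -> ~ B y) ->
  (forall y, E y <-> A y \/ B y) -> A !=set0 -> exists2 p, S p & closure A p.
Proof.
move=> oA oB dAB EAB [a Aa]; apply: contrapT => nS.
have clA : closed A.
  move=> x clx; apply: contrapT => nAx.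
  have [cx|Ex] := pselect (closure Omega x).
    have [Ox|Sx] := closure_OmegaU drho cx; last by apply: nS; exists x.
    have [y [Ay Oy]] := clx Omega (open_nbhs_nbhs (conj (defining_open drho) Ox)).
    by have : E y by [apply/EAB; left]; apply; exact: subset_closure.
  have [//|Bx] := (EAB x).1 Ex.
  by have [y [Ay By]] := clx B (open_nbhs_nbhs (conj oB Bx)); exact: dAB Ay By.
have [w Ow] := Omega0.
have Ao : A (a + (w - a)).
  apply: (seg_connected oA (closed_openC clA)) Aa; first by move=> y Ay; exact.
  by move=> t _; exact: EM.
rewrite subrKC in Ao; have : E w by apply/EAB; left.
by apply; exact: subset_closure.
Qed.

(** The complex lines on which z_1 is a constant with real part above [m] miss [Omega], so the
    function is entire on them and tends to 0. Together they fill an open half-space. *)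
Lemma zero_near_exists : zero_near !=set0.
Proof.
have [M [_ HM]] := bounded_closure bOmega.
pose m := `|M| + 1.
have Mm : M < m by apply: le_lt_trans (ler_norm M) _; rewrite ltrDl.
have m0 : 0 <= m by rewrite addr_ge0.
have far (y : quat R) : m < y 0 (inord 0) -> E y.
  move=> ym cy; have : `|y| <= m := HM m Mm y cy.
  rewrite leNgt => /negP; apply.
  by apply: lt_le_trans ym _; apply: le_trans (ler_norm _) _; exact: norm_coord_le.
have zero (y : quat R) : m < y 0 (inord 0) -> P y = 0 /\ Q y = 0.
  move=> ym.
  have H : hol setT (fun s t => P (y + s *: e_ 2 + t *: e_ 3)) (fun s t => Q (y + s *: e_ 2 + t *: e_ 3)).
    apply: (slice_hol CR23) => s t _; apply: far.
    by rewrite !mxE /= !inord4_eq//= !mulr0 !addr0.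
  have := plane_liouville H _ 0 0; rewrite !scale0r !addr0; apply.
  move=> e /decay[r Hr]; pose c := `|r| + `|y|.
  have c0 : 0 <= c by rewrite addr_ge0.
  exists (2 * (c + 1) ^+ 2) => s t st; apply: Hr; rewrite leNgt; apply/negP => zr.
  set z := y + _ + _ in zr.
  have key (u : R) k : u = z 0 k - y 0 k -> u ^+ 2 < (c + 1) ^+ 2.
    move=> uE; rewrite -[ltLHS]real_normK ?num_real// ltr_sqr ?nnegrE ?addr_ge0//.
    rewrite uE; apply: le_lt_trans (ler_normB _ _) _.
    have := norm_coord_le z k; have := norm_coord_le y k; have := ler_norm r.
    by rewrite /c; lra.
  have s2 : s ^+ 2 < (c + 1) ^+ 2.
    by apply: (key _ (inord 2)); rewrite /z !mxE /= !inord4_eq//=; ring.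
  have t2 : t ^+ 2 < (c + 1) ^+ 2.
    by apply: (key _ (inord 3)); rewrite /z !mxE /= !inord4_eq//=; ring.
  lra.
exists ((m + 1) *: e_ 0); split.
  by apply: far; rewrite !mxE /= inord4_eq//= mulr1 ltrDl.
exists 1 => // v v1; apply: zero; rewrite !mxE /= inord4_eq//= mulr1.
have := norm_coord_le v (inord 0); rewrite ler_norml => /andP[h _]; lra.
Qed.

(** Connectedness of the exterior is not given and is replaced by that of the boundary. The boundary
    points approached by [zero_near] form a nonempty closed set, open by [exterior_local], hence the
    whole boundary. A nonempty [nonzero_near] would also approach one of them, against
    [exterior_local]. *)
Lemma exterior_zero x : E x -> P x = 0 /\ Q x = 0.
Proof.
have EAB y : E y <-> zero_near y \/ nonzero_near y.
  split=> [Ey|[[]|[]]//]; have [|] := pselect (zero_near y); [by left|by right].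
have oZ := open_zero_near; have oN := open_nonzero_near.
have TS : S `&` closure zero_near = S.
  apply: cnS.
  - have [|p Sp cp] := touches oZ oN _ EAB zero_near_exists; first by move=> y Zy [].
    by exists p.
  (* Relative openness is witnessed by this interior; the point is that it contains every boundary
     point approached by [zero_near]. *)
  - exists (~` S `|` closure zero_near)°; first exact: open_interior.
    apply/seteqP; split=> p [Sp cp]; split=> //; last first.
      by case: (interior_subset cp).
    have [r r0 Hr] := exterior_local Sp.
    have [z [Zz zr]] : exists z, zero_near z /\ `|z - p| < r.
      have : nbhs p [set z | `|z - p| < r].
        by apply/nbhs_rowP; exists r => // h hr; rewrite /= addrAC subrr add0r.
      by move=> /cp[z [Zz zr]]; exists z.
    apply/nbhs_rowP; exists r => // h hr.
    have [Sh|] := pselect (S (p + h)); last by left.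
    right => B /nbhs_rowP[d d0 Hd].
    have m0 : 0 < Num.min d (r - `|h|) by rewrite lt_min d0 subr_gt0.
    have [y Ey yd] := exterior_limit Sh m0; exists y; split; last first.
      move: yd; rewrite lt_min => /andP[yd _].
      by rewrite -[y](subrKC (p + h)); exact: Hd.
    apply: (Hr z) => //; first exact: Zz.1.
    move: yd; rewrite lt_min => /andP[_ yd].
    rewrite (_ : y - p = (y - (p + h)) + h); last by apply/rowP => k; rewrite !mxE; ring.
    by apply: le_lt_trans (ler_normD _ _) _; lra.
  - by exists (closure zero_near) => //; exact: closed_closure.
move=> Ex; have [[_ [d d0 H]]|Nx] := (EAB x).1 Ex.
  by have := H 0; rewrite normr0 addr0; apply.
have [|||p Sp cp] := touches oN oZ _ _ _.
- by move=> y [_ nZ].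
- by move=> y; rewrite EAB; split=> -[]; [right|left|right|left].
- by exists x.
have [r r0 Hr] := exterior_local Sp.
have nb : nbhs p [set z | `|z - p| < r].
  by apply/nbhs_rowP; exists r => // h hr; rewrite /= addrAC subrr add0r.
have [_ cz] : (S `&` closure zero_near) p by rewrite TS.
have [z1 [Zz1 zr1]] := cz _ nb.
have [z2 [Zz2 zr2]] := cp _ nb.
by case: Zz2.2; apply: (Hr z1) => //; [exact: Zz1.1|exact: Zz2.1].
Qed.

End ExteriorZero.

(** With rows 0 and 1 zero only the right-hand sides survive, and they are the Cauchy-Riemann
    equations of component 2 + i component 3, in z_1 and in z_2. *)
Lemma cr_equations_a {R : realType} (D : 'I_4 -> 'I_4 -> R) : cr_equations D ->
  (forall b, D (inord 0) b = 0) -> (forall b, D (inord 1) b = 0) ->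
  (D (inord 2) (inord 0) = D (inord 3) (inord 1) /\
   D (inord 2) (inord 1) = - D (inord 3) (inord 0)) /\
  (D (inord 2) (inord 2) = D (inord 3) (inord 3) /\
   D (inord 2) (inord 3) = - D (inord 3) (inord 2)).
Proof. by move=> [e1 e2 e3 e4] Z0 Z1; rewrite !Z0 !Z1 in e1 e2 e3 e4; split; split; lra. Qed.

Lemma cr_equations_b {R : realType} (D : 'I_4 -> 'I_4 -> R) : cr_equations D ->
  (forall b, D (inord 2) b = 0) -> (forall b, D (inord 3) b = 0) ->
  (D (inord 0) (inord 0) = D (inord 1) (inord 1) /\
   D (inord 0) (inord 1) = - D (inord 1) (inord 0)) /\
  (D (inord 0) (inord 2) = D (inord 1) (inord 3) /\
   D (inord 0) (inord 3) = - D (inord 1) (inord 2)).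
Proof. by move=> [e1 e2 e3 e4] Z2 Z3; rewrite !Z2 !Z3 in e1 e2 e3 e4; split; split; lra. Qed.

(** * Decay at infinity and vanishing of all components *)

Section Decay.
Context {R : realType}.
Variables (Omega : set (quat R)) (rho : quat R -> R).
Variable sigma : {measure set (@borel R 4) -> \bar R}.
Hypothesis drho : defining_function rho Omega.
Hypothesis bOmega : bounded_set Omega.
Local Notation S := (boundary Omega).
Hypothesis surf : surface_measure S sigma.
Variable f : quat R -> quat R.
Hypothesis cf : forall i, {within S, continuous (fun x => f x 0 i)}.

Let cS : compact S. Proof. exact: boundary_compact drho bOmega. Qed.
Let finS : (sigma S < +oo)%E. Proof. exact: boundary_finite drho bOmega surf. Qed.
Local Notation U := (cauchy_potential Omega rho sigma f).
Local Notation U1 := (cauchy_potential1 Omega rho sigma f).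
Local Notation U2 := (cauchy_potential2 Omega rho sigma f).

(** The true order of decay is |v|^-3; the weaker 1/c is enough for a potential over a set of finite
    mass to tend to 0. *)
Lemma ker_le (a : 'I_4) (v : quat R) (c : R) : 1 <= c -> c <= `|v| -> `|ker a v| <= c^-1.
Proof.
move=> c1 cv; have c0 : 0 < c by exact: lt_le_trans c1.
have v0 : 0 < `|v| by exact: lt_le_trans cv.
have q2 : `|v| ^+ 2 <= sqn v by exact: sqn_ge_norm.
have q0 : 0 < sqn v by apply: lt_le_trans q2; rewrite exprn_gt0.
rewrite /ker /newton normrM (@ger0_norm _ (_ ^+ 2)) ?sqr_ge0// exprVn.
have v1 : 1 <= `|v| by exact: le_trans cv.
rewrite ler_pdivrMr ?exprn_gt0// ler_pdivlMl//.
apply: (@le_trans _ _ (`|v| * `|v|)).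
  by apply: ler_pM => //; [exact: ltW|exact: norm_coord_le].
rewrite -expr2; apply: le_trans q2 _.
rewrite expr2 ler_peMr ?(ltW q0)//; apply: le_trans (sqn_ge_norm v).
by rewrite expr_ge1// ltW.
Qed.

Lemma cauchy_potential_decay i (e : R) : 0 < e ->
  exists r, forall x, r <= `|x| -> `|U i x| <= e.
Proof.
move=> e0; have [B [_ HB]] := bounded_closure bOmega.
pose b := `|B| + 1.
have Sb z : S z -> `|z| <= b.
  move=> /(boundary_closure drho) cz; have : `|z| <= b := HB b _ z cz.
  by apply; apply: le_lt_trans (ler_norm B) _; rewrite ltrDl.
have dw a : {within S, continuous (density rho f i a)} by exact: (density_within drho cf).
pose M := \sum_a \int[sigma]_(z in S) `|density rho f i a z|.
have M0 : 0 <= M by apply: sumr_ge0 => a _; apply: Rintegral_ge0.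
pose c := 1 + M / e.
have c1 : 1 <= c by rewrite lerDl divr_ge0// ltW.
have c0 : 0 < c by exact: lt_le_trans c1.
exists (b + c) => x xr.
have far z : S z -> c <= `|x - z|.
  by move=> /Sb zb; have := lerB_dist x z; lra.
have nSx : ~ S x by move=> /Sb; lra.
apply: le_trans (ler_norm_sum _ _ _) _.
apply: (@le_trans _ _ (c^-1 * M)); last first.
  by rewrite ler_pdivrMl// /c mulrDl mul1r divfK ?gt_eqF// lerDr ltW.
rewrite mulr_sumr; apply: ler_sum => a _.
have cn := within_continuous_norm (dw a).
rewrite /potential -(sintZ cS finS _ cn); apply: (sint_norm_le cS finS).
- by apply: potential_within nSx => //; exact: ker_off0.
- by apply: within_continuousM => //; exact: within_continuous_cst.
by move=> z Sz; rewrite normrM ler_wpM2r// ker_le// far.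
Qed.

Hypothesis Omega0 : Omega !=set0.
Hypothesis cnS : connected S.
Local Notation E := (~` closure Omega).

Let ES x : E x -> ~ S x. Proof. by move=> Ex /(boundary_closure drho). Qed.

Let oE : open E. Proof. by apply: closed_openC; exact: closed_closure. Qed.

Let U1_zero i : (forall x, E x -> U i x = 0) -> forall b x, E x -> U1 i b x = 0.
Proof.
move=> U0 b x Ex; rewrite -(cauchy_potential_grad drho bOmega surf cf i (ES Ex)).2.
have N : {near x, U i =1 (fun=> 0)}.
  have : nbhs x E by apply: open_nbhs_nbhs.
  by apply: filterS => y /U0.
by rewrite (near_eq_partial b N) /partial derive_cst.
Qed.

Lemma exterior_pair (i j : nat) : (i < 4)%N -> (j < 4)%N ->
  cr_pair Omega (U1 (inord i)) (U1 (inord j)) (inord 0) (inord 1) ->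
  cr_pair Omega (U1 (inord i)) (U1 (inord j)) (inord 2) (inord 3) ->
  forall x, E x -> U (inord i) x = 0 /\ U (inord j) x = 0.
Proof.
move=> i4 j4 C01 C23; apply: (exterior_zero drho bOmega Omega0 cnS
    (P1 := U1 (inord i)) (Q1 := U1 (inord j)) (P2 := U2 (inord i)) (Q2 := U2 (inord j))) => //.
- by move=> x Ex; apply: (cauchy_potential_grad drho bOmega surf cf); exact: ES.
- by move=> x Ex; apply: (cauchy_potential_grad drho bOmega surf cf); exact: ES.
- by move=> b x Ex; apply: (cauchy_potential1_grad drho bOmega surf cf); exact: ES.
- by move=> b x Ex; apply: (cauchy_potential1_grad drho bOmega surf cf); exact: ES.
- by move=> b c x; exact: cauchy_potential2_sym.
- by move=> b c x; exact: cauchy_potential2_sym.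
move=> e e0; have [r Hr] := cauchy_potential_decay (inord i) e0.
have [s Hs] := cauchy_potential_decay (inord j) e0.
by exists (Num.max r s) => x; rewrite ge_max => /andP[/Hr ? /Hs ?].
Qed.

Let reg x (Ex : E x) := cauchy_potential_regular drho bOmega surf cf (ES Ex).

Lemma exterior_all_a : (forall x, E x -> U (inord 0) x = 0 /\ U (inord 1) x = 0) ->
  forall i x, E x -> U i x = 0.
Proof.
move=> Z; have Z0 := U1_zero (fun x Ex => (Z x Ex).1); have Z1 := U1_zero (fun x Ex => (Z x Ex).2).
have [e01 e23] : cr_pair Omega (U1 (inord 2)) (U1 (inord 3)) (inord 0) (inord 1) /\
    cr_pair Omega (U1 (inord 2)) (U1 (inord 3)) (inord 2) (inord 3).
  by split=> x Ex; have [] := cr_equations_a (reg Ex) (fun b => Z0 b x Ex) (fun b => Z1 b x Ex).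
have W := exterior_pair (isT : (2 < 4)%N) (isT : (3 < 4)%N) e01 e23.
move=> i x Ex; have [] := ord4_cases i => ->.
- exact: (Z x Ex).1.
- exact: (Z x Ex).2.
- exact: (W x Ex).1.
- exact: (W x Ex).2.
Qed.

Lemma exterior_all_b : (forall x, E x -> U (inord 2) x = 0 /\ U (inord 3) x = 0) ->
  forall i x, E x -> U i x = 0.
Proof.
move=> Z; have Z2 := U1_zero (fun x Ex => (Z x Ex).1); have Z3 := U1_zero (fun x Ex => (Z x Ex).2).
have [e01 e23] : cr_pair Omega (U1 (inord 0)) (U1 (inord 1)) (inord 0) (inord 1) /\
    cr_pair Omega (U1 (inord 0)) (U1 (inord 1)) (inord 2) (inord 3).
  by split=> x Ex; have [] := cr_equations_b (reg Ex) (fun b => Z2 b x Ex) (fun b => Z3 b x Ex).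
have W := exterior_pair (isT : (0 < 4)%N) (isT : (1 < 4)%N) e01 e23.
move=> i x Ex; have [] := ord4_cases i => ->.
- exact: (W x Ex).1.
- exact: (W x Ex).2.
- exact: (Z x Ex).1.
- exact: (Z x Ex).2.
Qed.

End Decay.

(** * From real components to quaternion-valued functions *)

Section RowValued.
Context {R : realType} {n m : nat}.
Implicit Types (g : 'I_m -> 'rV[R]_n -> R) (x : 'rV[R]_n).

Lemma row_continuous g x : (forall j, {for x, continuous (g j)}) ->
  {for x, continuous (fun y => \row_j g j y : 'rV[R]_m)}.
Proof.
move=> cg; have c : {for x, continuous (fun y => \sum_j `|g j y - g j x|)}.
  apply: for_continuous_sum => j.
  have c1 : {for x, continuous (fun y => g j y - g j x)}.
    by apply: continuousB; [exact: cg|exact: cst_continuous].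
  exact: (continuous_comp c1 (@norm_continuous _ _ _)).
have FF : Filter (nbhs x) by apply: nbhs_filter.
apply/(@cvgrPdist_le _ _ _ (nbhs x) FF) => e e0.
have /continuous_rowP/(_ _ e0)[d d0 Hd] := c.
apply/nbhs_rowP; exists d => // h /Hd.
rewrite [X in `|_ - X|]big1 ?subr0; last by move=> j _; rewrite subrr normr0.
rewrite ger0_norm; last by apply: sumr_ge0.
move=> H; rewrite distrC; apply: norm_row_le; first exact: ltW.
move=> j; rewrite !mxE; apply: le_trans H; rewrite (bigD1 j)//= lerDl.
by apply: sumr_ge0.
Qed.

Lemma row_differentiable g x : (forall j, differentiable (g j) x) ->
  differentiable (fun y => \row_j g j y : 'rV[R]_m) x.
Proof.
move=> dg; rewrite (_ : (fun y => _) = \sum_(j < m) (fun y => g j y *: ('e_j : 'rV[R]_m))).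
  by apply: differentiable_sum => j; exact: differentiableZl.
apply/funext => y; rewrite fct_sumE [LHS]row_basis_sum; apply: eq_bigr => j _.
by rewrite mxE.
Qed.

Lemma row_partial g x k : (forall j, differentiable (g j) x) ->
  partial k (fun y => \row_j g j y : 'rV[R]_m) x = \row_j partial k (g j) x.
Proof.
move=> dg; rewrite /partial derive_mx; last first.
  by apply: diff_derivable; exact: row_differentiable.
apply/rowP => j; rewrite !mxE (_ : (fun t => _) = g j)//; by apply/funext => y; rewrite mxE.
Qed.

Lemma row_C1 g (D : set 'rV[R]_n) : open D -> (forall j, C1_on D (g j)) ->
  C1_on D (fun y => \row_j g j y : 'rV[R]_m).
Proof.
move=> oD C1 x Dx; split; first by apply: row_differentiable => j; have [] := C1 j x Dx.
move=> k; have N : {near x, (fun y => \row_j partial k (g j) y) =1 partial k (fun y => \row_j g j y : 'rV[R]_m)}.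
  have : nbhs x D by apply: open_nbhs_nbhs.
  apply: filterS => y Dy; rewrite row_partial// => j; by have [] := C1 j y Dy.
have c : {for x, continuous (fun y => \row_j partial k (g j) y : 'rV[R]_m)}.
  by apply: row_continuous => j; have [_] := C1 j x Dx; exact.
rewrite /prop_for /continuous_at -(nbhs_singleton N).
by apply: cvg_trans c; exact: (near_eq_cvg N).
Qed.

End RowValued.

Section Regular.
Context {R : realType}.
Implicit Types (p : quat R).

Lemma zcoord_quat (a b : R[i]) : (zcoord 0 (quat_of a b) = a) * (zcoord 1 (quat_of a b) = b).
Proof.
have i0 : re_idx 0 = inord 0 by [].
rewrite /zcoord /quat_of !mxE /re_idx /im_idx !inordK//=.
by case: a => a1 a2; case: b.
Qed.

Lemma qmul_qi p : qmul (qi R) p = \row_(i < 4) [:: - p 0 (inord 1); p 0 (inord 0);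
  - p 0 (inord 3); p 0 (inord 2)]`_i.
Proof.
rewrite /qmul /qi !zcoord_quat; apply/rowP => i.
have [] := ord4_cases i => ->; rewrite !mxE !inordK//= /zcoord /=; ring.
Qed.

Lemma qmul_qj p : qmul (qj R) p = \row_(i < 4) [:: - p 0 (inord 2); p 0 (inord 3);
  p 0 (inord 0); - p 0 (inord 1)]`_i.
Proof.
rewrite /qmul /qj !zcoord_quat; apply/rowP => i.
have [] := ord4_cases i => ->; rewrite !mxE !inordK//= /zcoord /=; ring.
Qed.

Lemma psi_regular_row (D : set (quat R)) (g : 'I_4 -> quat R -> R) : open D ->
  (forall i, C1_on D (g i)) ->
  (forall x, D x -> cr_equations (fun i b => partial b (g i) x)) ->
  psi_regular D (fun x => \row_i g i x).
Proof.
move=> oD C1 CR; split; first exact: row_C1.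
move=> x Dx; have [e1 e2 e3 e4] := CR x Dx.
have d i : differentiable (g i) x by have [] := C1 i x Dx.
have idx : (re_idx 0 = inord 0) * (im_idx 0 = inord 1) * (re_idx 1 = inord 2) * (im_idx 1 = inord 3).
  by [].
have pk k : partial k (fun x => \row_i g i x) x = \row_j partial k (g j) x by exact: row_partial.
move: e1 e2 e3 e4 pk; set G := fun x => \row_i g i x.
pose h j k := partial k (g j) x; rewrite -!/(h _ _) => e1 e2 e3 e4 pk.
have {}pk k : partial k G x = \row_j h j k by exact: pk.
rewrite /qdbar !pk !idx; clearbody h; clear pk G d C1 CR.
rewrite qmul_qj !qmul_qi; apply/rowP => i.
have [] := ord4_cases i => ->; do ?[rewrite !mxE|rewrite !inordK//=]; lra.
Qed.

End Regular.

(** * The regular extension *)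

Lemma within_row_coord {R : realType} {n m : nat} (S : set 'rV[R]_n) (f : 'rV[R]_n -> 'rV[R]_m) i :
  {within S, continuous f} -> {within S, continuous (fun x => f x 0 i)}.
Proof.
by move=> cf x; apply: (@continuous_comp (subspace S) _ _ f (fun v : 'rV[R]_m => v 0 i)); [exact: cf|exact: coord_continuous].
Qed.

Lemma cr_equationsZ {R : realType} (c : R) (D : 'I_4 -> 'I_4 -> R) : cr_equations D ->
  cr_equations (fun i b => c * D i b).
Proof.
by move=> [e1 e2 e3 e4]; split; rewrite -?mulrDr -?mulrBr -?mulrN ?(e1, e2, e3, e4).
Qed.

Lemma C1_onZ {R : realType} {n : nat} (c : R) (U : set 'rV[R]_n) (u : 'rV[R]_n -> R) :
  open U -> C1_on U u -> C1_on U (fun x => c * u x).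
Proof.
move=> oU C1 x Ux.
have g y : U y -> has_grad (fun x => c * u x) y (fun k => c * partial k u y).
  by move=> Uy; apply: has_gradZ; split=> //; have [] := C1 y Uy.
split; first by have [] := g x Ux.
move=> k; have N : {near x, (fun y => c * partial k u y) =1 partial k (fun x => c * u x)}.
  have : nbhs x U by apply: open_nbhs_nbhs.
  by apply: filterS => y Uy; rewrite (g y Uy).2.
apply: near_eq_continuous_at N _; apply: continuousM; first exact: cst_continuous.
by have [_] := C1 x Ux; exact.
Qed.

Theorem theorem5 (R : realType) (Omega : set (quat R)) (rho : quat R -> R)
    (sigma : {measure set (@borel R 4) -> \bar R}) (f : quat R -> quat R) :
  defining_function rho Omega ->
  Omega !=set0 -> connected Omega -> bounded_set Omega ->
  connected (boundary Omega) ->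
  surface_measure (boundary Omega) sigma ->
  {within boundary Omega, continuous f} ->
  (forall phi : quat R -> R[i], harm1 Omega phi ->
     cintegral sigma (boundary Omega)
       (fun x => conjc (zcoord 0 (f x)) * dbar_n rho Omega phi x) =
     cintegral sigma (boundary Omega)
       (fun x => zcoord 1 (f x) * Lop rho Omega phi x))
  \/
  (forall phi : quat R -> R[i], harm1 Omega phi ->
     cintegral sigma (boundary Omega)
       (fun x => conjc (zcoord 1 (f x)) * dbar_n rho Omega phi x) =
     - cintegral sigma (boundary Omega)
         (fun x => zcoord 0 (f x) * Lop rho Omega phi x)) ->
  exists F : quat R -> quat R,
    [/\ psi_regular Omega F,
        {within closure Omega, continuous F} &
        forall x, boundary Omega x -> F x = f x].
Proof.
move=> drho O0 _ bO cnS surf cf H.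
have cfi i : {within boundary Omega, continuous (fun x => f x 0 i)} by exact: within_row_coord.
pose U := cauchy_potential Omega rho sigma f.
have E0 i x : ~ closure Omega x -> U i x = 0.
  case: H => H; [apply: exterior_all_a|apply: exterior_all_b] => // y Ey.
    by apply: exterior_zero_a => //; apply: H; exact: newton_test_harm1.
  by apply: exterior_zero_b => //; apply: H; exact: newton_test_harm1.
have pi2 : 0 < 2 * (pi : R) ^+ 2 by rewrite mulr_gt0// exprn_gt0// pi_gt0.
(* By the jump relation with zero exterior values, the interior limit of [U] is - 2 pi^2 times
   [f]. *)
pose c : R := - (2 * pi ^+ 2)^-1.
pose G x : quat R := \row_i (c * U i x).
have oO := defining_open drho.
have OS x : Omega x -> ~ boundary Omega x by move=> Ox /(boundary_notin drho).
have GR : psi_regular Omega G.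
  apply: (psi_regular_row (g := fun i x => c * U i x) oO) => [i|x Ox].
    apply: (C1_onZ c oO) => x Ox; apply: (cauchy_potential_C1 drho bO surf cfi); exact: OS.
  have P i b : partial b (fun y => c * U i y) x = c * cauchy_potential1 Omega rho sigma f i b x.
    exact: (has_gradZ c (cauchy_potential_grad drho bO surf cfi i (OS x Ox))).2.
  have -> : (fun i b => partial b (fun y => c * U i y) x) =
      (fun i b => c * cauchy_potential1 Omega rho sigma f i b x).
    by apply/funext => i; apply/funext => b; exact: P.
  by apply: cr_equationsZ; apply: cauchy_potential_regular => //; exact: OS.
(* The integral defining [U] is singular on the boundary, so the boundary values are imposed there
   and continuity of the glued function has to be proved. *)
pose F x := if x \in Omega then G x else f x.
have FO x : Omega x -> F x = G x by move=> Ox; rewrite /F mem_set.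
have FS x : boundary Omega x -> F x = f x.
  by move=> Sx; rewrite /F memNset//; exact: (boundary_notin drho Sx).
have nFG x : Omega x -> {near x, G =1 F}.
  move=> Ox; have : nbhs x Omega by apply: open_nbhs_nbhs.
  by apply: filterS => y /FO.
exists F; split; last exact: FS.
  case: GR => C1 eqn; split; first by apply: eq_C1_on oO _ C1 => x /FO.
  by move=> x Ox; rewrite /qdbar -!(near_eq_partial _ (nFG x Ox)); exact: eqn.
apply/subspace_continuousP => x cx.
change (F y @[y --> within (closure Omega) (nbhs x)] --> F x).
have [Ox|Sx] := closure_OmegaU drho cx.
  have cG : {for x, continuous G} by apply: differentiable_continuous; have [C1 _] := GR; have [] := C1 x Ox.
  rewrite (FO x Ox); apply: (cvg_trans _ cG).
  apply: cvg_trans (near_eq_cvg (nFG x Ox)); apply: cvg_app; exact: cvg_within.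
have FF : Filter (within (closure Omega) (nbhs x)) by apply: within_filter; apply: nbhs_filter.
rewrite (FS x Sx); apply/(@cvgrPdist_le _ _ _ _ FF) => e e0.
(* Points of the closure near the boundary point [x] are of two kinds: those on the boundary are
   handled by continuity of [f], those in [Omega] by the jump relation. *)
have cs : {within boundary Omega, continuous (fun z => \sum_i `|f z 0 i - f x 0 i|)}.
  apply: within_continuous_sum => i; apply: within_continuous_norm.
  by apply: within_continuousD => //; exact: within_continuous_cst.
have [d1 d10 H1] := within_near cs Sx e0.
have K i : exists2 eta, 0 < eta & forall y, Omega y -> `|y - x| < eta -> `|f x 0 i - c * U i y| <= e.
  have e1 : 0 < 2 * pi ^+ 2 * e by rewrite mulr_gt0.
  have [eta eta0 He] := cauchy_potential_jump drho bO surf cfi (E0 i) Sx e1.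
  exists eta => // y Oy /(He y Oy) L.
  rewrite (_ : f x 0 i - c * U i y = (2 * pi ^+ 2)^-1 * (U i y + 2 * pi ^+ 2 * f x 0 i)).
    by rewrite normrM gtr0_norm ?invr_gt0// ler_pdivrMl.
  by rewrite /c mulrDr mulKf ?gt_eqF// mulNr opprK addrC.
have [d2 d20 H2] : exists2 d, 0 < d & forall i y, Omega y -> `|y - x| < d -> `|f x 0 i - c * U i y| <= e.
  have [a a0 Ha] := K (inord 0); have [b b0 Hb] := K (inord 1).
  have [a' a'0 Ha'] := K (inord 2); have [b' b'0 Hb'] := K (inord 3).
  exists (Num.min (Num.min a b) (Num.min a' b')); first by rewrite !lt_min a0 b0 a'0.
  move=> i y Oy; rewrite !lt_min => /andP[/andP[ya yb] /andP[ya' yb']].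
  by have [] := ord4_cases i => ->; [exact: Ha|exact: Hb|exact: Ha'|exact: Hb'].
rewrite near_withinE; apply/nbhs_rowP; exists (Num.min d1 d2); first by rewrite lt_min d10.
move=> h; rewrite lt_min => /andP[h1 h2] cy.
have hx : x + h - x = h by rewrite addrAC subrr add0r.
apply: norm_row_le; first exact: ltW.
move=> i; rewrite [X in `|X|](_ : _ = f x 0 i - F (x + h) 0 i); last by rewrite !mxE.
have [Oy|Sy] := closure_OmegaU drho cy.
  by rewrite (FO _ Oy) mxE; apply: H2 => //; rewrite hx.
rewrite (FS _ Sy) distrC; have := H1 _ Sy; rewrite hx => /(_ h1).
rewrite [X in `|_ - X|]big1 ?subr0; last by move=> j _; rewrite subrr normr0.
rewrite ger0_norm; last by apply: sumr_ge0.
by apply: le_trans; rewrite (bigD1 i)//= lerDl; apply: sumr_ge0.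
Qed.
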